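(* Let $M$ be a smooth manifold of dimension $n$ with a singular Lie filtration $\mathfrak{X}_M=\mathcal{H}_{-r}\supseteq\cdots\supseteq\mathcal{H}_{-1}\supseteq 0$ of order $r$ (with $\mathcal{H}_0=0$), and let $N\subseteq M$ be a closed $\mathcal{H}_\bullet$-clean submanifold. Define a filtration $C^\infty_M=C^\infty_{M,(0)}\supseteq C^\infty_{M,(1)}\supseteq\cdots$ inductively by $C^\infty_{M,(1)}=\mathcal{I}$, the vanishing ideal sheaf of $N$, and for $i>1$ and $U\subseteq M$ open $$C^\infty(U)_{(i)}=\{f\in \mathcal{I}(U)\mid \forall\, 0<j<i,\ \forall X\in\mathcal{H}_{-j}(U):\ \mathcal{L}_Xf\in C^\infty(U)_{(i-j)}\}.$$ Then this filtration is a weighting of order $r$ along $N$, and the filtration of the normal bundle associated with this weighting is $$\nu(M,N)=F_{-r}\supseteq\cdots\supseteq F_{-1}\supseteq F_0=0,\qquad F_{-i}|_m=(T_mN+\mathcal{H}_{-i}|_m)/T_mN .$$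
   Context: $C^\infty_M$ and $\mathfrak{X}_M$ are the sheaves of smooth functions and of vector fields on $M$; $\nu(M,N)=TM|_N/TN$; $\mathcal{L}_Xf=Xf$. Singular Lie filtrations. A singular distribution on $M$ is a sheaf of $C^\infty_M$-submodules $\mathcal{D}\subseteq\mathfrak{X}_M$ that is locally finitely generated (every point has an open neighborhood $U$ such that $\mathcal{D}(U)$ is a finitely generated $C^\infty(U)$-module). Write $\mathcal{D}|_m\subseteq T_mM$ for the space of values at $m$ of local sections of $\mathcal{D}$ near $m$. A singular Lie filtration of order $r$ is a filtration $\mathfrak{X}_M=\mathcal{H}_{-r}\supseteq\mathcal{H}_{-r+1}\supseteq\cdots\supseteq\mathcal{H}_0\supseteq 0$ by singular distributions with $[\mathcal{H}_{-i},\mathcal{H}_{-j}]\subseteq\mathcal{H}_{-i-j}$ for all $i,j$ (with $\mathcal{H}_{-i}=\mathfrak{X}_M$ for $i\ge r$). Here $\mathcal{H}_0=0$. An embedded submanifold $N\subseteq M$ is $\mathcal{H}_\bullet$-clean if for every $i$ the dimension of $T_mN+\mathcal{H}_{-i}|_m$ is constant as a function of $m\in N$; then the $F_{-i}$ are subbundles of $\nu(M,N)$. Weightings. Let $w_1,\dots,w_n\in\mathbb{Z}_{\ge0}$ be a sequence of weights, with $w_a\le r$ for all $a$ (''order $r$''). For $U\subseteq\mathbb{R}^n$ open let $C^\infty(U)_{(i)}$ be the ideal in $C^\infty(U)$ generated by the monomials $x^s=x_1^{s_1}\cdots x_n^{s_n}$ with $s\cdot w=\sum_a s_aw_a\ge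 i$. A weighted atlas on $M$ is an atlas whose transition functions preserve these filtrations; a weighting of order $r$ is a maximal weighted atlas. A weighting determines (and is determined by) a filtration of $C^\infty_M$ by ideal sheaves $C^\infty_{M,(i)}$, given in charts of the weighted atlas by the description above; it is a weighting along the closed submanifold $N$ cut out in weighted charts by $x_a=0$ for all $a$ with $w_a>0$. A filtration of $C^\infty_M$ is said to be a weighting of order $r$ along $N$ if it arises in this way. The filtration of the normal bundle associated with a weighting along $N$ is the filtration $\nu(M,N)=F_{-r}\supseteq\cdots\supseteq F_0=0$ by subbundles such that for $i\ge1$ the image of $C^\infty_{M,(i+1)}$ in $\mathcal{I}/\mathcal{I}^2=\Gamma_{\nu(M,N)^*}$ is the sheaf of sections of the annihilator bundle $\mathrm{ann}(F_{-i})\subseteq\nu(M,N)^*$.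
   Formalization: It is additionally assumed that N has positive codimension or N = M: if N is a proper open and closed part of M (e.g. one of two components), or N is empty and n = 0, no single sequence of weights gives a weighting along N and the claim fails. *)

(* Defs.v *)
From HB Require Import structures.
From mathcomp Require Import all_boot all_order all_algebra.
From mathcomp Require Import all_classical all_reals all_analysis.
Import Order.TTheory GRing.Theory Num.Theory.
Import numFieldNormedType.Exports.

Set Implicit Arguments.
Unset Strict Implicit.
Unset Printing Implicit Defensive.

Local Open Scope classical_set_scope.
Local Open Scope ring_scope.

(* Functions, vector fields, ... on an open set U are represented by total
   functions of which only the restriction to U matters: every predicate below
   that takes an open set U is invariant under modification outside U. *)

Section Euclidean.
Context {R : realType} {n : nat}.
Local Notation E := ('rV[R]_n).

(* C^k on an open set V, through iterated partial derivatives. *)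
Fixpoint Ck (k : nat) (V : set E) (f : E -> R) : Prop :=
  (forall x, V x -> {for x, continuous f}) /\
  if k is k'.+1 then
    forall a : 'I_n, (forall x, V x -> derivable f x (delta_mx 0 a)) /\
                     Ck k' V ('D_(delta_mx 0 a) f)
  else True.

Definition Cinfty (V : set E) (f : E -> R) : Prop := forall k, Ck k V f.

(* C^oo(V)_(i): the ideal of C^oo(V) generated by the monomials x^s with
   s.w >= i. *)
Definition weighted_ideal (w : 'I_n -> nat) (V : set E) (i : nat)
    (g : E -> R) : Prop :=
  exists (k : nat) (s : 'I_k -> 'I_n -> nat) (h : 'I_k -> E -> R),
  [/\ forall l, (i <= \sum_(a < n) s l a * w a)%N,
      forall l, Cinfty V (h l) &
      forall x, V x ->
        g x = \sum_(l < k) h l x * \prod_(a < n) x 0 a ^+ s l a].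

End Euclidean.

Section Charts.
Context {R : realType} {n : nat} {M : topologicalType}.

Record chart := Chart {
  cdom : set M;
  cmap : M -> 'rV[R]_n;
  cinv : 'rV[R]_n -> M;
  cdom_open : open cdom;
  cimg_open : open (cmap @` cdom);
  cmapK : forall m, cdom m -> cinv (cmap m) = m;
  cmap_cont : forall m, cdom m -> {for m, continuous cmap};
  cinv_cont : forall x, (cmap @` cdom) x -> {for x, continuous cinv} }.

Definition overlap (c c' : chart) : set 'rV[R]_n :=
  cmap c @` (cdom c `&` cdom c').

Definition transition (c c' : chart) : 'rV[R]_n -> 'rV[R]_n :=
  cmap c' \o cinv c.

Definition compatible (c c' : chart) : Prop :=
  (forall a, Cinfty (overlap c c') (fun x => transition c c' x 0 a)) /\
  (forall a, Cinfty (overlap c' c) (fun x => transition c' c x 0 a)).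

End Charts.
Arguments chart : clear implicits.

Record smooth_manifold (R : realType) (n : nat) := SmoothManifold {
  carrier :> topologicalType;
  man_hausdorff : hausdorff_space carrier;
  man_second_countable : @second_countable carrier;
  atlas : set (chart R n carrier);
  atlas_cover : forall m, exists2 c, atlas c & cdom c m;
  atlas_compatible : forall c c', atlas c -> atlas c' -> compatible c c' }.

Section Dimension.
Context {R : realType} {V : lmodType R}.

Definition lin_indep k (b : 'I_k -> V) : Prop :=
  forall a : 'I_k -> R, \sum_(j < k) a j *: b j = 0 -> forall j, a j = 0.

Definition lin_span k (b : 'I_k -> V) : set V :=
  [set v | exists a : 'I_k -> R, v = \sum_(j < k) a j *: b j].

Definition has_dim (S : set V) (k : nat) : Prop :=
  exists b : 'I_k -> V, lin_indep b /\ S = lin_span b.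

Definition sum_space (A B : set V) : set V :=
  [set v | exists a b, [/\ A a, B b & v = a + b]].

End Dimension.

Section Manifold.
Context {R : realType} {n : nat} {M : smooth_manifold R n}.

(* Membership in the maximal atlas. *)
Definition smooth_chart (c : chart R n M) : Prop :=
  forall c', atlas c' -> compatible c c'.

Definition smooth (U : set M) (f : M -> R) : Prop :=
  forall c, atlas c -> Cinfty (cmap c @` (cdom c `&` U)) (f \o cinv c).

Definition smooth_near (m : M) (f : M -> R) : Prop :=
  exists U, [/\ open U, U m & smooth U f].

Definition tvec : lmodType R := ((M -> R) -> R^o)%type.

(* T_mM: derivations at m of the algebra of germs at m of smooth functions.
   The value on functions that are not smooth near m carries no information
   and is normalized to 0. *)
Definition tangent (m : M) (v : tvec) : Prop :=
  [/\ forall f g (a : R), smooth_near m f -> smooth_near m g ->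
        v (fun p => a * f p + g p) = a * v f + v g,
      forall f g, smooth_near m f -> smooth_near m g ->
        v (fun p => f p * g p) = f m * v g + g m * v f,
      forall f g, smooth_near m f -> smooth_near m g ->
        (\forall p \near m, f p = g p) -> v f = v g &
      forall f, ~ smooth_near m f -> v f = 0].

Definition lieD (X : M -> tvec) (f : M -> R) : M -> R := fun m => X m f.

Definition vfield (U : set M) (X : M -> tvec) : Prop :=
  (forall m, U m -> tangent m (X m)) /\
  (forall V f, open V -> V `<=` U -> smooth V f -> smooth V (lieD X f)).

Definition lie_bracket (X Y : M -> tvec) : M -> tvec :=
  fun m f => if `[< smooth_near m f >]
             then X m (lieD Y f) - Y m (lieD X f) else 0.

(* A sheaf of C^oo-submodules of the sheaf of vector fields that is locally
   finitely generated.  Since sections are total functions, compatible local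
   sections are always the restrictions of one function X, which is why sd_glue
   mentions a single X. *)
Record singular_distribution (D : set M -> set (M -> tvec)) : Prop := {
  sd_vfield : forall U X, open U -> D U X -> vfield U X;
  sd_ext : forall U X Y, open U -> D U X ->
    (forall m, U m -> X m = Y m) -> D U Y;
  sd_res : forall U V X, open U -> open V -> V `<=` U -> D U X -> D V X;
  sd_glue : forall U X, open U ->
    (forall m, U m -> exists V, [/\ open V, V m, V `<=` U & D V X]) -> D U X;
  sd_zero : forall U, open U -> D U (fun=> 0);
  sd_add : forall U X Y, open U -> D U X -> D U Y ->
    D U (fun m => X m + Y m);
  sd_scale : forall U f X, open U -> smooth U f -> D U X ->
    D U (fun m => f m *: X m);
  sd_fg : forall m, exists U, [/\ open U, U m &
    exists (k : nat) (X : 'I_k -> M -> tvec), (forall j, D U (X j)) /\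
      forall Y, D U Y -> exists f : 'I_k -> M -> R,
        (forall j, smooth U (f j)) /\
        (forall p, U p -> Y p = \sum_(j < k) f j p *: X j p)] }.

(* H i stands for H_{-i}. *)
Record singular_lie_filtration (r : nat)
    (H : nat -> set M -> set (M -> tvec)) : Prop := {
  slf_distribution : forall i, singular_distribution (H i);
  slf_top : forall i U X, (r <= i)%N -> open U -> (H i U X <-> vfield U X);
  slf_decr : forall i U, open U -> H i U `<=` H i.+1 U;
  slf_bracket : forall i j U X Y, open U -> H i U X -> H j U Y ->
    H (i + j)%N U (lie_bracket X Y) }.

Definition zero_distribution (D : set M -> set (M -> tvec)) : Prop :=
  forall U X, open U -> (D U X <-> forall m, U m -> X m = 0).

(* D|_m *)
Definition values_at (D : set M -> set (M -> tvec)) (m : M) : set tvec :=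
  [set v | exists U X, [/\ open U, U m, D U X & v = X m]].

Definition embedded_submanifold (d : nat) (N : set M) : Prop :=
  (d <= n)%N /\ forall m, N m -> exists c : chart R n M,
    [/\ smooth_chart c, cdom c m &
        forall p, cdom c p ->
          (N p <-> forall a : 'I_n, (d <= a)%N -> cmap c p 0 a = 0)].

(* Image of T_mN in T_mM.  The germs of smooth functions on N are the
   restrictions to N of germs of smooth functions on M, so a derivation of the
   former is a derivation of the latter that only depends on restrictions. *)
Definition tangent_sub (N : set M) (m : M) : set tvec :=
  [set v | tangent m v /\
    forall f g, smooth_near m f -> smooth_near m g ->
      (\forall p \near m, N p -> f p = g p) -> v f = v g].

Definition clean (H : nat -> set M -> set (M -> tvec)) (N : set M) : Prop :=
  forall i, exists k, forall m, N m ->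
    has_dim (sum_space (tangent_sub N m) (values_at (H i) m)) k.

Definition vanishing_ideal (N U : set M) (f : M -> R) : Prop :=
  smooth U f /\ forall m, U m -> N m -> f m = 0.

Definition vanishing_ideal_sq (N U : set M) (f : M -> R) : Prop :=
  exists (k : nat) (g h : 'I_k -> M -> R),
  [/\ forall l, vanishing_ideal N U (g l),
      forall l, vanishing_ideal N U (h l) &
      forall m, U m -> f m = \sum_(l < k) g l m * h l m].

(* The recursive definition of C^oo(U)_(i), as a least predicate: since i - j
   is smaller than i, it is the unique one satisfying the three clauses. *)
Inductive lie_ideal (H : nat -> set M -> set (M -> tvec)) (N : set M) :
    nat -> set M -> (M -> R) -> Prop :=
  | lie_ideal0 U f : smooth U f -> lie_ideal H N 0 U f
  | lie_ideal1 U f : vanishing_ideal N U f -> lie_ideal H N 1 U f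
  | lie_idealS i U f : (1 < i)%N -> vanishing_ideal N U f ->
      (forall j X, (0 < j < i)%N -> H j U X ->
        lie_ideal H N (i - j)%N U (lieD X f)) ->
      lie_ideal H N i U f.

(* An atlas of M whose transition functions preserve the filtrations
   C^oo(V)_(i) of the structure sheaf of R^n. *)
Definition weighted_atlas (w : 'I_n -> nat) (A : set (chart R n M)) : Prop :=
  [/\ A `<=` smooth_chart,
      forall m, exists2 c, A c & cdom c m &
      forall c c', A c -> A c' -> forall i V g, open V -> V `<=` overlap c' c ->
        weighted_ideal w V i g ->
        weighted_ideal w (overlap c c' `&` transition c c' @^-1` V) i
          (g \o transition c c')].

Definition weighting (w : 'I_n -> nat) (A : set (chart R n M)) : Prop :=
  weighted_atlas w A /\ forall B, weighted_atlas w B -> A `<=` B -> B = A.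

Definition weighting_ideal (w : 'I_n -> nat) (A : set (chart R n M))
    (i : nat) (U : set M) (f : M -> R) : Prop :=
  smooth U f /\ forall c, A c ->
    weighted_ideal w (cmap c @` (cdom c `&` U)) i (f \o cinv c).

(* The filtration C is a weighting of order r along N. *)
Definition is_weighting_along (r : nat) (N : set M)
    (C : nat -> set M -> (M -> R) -> Prop) : Prop :=
  exists (w : 'I_n -> nat) (A : set (chart R n M)),
  [/\ forall a, (w a <= r)%N,
      weighting w A,
      forall i U f, open U -> (C i U f <-> weighting_ideal w A i U f) &
      forall c, A c -> forall m, cdom c m ->
        (N m <-> forall a, (0 < w a)%N -> cmap c m 0 a = 0)].

(* The class v + T_mN in T_mM / T_mN; the zero vector is T_mN itself. *)
Definition normal_class (N : set M) (m : M) (v : tvec) : set tvec :=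
  [set u | tangent_sub N m (u - v)].

Definition normal_space (N : set M) (m : M) : set (set tvec) :=
  normal_class N m @` tangent m.

(* A smooth subbundle of nu(M,N): local frames are given by classes of vector
   fields, since sections of nu(M,N) lift locally to vector fields on M. *)
Definition normal_subbundle (N : set M) (F : M -> set (set tvec)) : Prop :=
  forall m0, N m0 -> exists U, [/\ open U, U m0 &
    exists (k : nat) (X : 'I_k -> M -> tvec), (forall j, vfield U (X j)) /\
      forall m, U m -> N m ->
        (forall a : 'I_k -> R, tangent_sub N m (\sum_(j < k) a j *: X j m) ->
           forall j, a j = 0) /\
        F m = normal_class N m @` lin_span (fun j => X j m)].

(* f in I(U) defines the section [v] |-> v f of nu(M,N)^* over N `&` U. *)
Definition annihilates (N U : set M) (F : M -> set (set tvec)) (f : M -> R) :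
    Prop :=
  forall m, U m -> N m -> forall q, F m q -> forall v, q v -> v f = 0.

(* The class of f in I/I^2 belongs to the image of the sheaf C. *)
Definition in_conormal_image (N : set M) (C : set M -> (M -> R) -> Prop)
    (U : set M) (f : M -> R) : Prop :=
  forall m, U m -> exists V, [/\ open V, V m, V `<=` U &
    exists2 g, C V g & vanishing_ideal_sq N V (fun p => f p - g p)].

(* F i stands for F_{-i}; the convention F_{-i} = nu(M,N) for i >= r gives a
   meaning to the last clause for all i. *)
Record normal_filtration_of (r : nat) (N : set M)
    (C : nat -> set M -> (M -> R) -> Prop) (F : nat -> M -> set (set tvec)) :
    Prop := {
  nf_top : forall i m, (r <= i)%N -> N m -> F i m = normal_space N m;
  nf_zero : forall m, N m -> F 0%N m = [set normal_class N m 0];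
  nf_decr : forall i m, N m -> F i m `<=` F i.+1 m;
  nf_subbundle : forall i, normal_subbundle N (F i);
  nf_ann : forall i U f, (0 < i)%N -> open U -> vanishing_ideal N U f ->
    (in_conormal_image N (C i.+1) U f <-> annihilates N U (F i) f) }.

Definition lie_normal_filtration (H : nat -> set M -> set (M -> tvec))
    (N : set M) (i : nat) (m : M) : set (set tvec) :=
  normal_class N m @` sum_space (tangent_sub N m) (values_at (H i) m).

End Manifold.

(* Main.v *)
Require Import Defs.
From HB Require Import structures.
From mathcomp Require Import all_boot all_order all_algebra.
From mathcomp Require Import all_classical all_reals all_analysis.
From mathcomp Require Import ring lra zify.
Import Order.TTheory GRing.Theory Num.Theory.
Import numFieldNormedType.Exports.

Set Implicit Arguments.
Unset Strict Implicit.
Unset Printing Implicit Defensive.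

Local Open Scope classical_set_scope.
Local Open Scope ring_scope.

(* Unfolding its recursion, the ideal [lie_ideal H N i] consists of the smooth
   functions [f] such that [X_1 ... X_k f] vanishes on [N] for all sections [X_l]
   of [H_(-j_l)] with [j_l > 0] and [j_1 + ... + j_k < i].  Cleanness yields near
   each point of [N] vector fields [Z_b] in [H_(-w_b)] that frame the filtration
   transversally to [N], where [dim (TN + H_(-i))] counts the weights [w_a <= i].
   Since brackets respect the weights, it suffices to test membership on the
   compositions of the [Z_b] taken in increasing order.  Straightening fibrewise
   linearly gives coordinates with [Z_a x_b = delta_ab] on [N], and subtracting
   from [x_a] a polynomial in the transverse coordinates of smaller weight makes
   all the tests on [x_a] below weight [w_a] vanish (Bellaiche's construction of
   privileged coordinates).  In such coordinates monomials of weight at least [i]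
   lie in [lie_ideal H N i]; conversely, [Z_b f = \sum_a (Z_b x_a) d_a f] controls
   the derivatives [d_b f] by descending induction on [w_b], and Hadamard's lemma
   then places [f] in the weighted ideal by induction on [i].  No flow and no
   inverse function theorem is needed: all coordinate changes are triangular. *)

(** * Calculus of smooth functions *)

(** Two mismatches shape the proof. [lie_ideal] on [U] tests against sections over [U], so a smaller
    open set has more tests; sections are extended by bump functions, which exist because the
    manifold is Hausdorff. And [weighted_ideal] asks for one finite expansion over the whole open
    set, so local expansions have to be glued; this works because a finite set of monomials, fixed
    by the weights and the order, suffices. The fields [Z_b] do not commute and are dual to the
    coordinates on [N] only, so their compositions are not iterated partial derivatives. Exchanging
    two factors produces a bracket of the same total weight that is one factor shorter, as in the
    Poincaré-Birkhoff-Witt theorem, and on monomials [Z_b] acts as a partial derivative up to higher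
    powers of the vanishing ideal. The maximal weighted atlas is not obtained by enlarging an atlas:
    it consists of all charts in which the intrinsic ideals become the weighted ones, which makes
    compatibility and maximality formal. *)

Section CkCalculus.
Context {R : realType} {n : nat}.
Local Notation E := ('rV[R]_n).
Local Notation e_ a := (delta_mx 0 a : E).
Implicit Types (V : set E) (f g : E -> R).

Lemma near_eq_continuous (T U : topologicalType) (f g : T -> U) (x : T) :
  (\forall y \near x, f y = g y) -> {for x, continuous f} ->
  {for x, continuous g}.
Proof.
move=> S cf; have fgx : f x = g x := nbhs_singleton S.
have cfx : f y @[y --> x] --> f x := cf; rewrite fgx in cfx.
have : g y @[y --> x] --> g x; last by [].
by move=> A /cfx fA; apply: filterS2 S fA => y /= <-.
Qed.

Lemma Ck_ext k V f g : (forall x, V x -> \forall y \near x, f y = g y) ->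
  Ck k V f -> Ck k V g.
Proof.
elim: k f g => [|k IH] f g fg /= [cf df]; split.
- by move=> x Vx; apply: near_eq_continuous (cf x Vx); exact: fg.
- by [].
- by move=> x Vx; apply: near_eq_continuous (cf x Vx); exact: fg.
- move=> a; have [d1 d2] := df a; split.
    by move=> x Vx; apply: near_eq_derivable (d1 x Vx); exact: fg.
  apply: IH d2 => x Vx; have := fg x Vx; rewrite -nbhs_nearE nbhsE => -[U [oU Ux UV]].
  rewrite -nbhs_nearE nbhsE; exists U => // y Uy; apply: near_eq_derive.
  by rewrite -nbhs_nearE nbhsE; exists U.
Qed.

Lemma Cinfty_ext V f g : (forall x, V x -> \forall y \near x, f y = g y) ->
  Cinfty V f -> Cinfty V g.
Proof. by move=> fg cf k; apply: Ck_ext fg (cf k). Qed.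

Lemma eq_Cinfty V f g : open V -> (forall x, V x -> f x = g x) ->
  Cinfty V f -> Cinfty V g.
Proof.
move=> oV fg; apply: Cinfty_ext => x Vx; rewrite -nbhs_nearE nbhsE.
by exists V => // y /fg.
Qed.

Lemma eq_Ck k V f g : open V -> (forall x, V x -> f x = g x) ->
  Ck k V f -> Ck k V g.
Proof.
move=> oV fg; apply: Ck_ext => x Vx; rewrite -nbhs_nearE nbhsE.
by exists V => // y /fg.
Qed.

(** [U] need not be open: [Ck] is a conjunction of pointwise conditions on the iterated derivatives
    of the total function [f]. *)
Lemma Ck_local k V f : (forall x, V x -> exists2 U, U x & Ck k U f) ->
  Ck k V f.
Proof.
elim: k f => [|k IH] f H /=; split => //.
- by move=> x /H[U Ux [+ _]]; exact.
- by move=> x /H[U Ux [+ _]]; exact.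
- move=> a; split; first by move=> x /H[U Ux [_ /(_ a)[+ _]]]; exact.
  by apply: IH => x /H[U Ux [_ /(_ a)[_ ?]]]; exists U.
Qed.

Lemma Cinfty_local V f : (forall x, V x -> exists2 U, U x & Cinfty U f) ->
  Cinfty V f.
Proof. by move=> H k; apply: Ck_local => x /H[U Ux /(_ k)]; exists U. Qed.

Lemma Cinfty_sub V U f : U `<=` V -> Cinfty V f -> Cinfty U f.
Proof. by move=> UV cf; apply: Cinfty_local => x /UV Vx; exists V. Qed.

Lemma Cinfty_cont V f x : Cinfty V f -> V x -> {for x, continuous f}.
Proof. by move=> /(_ 0%N)[+ _] => /[apply]. Qed.

Lemma Cinfty_derivable V f a x : Cinfty V f -> V x -> derivable f x (e_ a).
Proof. by move=> /(_ 1%N)[_ /(_ a)[+ _]] => /[apply]. Qed.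

Lemma Cinfty_derive V f a : Cinfty V f -> Cinfty V ('D_(e_ a) f).
Proof. by move=> cf k; have [_ /(_ a)[]] := cf k.+1. Qed.

Lemma CinftyP V f : (forall x, V x -> {for x, continuous f}) ->
  (forall a, (forall x, V x -> derivable f x (e_ a)) /\
             Cinfty V ('D_(e_ a) f)) -> Cinfty V f.
Proof. by move=> cf df [|k] //=; split => // a; case: (df a). Qed.

Lemma Ck_S k V f : Ck k.+1 V f -> Ck k V f.
Proof.
elim: k f => [|k IH] f [cf df]; split => // a.
by have [d1 d2] := df a; split => //; exact: IH.
Qed.

Lemma Ck_cst k V (c : R) : Ck k V (fun=> c).
Proof.
elim: k c => [|k IH] c; (split; first by move=> x _; exact: cst_continuous) => //.
move=> a; split; first by move=> x Vx; exact: derivable_cst.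
apply: Ck_ext (IH 0) => x Vx; near=> y.
by rewrite derive_cst.
Unshelve. all: by end_near. Qed.

Lemma Cinfty_cst V (c : R) : Cinfty V (fun=> c).
Proof. by move=> k; exact: Ck_cst. Qed.

Lemma Ck_add k V f g : open V -> Ck k V f -> Ck k V g ->
  Ck k V (fun x => f x + g x).
Proof.
move=> oV; elim: k f g => [|k IH] f g [cf df] [cg dg]; 
  (split; first by move=> x Vx; apply: continuousD; [exact: cf|exact: cg]) => //.
move=> a; have [d1 d2] := df a; have [g1 g2] := dg a; split.
  by move=> x Vx; apply: derivableD; [exact: d1|exact: g1].
apply: eq_Ck (IH _ _ d2 g2) => // x Vx.
by rewrite -deriveD//; [exact: d1|exact: g1].
Qed.

Lemma Ck_mul k V f g : open V -> Ck k V f -> Ck k V g ->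
  Ck k V (fun x => f x * g x).
Proof.
move=> oV; elim: k f g => [|k IH] f g [cf df] [cg dg]; 
  (split; first by move=> x Vx; apply: continuousM; [exact: cf|exact: cg]) => //.
move=> a; have [d1 d2] := df a; have [g1 g2] := dg a; split.
  by move=> x Vx; apply: derivableM; [exact: d1|exact: g1].
have Cf : Ck k V f by apply: Ck_S; split.
have Cg : Ck k V g by apply: Ck_S; split.
apply: eq_Ck (Ck_add oV (IH _ _ Cf g2) (IH _ _ Cg d2)) => // x Vx.
by rewrite deriveM//; [exact: d1|exact: g1].
Qed.

Lemma Cinfty_add V f g : open V -> Cinfty V f -> Cinfty V g ->
  Cinfty V (fun x => f x + g x).
Proof. by move=> oV cf cg k; apply: Ck_add. Qed.

Lemma Cinfty_mul V f g : open V -> Cinfty V f -> Cinfty V g ->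
  Cinfty V (fun x => f x * g x).
Proof. by move=> oV cf cg k; apply: Ck_mul. Qed.

Lemma Cinfty_opp V f : open V -> Cinfty V f -> Cinfty V (fun x => - f x).
Proof.
move=> oV cf; apply: eq_Cinfty (Cinfty_mul oV (Cinfty_cst V (-1)) cf) => // x _.
by rewrite mulN1r.
Qed.

Lemma Cinfty_sub_fun V f g : open V -> Cinfty V f -> Cinfty V g ->
  Cinfty V (fun x => f x - g x).
Proof. by move=> oV cf cg; apply: Cinfty_add => //; exact: Cinfty_opp. Qed.

Lemma Cinfty_sum V (I : Type) (r : seq I) (P : pred I) (F : I -> E -> R) :
  open V -> (forall i, P i -> Cinfty V (F i)) ->
  Cinfty V (fun x => \sum_(i <- r | P i) F i x).
Proof.
move=> oV HF; elim: r => [|i r IH].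
  by apply: eq_Cinfty (Cinfty_cst V 0) => // x _; rewrite big_nil.
case Pi: (P i).
  apply: eq_Cinfty (Cinfty_add oV (HF i Pi) IH) => // x _.
  by rewrite big_cons Pi.
by apply: eq_Cinfty IH => // x _; rewrite big_cons Pi.
Qed.

Lemma Cinfty_prod V (I : Type) (r : seq I) (P : pred I) (F : I -> E -> R) :
  open V -> (forall i, P i -> Cinfty V (F i)) ->
  Cinfty V (fun x => \prod_(i <- r | P i) F i x).
Proof.
move=> oV HF; elim: r => [|i r IH].
  by apply: eq_Cinfty (Cinfty_cst V 1) => // x _; rewrite big_nil.
case Pi: (P i).
  apply: eq_Cinfty (Cinfty_mul oV (HF i Pi) IH) => // x _.
  by rewrite big_cons Pi.
by apply: eq_Cinfty IH => // x _; rewrite big_cons Pi.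
Qed.

Lemma Cinfty_exp V f m : open V -> Cinfty V f -> Cinfty V (fun x => f x ^+ m).
Proof.
move=> oV cf; elim: m => [|m IH].
  exact: Cinfty_cst.
by apply: eq_Cinfty (Cinfty_mul oV cf IH) => // x _; rewrite exprS.
Qed.

(** The partial derivative of [1 / f] is [- (1 / f)^2] times that of [f], so the class [C^k] of
    [1 / f] bootstraps to [C^(k+1)]. *)
Lemma Cinfty_inv V f : open V -> (forall x, V x -> f x != 0) -> Cinfty V f ->
  Cinfty V (fun x => (f x)^-1).
Proof.
move=> oV f0 cf; elim => [|k IH]; 
  (split; first by move=> x Vx; apply: continuousV; [exact: f0|exact: Cinfty_cont cf Vx]) => //.
move=> a; split.
  by move=> x Vx; apply: derivableV; [exact: f0|exact: Cinfty_derivable cf Vx].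
have := Ck_mul oV (Ck_mul oV (Ck_cst k V (-1)) (Ck_mul oV IH IH))
  (Cinfty_derive a cf k).
apply: eq_Ck => // x Vx; rewrite deriveV ?f0//.
  by rewrite /GRing.scale/= expr2 invfM !mulN1r.
exact: Cinfty_derivable cf Vx.
Qed.

Lemma derivable_coord (b : 'I_n) (x v : E) :
  derivable (fun y : E => y 0 b) x v.
Proof. exact/diff_derivable/differentiable_coord. Qed.

Lemma derive_coord (b : 'I_n) (x v : E) : 'D_v (fun y : E => y 0 b) x = v 0 b.
Proof.
rewrite /derive; apply: lim_near_cst => //; near=> h.
rewrite /= !mxE addrK /GRing.scale/= mulKf//.
near: h; exact: nbhs_dnbhs_neq.
Unshelve. all: by end_near. Qed.

Lemma Cinfty_coord V (a : 'I_n) : Cinfty V (fun x : E => x 0 a).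
Proof.
apply: CinftyP => [x _|b]; first exact: coord_continuous.
split; first by move=> x _; exact: derivable_coord.
apply: Cinfty_ext (Cinfty_cst V (e_ b 0 a)) => x Vx; near=> y.
by rewrite derive_coord.
Unshelve. all: by end_near. Qed.

End CkCalculus.

(** * First-order Taylor expansion and the chain rule *)

Section ChainRule.
Context {R : realType}.

(** The norm on row vectors is the sup norm; cubes let neighbourhood conditions be checked one
    coordinate at a time. *)
Lemma nbhs_cube n (x : 'rV[R]_n) (A : set 'rV[R]_n) :
  nbhs x A <-> exists2 e : R, 0 < e &
    forall y : 'rV[R]_n, (forall a, `|y 0 a - x 0 a| < e) -> A y.
Proof.
split.
  move=> /nbhs_ballP[e /= e0 eA]; exists e => // y xy; apply: eA; split => //.
  by move=> i j; rewrite ord1 /ball/= distrC.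
move=> [e e0 eA]; apply/nbhs_ballP; exists e => //= y [_ xy]; apply: eA => a.
by have := xy 0 a; rewrite /ball/= distrC.
Qed.

Lemma coord_le_norm n (x : 'rV[R]_n) a : `|x 0 a| <= `|x|.
Proof.
rewrite [leRHS]/Num.norm /= mx_normrE; apply/bigmax_geP; right => /=.
by exists (0, a).
Qed.

(** An equality of difference quotients as functions, so that it transports both derivability and
    the value of the derivative. *)
Lemma line_growth n (f : 'rV[R]_n -> R) (x v : 'rV[R]_n) (s : R) :
  (fun h : R => h^-1 *: (((fun s => f (s *: v + x)) \o shift s) (h *: 1)
     - f (s *: v + x))) =
  (fun h : R => h^-1 *: ((f \o shift (s *: v + x)) (h *: v) - f (s *: v + x))).
Proof.
apply/funext => h; rewrite /= [h%:A]mulr1 scalerDl addrA.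
by [].
Qed.

Lemma MVT_line n (f : 'rV[R]_n -> R) (x v : 'rV[R]_n) (t : R) :
  (forall s : R, `|s| <= `|t| -> derivable f (s *: v + x) v) ->
  exists2 c : R, `|c| <= `|t| & f (t *: v + x) - f x = t * 'D_v f (c *: v + x).
Proof.
move=> df; pose phi := fun s : R => f (s *: v + x).
have dphi (s : R) : `|s| <= `|t| -> is_derive s 1 phi ('D_v f (s *: v + x)).
  move=> /df dfs; apply: DeriveDef.
    by rewrite /derivable /phi line_growth.
  by rewrite /derive /phi line_growth.
have cphi (s : R) : `|s| <= `|t| -> {for s, continuous phi}.
  move=> /dphi[d _]; apply: differentiable_continuous; exact/derivable1_diffP.
have [t0|t0] := leP 0 t.
  have [||c] := @MVT_segment R phi (fun s => 'D_v f (s *: v + x)) 0 t t0.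
  - move=> s; rewrite in_itv/= => /andP[s0 st]; apply: dphi.
    by rewrite !ger0_norm// ltW.
  - apply: continuous_in_subspaceT => s; rewrite inE/= in_itv/= => /andP[s0 st].
    by apply: cphi; rewrite !ger0_norm.
  - rewrite in_itv/= => /andP[c0 ct]; rewrite /phi scale0r add0r subr0 => E.
    by exists c; rewrite ?E 1?mulrC// !ger0_norm.
have [||c] := @MVT_segment R phi (fun s => 'D_v f (s *: v + x)) t 0 (ltW t0).
- move=> s; rewrite in_itv/= => /andP[s0 st]; apply: dphi.
  by rewrite !ltr0_norm// lerN2 ltW.
- apply: continuous_in_subspaceT => s; rewrite inE/= in_itv/= => /andP[s0 st].
  by apply: cphi; rewrite !ler0_norm ?lerN2// ltW.
- rewrite in_itv/= => /andP[c0 ct]; rewrite /phi scale0r add0r sub0r => E.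
  exists c; first by rewrite !ler0_norm ?lerN2// ltW.
  by rewrite -opprB E mulrN opprK mulrC.
Qed.

(** The coordinates of the increment are switched on one after the other ([tr]); the mean value
    theorem applies to each step, and continuity of the partial derivatives at [x] bounds the
    error. *)
Lemma C1_taylor n (V : set 'rV[R]_n) (f : 'rV[R]_n -> R) x : open V -> V x ->
  Ck 1 V f -> forall eps : R, 0 < eps -> exists2 del : R, 0 < del &
  forall h : 'rV[R]_n, (forall a, `|h 0 a| < del) ->
  `|f (h + x) - f x - \sum_a h 0 a * 'D_(delta_mx 0 a) f x| <= eps * `|h|.
Proof.
move=> oV Vx [_ df] eps eps0.
have /nbhs_cube[d0 d00 d0V] : nbhs x V by exact: open_nbhs_nbhs.
(* There are [n] steps; dividing by [n.+1] avoids a separate case [n = 0]. *)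
have e'0 : 0 < eps / n.+1%:R by rewrite divr_gt0.
have H (a : 'I_n) : exists2 e : R, 0 < e & forall y : 'rV[R]_n,
    (forall b, `|y 0 b - x 0 b| < e) ->
    `|'D_(delta_mx 0 a) f y - 'D_(delta_mx 0 a) f x| < eps / n.+1%:R.
  have [_ [/(_ x Vx) c _]] := df a.
  have /cvgrPdist_lt /(_ _ e'0) := c.
  rewrite nearE => /nbhs_cube[e e0 eH]; exists e => // y /eH /=.
  by rewrite distrC.
pose e1 a := sval (cid2 (H a)).
have e10 a : 0 < e1 a by rewrite /e1; case: (cid2 _).
have e1H a (y : 'rV[R]_n) : (forall b, `|y 0 b - x 0 b| < e1 a) ->
    `|'D_(delta_mx 0 a) f y - 'D_(delta_mx 0 a) f x| < eps / n.+1%:R.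
  by rewrite /e1; case: (cid2 _) => /= ? ? K; exact: K.
exists (\big[Order.min/d0]_a e1 a).
  by elim/big_ind: _ => // p q p0 q0; rewrite lt_min p0.
move=> h hd.
have hd0 a : `|h 0 a| < d0 by apply: lt_le_trans (hd a) _; exact: bigmin_le_id.
have hd1 a b : `|h 0 a| < e1 b.
  by apply: lt_le_trans (hd a) _; exact: bigmin_le_cond.
pose tr (k : nat) : 'rV[R]_n := \row_a (if (a < k)%N then h 0 a else 0).
have tr0 : tr 0%N = 0 by apply/rowP => a; rewrite !mxE.
have trn : tr n = h by apply/rowP => a; rewrite !mxE ltn_ord.
have trS (a : 'I_n) : tr a.+1 = h 0 a *: delta_mx 0 a + tr a.
  apply/rowP => b; rewrite !mxE eqxx/= ltnS leq_eqVlt -val_eqE/=.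
  by case: eqP => [/val_inj ->|_]; rewrite ?ltnn ?mulr1 ?mulr0 ?addr0 ?add0r.
have step (a : 'I_n) :
    `|(f (tr a.+1 + x) - f (tr a + x)) - h 0 a * 'D_(delta_mx 0 a) f x| <=
    `|h| * (eps / n.+1%:R).
  have near_c (c : R) : `|c| <= `|h 0 a| -> forall b,
     `|(c *: delta_mx 0 a + (tr a + x)) 0 b - x 0 b| <= `|h 0 b|.
    move=> ch b; rewrite !mxE eqxx/= addrA addrK.
    have [->|ba] := eqVneq b a; first by rewrite mulr1 ltnn addr0.
    by rewrite mulr0 add0r; case: ifP => // _; rewrite normr0.
  have [|c ch] := @MVT_line n f (tr a + x) (delta_mx 0 a) (h 0 a).
    move=> s sh; have [d _] := df a; apply: d; apply: d0V => b.
    exact: le_lt_trans (near_c _ sh b) _.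
  rewrite addrA -trS => ->; rewrite -mulrBr normrM ler_pM//.
    exact: coord_le_norm.
  by apply/ltW/e1H => b; exact: le_lt_trans (near_c _ ch b) _.
have -> : f (h + x) - f x = \sum_(a < n) (f (tr a.+1 + x) - f (tr a + x)).
  by rewrite -(big_mkord xpredT (fun a => f (tr a.+1 + x) - f (tr a + x)))
    telescope_sumr// trn tr0 add0r.
rewrite -sumrB; apply: le_trans (ler_norm_sum _ _ _) _.
apply: le_trans (ler_sum _ (fun a _ => step a)) _.
rewrite sumr_const card_ord -[leLHS]mulr_natr -mulrA [leRHS]mulrC.
by rewrite ler_wpM2l// -mulrA ger_pMr// mulrC ler_pdivrMr// mul1r ler_nat.
Qed.

Definition gradient n (f : 'rV[R]_n -> R) (x h : 'rV[R]_n) : R :=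
  \sum_a h 0 a * 'D_(delta_mx 0 a) f x.

(** Passes from partial derivatives, the only data in [Ck], to Fréchet differentiability, on which
    the chain rule rests. *)
Lemma C1_differentiable n (V : set 'rV[R]_n) (f : 'rV[R]_n -> R) x :
  open V -> V x -> Ck 1 V f ->
  differentiable f x /\ (forall v, 'D_v f x = gradient f x v).
Proof.
move=> oV Vx cf.
have glin : linear (gradient f x : 'rV[R]_n -> R^o).
  move=> k u v; rewrite /gradient scaler_sumr -big_split; apply: eq_bigr => a _.
  by rewrite !mxE mulrDl scalerAl.
pose gL := GRing.isLinear.Build _ _ _ _ _ glin.
pose g : {linear 'rV[R]_n -> R^o} := HB.pack (gradient f x) gL.
have cg : continuous (g : 'rV[R]_n -> R).
  move=> y; rewrite /g/=; apply: (@Cinfty_cont _ _ setT) => //.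
  apply: Cinfty_sum => [|a _]; first exact: openT.
  by apply: Cinfty_mul; [exact: openT|exact: Cinfty_coord|exact: Cinfty_cst].
have littleg : forall eps : R, 0 < eps -> \forall h \near (0 : 'rV[R]_n),
    `|f (h + x) - (f x + gradient f x h)| <= eps * `|h|.
  move=> eps eps0; have [del del0 H] := C1_taylor oV Vx cf eps0.
  apply/nbhs_cube; exists del => // h hd /=.
  by rewrite opprD addrA; apply: H => a; have := hd a; rewrite mxE subr0.
have dE : 'd f x = g :> (_ -> _).
  by apply: diff_unique => //; apply/eqaddoP; exact: littleg.
have dfx : differentiable f x.
  apply/diff_locallyP; rewrite dE; split=> //; apply/eqaddoP; exact: littleg.
by split => // v; rewrite deriveE// dE.
Qed.

Lemma differentiable_row n m (phi : 'rV[R]_n -> 'rV[R]_m) x :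
  (forall b, differentiable (fun y => phi y 0 b) x) -> differentiable phi x.
Proof.
move=> H.
rewrite (_ : phi = \sum_b (fun y => phi y 0 b *: delta_mx 0 b)).
  by apply: differentiable_sum => b; apply: differentiableZl; exact: H.
apply/funext => y; rewrite fct_sumE; exact: row_sum_delta.
Qed.

Lemma derive_comp n m (V : set 'rV[R]_n) (W : set 'rV[R]_m)
    (phi : 'rV[R]_n -> 'rV[R]_m) (f : 'rV[R]_m -> R) x (v : 'rV[R]_n) :
  open V -> open W -> V x -> W (phi x) ->
  (forall b, Ck 1 V (fun y => phi y 0 b)) -> Ck 1 W f ->
  [/\ {for x, continuous (f \o phi)}, derivable (f \o phi) x v &
  'D_v (f \o phi) x =
    \sum_b 'D_v (fun y => phi y 0 b) x * 'D_(delta_mx 0 b) f (phi x)].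
Proof.
move=> oV oW Vx Wx cphi cf.
have [df gf] := C1_differentiable oW Wx cf.
have dphi : differentiable phi x.
  by apply: differentiable_row => b; have [] := C1_differentiable oV Vx (cphi b).
have dc : differentiable (f \o phi) x by exact: differentiable_comp.
split; [exact: differentiable_continuous|exact: diff_derivable|].
rewrite deriveE// diff_comp//= -deriveE// gf /gradient; apply: eq_bigr => b _.
congr (_ * _); rewrite deriveE; last first.
  by have [] := C1_differentiable oV Vx (cphi b).
have -> : (fun y => phi y 0 b) = (fun M : 'rV[R]_m => M 0 b) \o phi by [].
have dco : differentiable (fun M : 'rV[R]_m => M 0 b) (phi x).
  exact: differentiable_coord.
rewrite [RHS](congr1 (fun g => g v) (diff_comp dphi dco)) /= -[RHS]deriveE//.
by rewrite derive_coord.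
Qed.

(** By the chain rule a partial derivative of the composite is a sum of products of derivatives of
    [phi] with composites of the same kind, hence an induction on the class for all [f] at once. *)
Lemma Cinfty_comp n m (V : set 'rV[R]_n) (W : set 'rV[R]_m)
    (phi : 'rV[R]_n -> 'rV[R]_m) (f : 'rV[R]_m -> R) :
  open V -> open W -> (forall x, V x -> W (phi x)) ->
  (forall b, Cinfty V (fun y => phi y 0 b)) -> Cinfty W f ->
  Cinfty V (f \o phi).
Proof.
move=> oV oW VW cphi cf k; elim: k f cf => [|k IH] f cf;
  (split; first by move=> x Vx;
     have [] := derive_comp 0 oV oW Vx (VW x Vx) (fun b => cphi b 1%N) (cf 1%N)) => //.
move=> a; split=> [x Vx|].
  by have [] := derive_comp (delta_mx 0 a) oV oW Vx (VW x Vx)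
     (fun b => cphi b 1%N) (cf 1%N).
have S : forall r : seq 'I_m, Ck k V (fun x => \sum_(b <- r)
    'D_(delta_mx 0 a) (fun y => phi y 0 b) x * 'D_(delta_mx 0 b) f (phi x)).
  elim => [|b r IHr].
    by apply: eq_Ck (Ck_cst k V 0) => // x _; rewrite big_nil.
  have := Ck_add oV (Ck_mul oV (Cinfty_derive a (cphi b) k)
    (IH _ (Cinfty_derive b cf))) IHr.
  by apply: eq_Ck => // x _; rewrite big_cons.
apply: eq_Ck (S (index_enum _)) => // x Vx.
by have [_ _ ->] := derive_comp (delta_mx 0 a) oV oW Vx (VW x Vx)
     (fun b => cphi b 1%N) (cf 1%N).
Qed.

End ChainRule.

(** * Bump functions *)

Section Bump.
Context {R : realType}.

(* Derivatives of [t |-> exp (- 1 / t)] are combinations of these. *)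
Definition flat_exp (k : nat) (t : R) : R :=
  if t <= 0 then 0 else t^-1 ^+ k * expR (- t^-1).

(** With [s = 1 / t], the exponential series gives [exp s >= s^(k+1) / (k+1)!]. The linear bound is
    what makes the derivatives at [0] vanish. *)
Lemma flat_exp_le k (t : R) : `|flat_exp k t| <= k.+1`!%:R * `|t|.
Proof.
rewrite /flat_exp; have [t0|t0] := leP t 0; first by rewrite normr0 mulr_ge0.
have s0 : 0 < t^-1 by rewrite invr_gt0.
rewrite !gtr0_norm//; last by rewrite mulr_gt0// ?expR_gt0// exprn_gt0.
rewrite expRN ler_pdivrMr ?expR_gt0//.
have := expR_ge1Dxn k (ltW s0); set E := expR _ => HE.
have HE' : t^-1 ^+ k.+1 / k.+1`!%:R <= E by apply: le_trans HE; rewrite lerDr.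
have f0 : 0 < (k.+1`!%:R : R) by rewrite ltr0n fact_gt0.
rewrite -(ler_pM2l (mulr_gt0 f0 t0)) in HE'.
apply: le_trans HE'; rewrite exprS.
by rewrite le_eqVlt; apply/orP; left; apply/eqP; field; rewrite !gt_eqF.
Qed.

(** At [0] the difference quotient of [flat_exp k] is [flat_exp k.+1], which tends to [0] by
    [flat_exp_le]. *)
Lemma flat_exp_derive k (t : R) :
  is_derive t 1 (flat_exp k) (flat_exp k.+2 t - k%:R * flat_exp k.+1 t).
Proof.
have [t0|t0|t0] := ltgtP t 0.
- have -> : flat_exp k.+2 t - k%:R * flat_exp k.+1 t = 0.
    by rewrite /flat_exp (ltW t0) mulr0 subr0.
  have H0 := is_derive_cst (0 : R) t (1 : R); apply: near_eq_is_derive H0.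
  near=> u; rewrite /flat_exp ifT//; apply: ltW.
  by near: u; exact: lt_nbhsl.
- have tn0 : t != 0 by rewrite gt_eqF.
  have dV : is_derive t 1 (fun u : R => u^-1) (- t ^- 2).
    have := @is_deriveV R id t 1 1 tn0 (is_derive_id _ _).
    by move=> H; apply: (is_derive_eq H); rewrite /GRing.scale/= mulr1.
  have dN : is_derive t 1 (fun u : R => - u^-1) (t ^- 2).
    by apply: (is_derive_eq (is_deriveN dV)); rewrite opprK.
  have dE : is_derive t 1 (fun u : R => expR (- u^-1)) (expR (- t^-1) * t ^- 2).
    have := @is_derive1_comp R expR (fun u => - u^-1) t _ _ (is_derive_expR _) dN.
    by move=> H; apply: (is_derive_eq H).
  have H1 := is_deriveM (is_deriveX k dV) dE.
  have E : (fun u : R => u^-1) ^+ k * (fun u => expR (- u^-1)) =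
      (fun u => u^-1 ^+ k * expR (- u^-1)).
    by apply/funext => u; rewrite /= fctE exprfctE.
  have H2 : is_derive t 1 (fun u => u^-1 ^+ k * expR (- u^-1))
      (flat_exp k.+2 t - k%:R * flat_exp k.+1 t); last first.
    apply: near_eq_is_derive H2.
    near=> u; rewrite /flat_exp ifF//; apply/negbTE; rewrite -ltNge.
    by near: u; exact: lt_nbhsr.
  rewrite -E; apply: (is_derive_eq H1).
  rewrite /flat_exp !ifF ?leNgt ?t0//= !fctE /GRing.scale/=.
  case: (k) => [|k']/=; rewrite -!exprVn !exprS ?expr0; ring.
- rewrite t0; have -> : flat_exp k.+2 0 - k%:R * flat_exp k.+1 0 = 0.
    by rewrite /flat_exp lexx mulr0 subr0.
  suff L : (fun h : R => h^-1 *: ((flat_exp k \o shift 0) (h *: 1) - flat_exp k 0))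
       @ 0^' --> (0 : R).
    by apply: DeriveDef; [apply/cvg_ex; exists 0|exact: cvg_lim L].
  apply/cvgrPdist_le => eps eps0.
  have f0 : 0 < (k.+2`!%:R : R) by rewrite ltr0n fact_gt0.
  near=> h; have h0 : h != 0 by near: h; exact: nbhs_dnbhs_neq.
  rewrite sub0r normrN /= addr0 [h%:A]mulr1 {2}/flat_exp lexx subr0.
  have -> : h^-1 *: flat_exp k h = flat_exp k.+1 h.
    by rewrite /flat_exp /GRing.scale/=; case: ifP; rewrite ?mulr0// exprS mulrA.
  apply: le_trans (flat_exp_le _ _) _; rewrite mulrC -ler_pdivlMr//.
  near: h; apply: dnbhs0_le; exact: divr_gt0.
Unshelve. all: by end_near. Qed.

Lemma Ck_flat_exp m k : Ck m setT (fun x : 'rV[R]_1 => flat_exp k (x 0 0)).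
Proof.
have D j (x : 'rV[R]_1) (a : 'I_1) :
   is_derive x (delta_mx 0 a) (fun x : 'rV[R]_1 => flat_exp j (x 0 0))
    (flat_exp j.+2 (x 0 0) - j%:R * flat_exp j.+1 (x 0 0)).
  have E : (fun h : R => h^-1 *: (((fun x : 'rV[R]_1 => flat_exp j (x 0 0)) \o
      shift x) (h *: delta_mx 0 a) - flat_exp j (x 0 0))) =
    (fun h : R => h^-1 *: ((flat_exp j \o shift (x 0 0)) (h *: 1) -
       flat_exp j (x 0 0))).
    by apply/funext => h; rewrite /= !mxE ord1 eqxx.
  have [d1 d2] := flat_exp_derive j (x 0 0).
  by apply: DeriveDef; rewrite ?/derivable ?/derive E.
have C j (x : 'rV[R]_1) : {for x, continuous (fun x : 'rV[R]_1 => flat_exp j (x 0 0))}.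
  have cj : {for x 0 0, continuous (flat_exp j)}.
    apply: differentiable_continuous; apply/derivable1_diffP.
    by have [] := flat_exp_derive j (x 0 0).
  exact: (continuous_comp (@coord_continuous _ _ _ 0 0 x) cj).
elim: m k => [|m IH] k; (split; first by move=> x _; exact: C) => //.
move=> a; split; first by move=> x _; have [] := D k x a.
have := Ck_add openT (IH k.+2) (Ck_mul openT (Ck_cst m setT (- k%:R)) (IH k.+1)).
apply: eq_Ck; first exact: openT.
by move=> x _; have [_ ->] := D k x a; rewrite mulNr.
Qed.

Definition smooth_step : R -> R := flat_exp 0.

Lemma smooth_step_gt0 t : 0 < t -> 0 < smooth_step t.
Proof. by move=> t0; rewrite /smooth_step /flat_exp leNgt t0/= mul1r expR_gt0. Qed.

Lemma smooth_step_le0 t : t <= 0 -> smooth_step t = 0.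
Proof. by rewrite /smooth_step /flat_exp => ->. Qed.

Lemma smooth_step_ge0 t : 0 <= smooth_step t.
Proof.
have [/smooth_step_le0 ->//|t0] := leP t 0; exact/ltW/smooth_step_gt0.
Qed.

Lemma Cinfty_smooth_step n (V : set 'rV[R]_n) g :
  open V -> Cinfty V g -> Cinfty V (fun x => smooth_step (g x)).
Proof.
move=> oV cg.
have := @Cinfty_comp R n 1 V setT (fun x => \row__ g x) _ oV openT
  (fun _ _ => I) _ (Ck_flat_exp^~ 0%N).
move=> /(_ _)/wrap[b|]; first by apply: eq_Cinfty cg => // x _; rewrite mxE.
by apply: eq_Cinfty => // x _; rewrite /= mxE.
Qed.

Lemma cube_bump n (p : 'rV[R]_n) (eps : R) : 0 < eps ->
  exists chi : 'rV[R]_n -> R, [/\ Cinfty setT chi,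
    forall x : 'rV[R]_n, (forall a, `|x 0 a - p 0 a| <= eps) -> chi x = 1 &
    forall (x : 'rV[R]_n) a, 2 * eps <= `|x 0 a - p 0 a| -> chi x = 0].
Proof.
move=> eps0.
(* Squaring keeps the distance smooth; the factor of index [a] is [1] for [tau <= 1] and [0] for
   [tau >= 4], that is, within distance [eps] and beyond [2 * eps]. *)
pose tau (x : 'rV[R]_n) a : R := ((x 0 a - p 0 a) / eps) ^+ 2.
pose den (t : R) := smooth_step (4 - t) + smooth_step (t - 1).
have den_neq0 t : den t != 0.
  rewrite gt_eqF// /den; have [t4|t4] := ltP t 4.
    by rewrite ltr_pwDl// ?smooth_step_ge0// smooth_step_gt0// subr_gt0.
  by rewrite ltr_pwDr// ?smooth_step_ge0// smooth_step_gt0//; lra.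
have ctau a : Cinfty setT (tau^~ a).
  apply: Cinfty_exp; first exact: openT.
  apply: Cinfty_mul; [exact: openT| |exact: Cinfty_cst].
  by apply: Cinfty_sub_fun; [exact: openT|exact: Cinfty_coord|exact: Cinfty_cst].
exists (fun x => \prod_a (smooth_step (4 - tau x a) / den (tau x a))); split.
- apply: Cinfty_prod => [|a _]; first exact: openT.
  have c1 : Cinfty setT (fun x => smooth_step (4 - tau x a)).
    apply: Cinfty_smooth_step; first exact: openT.
    by apply: Cinfty_sub_fun; [exact: openT|exact: Cinfty_cst|].
  apply: Cinfty_mul => //; first exact: openT.
  apply: Cinfty_inv => //; first exact: openT.
  apply: Cinfty_add => //; first exact: openT.
  apply: Cinfty_smooth_step; first exact: openT.
  by apply: Cinfty_sub_fun; [exact: openT| |exact: Cinfty_cst].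
- move=> x H; apply: big1 => a _.
  have t1 : tau x a <= 1.
    rewrite /tau -real_normK ?num_real// exprn_ile1// normrM normfV.
    by rewrite (gtr0_norm eps0) ler_pdivrMr// mul1r.
  rewrite /den (@smooth_step_le0 (tau x a - 1)) ?addr0 ?subr_le0// divff//.
  by rewrite gt_eqF// smooth_step_gt0//; lra.
- move=> x a H; rewrite (bigD1 a)//= smooth_step_le0 ?mul0r//.
  rewrite subr_le0 /tau -real_normK ?num_real// normrM normfV (gtr0_norm eps0).
  have : 2 <= `|x 0 a - p 0 a| / eps by rewrite ler_pdivlMr.
  set u := _ / _; nra.
Qed.

End Bump.

(** * Hadamard's lemma *)

Section UnitIntegral.
Context {R : realType}.
Local Notation mu := (@lebesgue_measure R).
Implicit Types phi psi : R -> R.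

Definition cont01 phi := forall t : R, 0 <= t <= 1 -> {for t, continuous phi}.

Definition int01 phi : R := (\int[mu]_(t in `[0%R, 1%R]) phi t)%R.

Lemma cont01_within phi : cont01 phi -> {within `[(0 : R), 1], continuous phi}.
Proof.
move=> c; apply: continuous_in_subspaceT => t; rewrite inE/= in_itv/=; exact: c.
Qed.

Lemma cont01_integrable phi : cont01 phi ->
  mu.-integrable `[(0 : R), 1] (EFin \o phi).
Proof.
move=> c; apply: continuous_compact_integrable; first exact: segment_compact.
exact: cont01_within.
Qed.

Lemma cont01B phi psi : cont01 phi -> cont01 psi ->
  cont01 (fun t => phi t - psi t).
Proof. by move=> c d t t01; apply: continuousB; [exact: c|exact: d]. Qed.

Lemma cont01D phi psi : cont01 phi -> cont01 psi ->
  cont01 (fun t => phi t + psi t).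
Proof. by move=> c d t t01; apply: continuousD; [exact: c|exact: d]. Qed.

Lemma cont01Z (r : R) phi : cont01 phi -> cont01 (fun t => r * phi t).
Proof.
by move=> c t t01; apply: continuousM; [exact: cst_continuous|exact: c].
Qed.

Lemma cont01X (k : nat) phi : cont01 phi -> cont01 (fun t => t ^+ k * phi t).
Proof.
by move=> c t t01; apply: continuousM; [exact: exprn_continuous|exact: c].
Qed.

Lemma int01B phi psi : cont01 phi -> cont01 psi ->
  int01 (fun t => phi t - psi t) = int01 phi - int01 psi.
Proof. by move=> c d; apply: RintegralB => //; exact: cont01_integrable. Qed.

Lemma int01D phi psi : cont01 phi -> cont01 psi ->
  int01 (fun t => phi t + psi t) = int01 phi + int01 psi.
Proof. by move=> c d; apply: RintegralD => //; exact: cont01_integrable. Qed.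

Lemma int01Z (r : R) phi : cont01 phi ->
  int01 (fun t => r * phi t) = r * int01 phi.
Proof. by move=> c; apply: RintegralZl => //; exact: cont01_integrable. Qed.

Lemma eq_int01 phi psi : (forall t, 0 <= t <= 1 -> phi t = psi t) ->
  int01 phi = int01 psi.
Proof.
by move=> E; apply: eq_Rintegral => t; rewrite inE/= in_itv/=; exact: E.
Qed.

Lemma int01_le phi (e : R) : cont01 phi ->
  (forall t, 0 <= t <= 1 -> `|phi t| <= e) -> `|int01 phi| <= e.
Proof.
move=> c H; apply: le_trans (le_normr_Rintegral _ (cont01_integrable c)) _ => //.
have <- : int01 (cst e) = e.
  rewrite /int01 Rintegral_cst//= lebesgue_measure_itv/= lte_fin ltr01/=.
  by rewrite subr0 mulr1.
apply: le_Rintegral => //.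
- apply: (@cont01_integrable (fun t => `|phi t|)) => t /c ct.
  exact: (continuous_comp ct (@norm_continuous _ _ _)).
- by apply: (@cont01_integrable (cst e)) => t _; exact: cst_continuous.
Qed.

Lemma int01_FTC (F : R -> R) phi : cont01 phi -> cont01 F ->
  (forall t : R, 0 < t < 1 -> is_derive t 1 F (phi t)) ->
  int01 phi = F 1 - F 0.
Proof.
move=> c cF dF; rewrite /int01 /Rintegral (@continuous_FTC2 R phi F 0 1)//=.
- exact: cont01_within.
- split.
  + by move=> t; rewrite in_itv/= => /dF[].
  + by apply: cvg_at_right_filter; apply: cF; rewrite lexx ler01.
  + by apply: cvg_at_left_filter; apply: cF; rewrite lexx ler01.
- by move=> t; rewrite in_itv/= derive1E => /dF[_ ->].
Qed.

End UnitIntegral.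

(** * Dilations of some of the coordinates and radial integrals *)

Section Radial.
Context {R : realType} {n : nat}.
Variable P : pred 'I_n.
Local Notation E := ('rV[R]_n).

(** In a chart where [N] is the locus [x_a = 0] for all [a] in [P], [dilation 0] projects onto
    [N]. *)
Definition dilation (t : R) (x : E) : E :=
  \row_a (if P a then t * x 0 a else x 0 a).

Lemma dilation1 x : dilation 1 x = x.
Proof. by apply/rowP => a; rewrite mxE mul1r if_same. Qed.

Lemma dilation_line t x :
  dilation t x = t *: (\row_a (if P a then x 0 a else 0)) + dilation 0 x.
Proof.
apply/rowP => a; rewrite !mxE; case: (P a); rewrite ?mul0r ?addr0//.
by rewrite mulr0 add0r.
Qed.

Definition starlike (V : set E) :=
  forall x t, V x -> 0 <= t <= 1 -> V (dilation t x).

(** The powers of [t] make this family stable under partial derivatives ([radial_derive]) and absorb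
    the factors that monomials release under dilation ([wideal_radial]). *)
Definition radial_integral (k : nat) (g : E -> R) (x : E) : R :=
  int01 (fun t => t ^+ k * g (dilation t x)).

Lemma cvg_rowP (T : Type) (F : set_system T) {FF : Filter F} (u : T -> E) (l : E) :
  (forall a, u y 0 a @[y --> F] --> l 0 a) -> u @ F --> l.
Proof.
move=> H A /nbhs_cube[e e0 eA].
have : \forall y \near F, forall a, `|u y 0 a - l 0 a| < e.
  apply: filter_forall => a.
  have /cvgrPdist_lt/(_ _ e0) := H a.
  by apply: filterS => y; rewrite distrC.
by apply: filterS => y; exact: eA.
Qed.

Lemma dilation_cvg (t : R) (x : E) :
  (fun p : R * E => dilation p.1 p.2) @ ((t, x) : R * E) --> dilation t x.
Proof.
apply: cvg_rowP => a; rewrite mxE.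
have c1 : (fun p : R * E => p.2 0 a) @ ((t, x) : R * E) --> x 0 a.
  move=> A /(@coord_continuous R 1 n 0 a x) hA.
  by exists (setT, [set y : E | A (y 0 a)]); [split; [exact: filterT|exact: hA]|move=> p []].
rewrite (_ : (fun y : R * E => _) =
  (fun p : R * E => if P a then p.1 * p.2 0 a else p.2 0 a)); last first.
  by apply/funext => p; rewrite mxE.
by case: (P a) => //; apply: cvgM => //; exact: cvg_fst.
Qed.

Section Fixed.
Variable V : set E.
Hypotheses (oV : open V) (sV : starlike V).

Lemma cont01_dilation (g : E -> R) x : (forall y, V y -> {for y, continuous g}) ->
  V x -> cont01 (fun t => g (dilation t x)).
Proof.
move=> cg Vx t t01.
have ct : {for t, continuous (dilation^~ x)}.
  apply: cvg_rowP => a; rewrite mxE.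
  rewrite (_ : (fun y => _) = (fun t => if P a then t * x 0 a else x 0 a)).
    by case: (P a); [apply: cvgM => //; exact: cvg_cst|exact: cvg_cst].
  by apply/funext => s; rewrite mxE.
exact: (continuous_comp ct (cg _ (sV Vx t01))).
Qed.

(** Uniformity in [t] comes from the compactness of [[0, 1]] and the joint continuity of the
    dilation in [(t, x)]. *)
Lemma dilation_unif (g : E -> R) x (e : R) :
  (forall y, V y -> {for y, continuous g}) -> V x -> 0 < e ->
  \forall y \near x, forall t, 0 <= t <= 1 ->
    `|g (dilation t y) - g (dilation t x)| < e.
Proof.
move=> cg Vx e0.
have e20 : 0 < e / 2 by rewrite divr_gt0.
have /compact_near_coveringP := @segment_compact R 0 1.
move=> /(_ _ (nbhs x) (fun y t => `|g (dilation t y) - g (dilation t x)| < e) _).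
move=> /(_ _)/wrap[t|]; last first.
  by apply: filterS => y H t t01; apply: H; rewrite /= in_itv.
rewrite /= in_itv/= => t01.
have cgx : g z @[z --> dilation t x] --> g (dilation t x) := cg _ (sV Vx t01).
have c1 : (fun p : R * E => g (dilation p.1 p.2)) @ ((t, x) : R * E)
    --> g (dilation t x).
  by move=> A /cgx hA; exact: (@dilation_cvg t x _ hA).
have c2 : g (dilation s x) @[s --> t] --> g (dilation t x).
  exact: (cont01_dilation cg Vx t01).
have /cvgrPdist_lt/(_ _ e20) h1 := c1.
have /cvgrPdist_lt/(_ _ e20) h2 := c2.
have h2' : \forall p \near ((t, x) : R * E),
    `|g (dilation t x) - g (dilation p.1 x)| < e / 2.
  exact: (cvg_fst (F := nbhs t) (G := nbhs x) h2).
apply: filterS2 h1 h2' => p /= p1 p2.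
rewrite -(subrKA (g (dilation t x))) (le_lt_trans (ler_normD _ _))//.
by rewrite [ltRHS]splitr ltrD// distrC.
Qed.

Lemma continuous_eps (f : E -> R) (x : E) :
  (forall e : R, 0 < e -> \forall y \near x, `|f y - f x| <= e) ->
  {for x, continuous f}.
Proof.
move=> H A /nbhs_ballP[e /= e0 eA].
have e20 : 0 < e / 2 by rewrite divr_gt0.
apply: filterS (H _ e20) => y fy; apply: eA; rewrite /ball/= distrC.
by apply: le_lt_trans fy _; rewrite ltr_pdivrMr// ltr_pMr// ltr1n.
Qed.

Lemma radial_continuous k (g : E -> R) : (forall y, V y -> {for y, continuous g}) ->
  forall x, V x -> {for x, continuous (radial_integral k g)}.
Proof.
move=> cg x Vx; apply: continuous_eps => e e0.
have nV : nbhs x V by exact: open_nbhs_nbhs.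
apply: filterS2 nV (dilation_unif cg Vx e0) => y Vy H.
rewrite /radial_integral -int01B;
  [|exact/cont01X/cont01_dilation|exact/cont01X/cont01_dilation].
apply: int01_le.
  by apply: cont01B; apply/cont01X/cont01_dilation.
move=> t t01; rewrite -mulrBr normrM -[leRHS]mul1r ler_pM//.
  by have /andP[? ?] := t01; rewrite normrX ger0_norm// exprn_ile1.
exact/ltW/H.
Qed.

Lemma dilation_derive g t x a : 0 <= t <= 1 -> V x -> Ck 1 V g ->
  derivable (fun y => g (dilation t y)) x (delta_mx 0 a) /\
  'D_(delta_mx 0 a) (fun y => g (dilation t y)) x =
    t ^+ P a * 'D_(delta_mx 0 a) g (dilation t x).
Proof.
move=> t01 Vx cg.
have cd b : Ck 1 V (fun y => dilation t y 0 b).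
  have : Cinfty V (fun y : E => (if P b then t else 1) * y 0 b).
    by apply: Cinfty_mul => //; [exact: Cinfty_cst|exact: Cinfty_coord].
  move=> /(_ 1%N); apply: eq_Ck => // y _; rewrite mxE.
  by case: ifP => //; rewrite mul1r.
have [_ d1 d2] := @derive_comp R n n V V (dilation t) g x (delta_mx 0 a) oV oV Vx
  (sV Vx t01) cd cg.
have D b : 'D_(delta_mx 0 a) (fun y => dilation t y 0 b) x =
    (if P b then t else 1) * (b == a)%:R.
  have -> : (fun y => dilation t y 0 b) =
      (fun y : E => (if P b then t else 1) * y 0 b).
    by apply/funext => y; rewrite mxE; case: (P b); rewrite ?mul1r.
  have := @deriveM R E (cst (if P b then t else 1)) (fun y => y 0 b) x
    (delta_mx 0 a) (derivable_cst _ _ _) (@derivable_coord R n b x _).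
  rewrite derive_coord derive_cst scaler0 addr0 mxE eqxx /= => ->.
  by rewrite eq_sym.
split=> //; rewrite [LHS]d2 (bigD1 a)//= [X in _ + X]big1 => [|b ba].
  by rewrite addr0 D eqxx mulr1; case: (P a).
by rewrite D (negbTE ba) mulr0 mul0r.
Qed.

(** Differentiation under the integral sign: by the mean value theorem in the direction [a], the
    integrand of the error is a difference of values of a partial derivative of [g], small uniformly
    in [t] by [dilation_unif]. The dilation contributes a further factor [t] exactly when [P a]. *)
Lemma radial_derive k g x a : V x -> Ck 1 V g ->
  is_derive x (delta_mx 0 a) (radial_integral k g)
    (radial_integral (k + P a) ('D_(delta_mx 0 a) g) x).
Proof.
move=> Vx cg; have [cg0 cg1] := cg; have [dg [cdg _]] := cg1 a.
suff L : (fun h : R => h^-1 *: ((radial_integral k g \o shift x) (h *: delta_mx 0 a)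
     - radial_integral k g x)) @ 0^' -->
    radial_integral (k + P a) ('D_(delta_mx 0 a) g) x.
  by apply: DeriveDef; [apply/cvg_ex; eexists; exact: L|exact: cvg_lim L].
apply/cvgrPdist_le => e e0.
have nV : nbhs x V by exact: open_nbhs_nbhs.
have /nbhs_cube[d d0 dH] : \forall y \near x, V y /\ forall t, 0 <= t <= 1 ->
   `|'D_(delta_mx 0 a) g (dilation t y) - 'D_(delta_mx 0 a) g (dilation t x)| < e.
  by apply: filterS2 nV (dilation_unif cdg Vx e0) => y Vy H; split.
have near_d (s : R) : `|s| < d -> forall b,
    `|(s *: delta_mx 0 a + x : E) 0 b - x 0 b| < d.
  move=> sd b; rewrite !mxE addrK eqxx/=; case: eqP => _; rewrite ?mulr1//.
  by rewrite mulr0 normr0.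
near=> h.
have h0 : h != 0 by near: h; exact: nbhs_dnbhs_neq.
have hd : `|h| < d by near: h; exact: dnbhs0_lt.
have [Vy _] := dH _ (near_d h hd).
have C1 := @cont01X R (k + P a) _ (cont01_dilation cdg Vx).
have C2 := @cont01X R k _ (cont01_dilation cg0 Vx).
have C3 := @cont01X R k _ (cont01_dilation cg0 Vy).
rewrite /= {2 3}/radial_integral -int01B// -[h^-1 *: _]int01Z; last exact: cont01B.
rewrite -int01B//; last exact/cont01Z/cont01B.
apply: int01_le; first by apply: cont01B => //; exact/cont01Z/cont01B.
move=> t t01.
have [|c ch E1] := @MVT_line R n (fun y => g (dilation t y)) x (delta_mx 0 a) h.
  move=> s sh; have [Vs _] := dH _ (near_d s (le_lt_trans sh hd)).
  by have [] := dilation_derive (g := g) a t01 Vs cg.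
have [Vc Hc] := dH _ (near_d c (le_lt_trans ch hd)).
have [_ E2] := dilation_derive (g := g) a t01 Vc cg.
rewrite -mulrBr E1 E2 exprD -mulrA.
set u := 'D_ _ g (dilation t x); set v := 'D_ _ g _.
have -> : t ^+ k * (t ^+ P a * u) - h^-1 * (t ^+ k * (h * (t ^+ P a * v))) =
  (t ^+ k * t ^+ P a) * (u - v) by field.
rewrite normrM -[leRHS]mul1r ler_pM//.
  by have /andP[? ?] := t01; rewrite -exprD normrX ger0_norm// exprn_ile1.
by rewrite distrC; apply/ltW/Hc.
Unshelve. all: by end_near. Qed.

Lemma Cinfty_radial k g : Cinfty V g -> Cinfty V (radial_integral k g).
Proof.
move=> cg m; elim: m k g cg => [|m IH] k g cg;
  (split; first by move=> x Vx; apply: radial_continuous => // y; exact: Cinfty_cont) => //.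
move=> a; split => [x Vx|].
  by have [] := radial_derive k a Vx (cg 1%N).
apply: eq_Ck (IH (k + P a)%N _ (Cinfty_derive a cg)) => // x Vx.
by have [_ ->] := radial_derive k a Vx (cg 1%N).
Qed.

(** The fundamental theorem of calculus along [t |-> g (dilation t x)], from the projection at
    [t = 0] to [x] at [t = 1]. *)
Lemma hadamard g x : Cinfty V g -> V x ->
  g x = g (dilation 0 x) +
    \sum_(a | P a) x 0 a * radial_integral 0 ('D_(delta_mx 0 a) g) x.
Proof.
move=> cg Vx.
pose v : E := \row_a (if P a then x 0 a else 0).
pose phi t := \sum_(a | P a) x 0 a * 'D_(delta_mx 0 a) g (dilation t x).
have c1 a : cont01 (fun t => 'D_(delta_mx 0 a) g (dilation t x)).
  apply: (cont01_dilation (g := 'D_(delta_mx 0 a) g)) => // y Vy.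
  exact: Cinfty_cont (Cinfty_derive a cg) Vy.
have csum (r : seq 'I_n) : cont01 (fun t => \sum_(a <- r | P a)
      x 0 a * 'D_(delta_mx 0 a) g (dilation t x)) /\
   int01 (fun t => \sum_(a <- r | P a)
      x 0 a * 'D_(delta_mx 0 a) g (dilation t x)) =
   \sum_(a <- r | P a) x 0 a * radial_integral 0 ('D_(delta_mx 0 a) g) x.
  elim: r => [|b r [IH1 IH2]].
    split.
      rewrite (_ : (fun t => _) = cst 0) => [t _|]; first exact: cst_continuous.
      by apply/funext => t; rewrite big_nil.
    rewrite big_nil (eq_int01 (psi := fun t => 0 * 0)); last first.
      by move=> t _; rewrite big_nil mul0r.
    by rewrite int01Z ?mul0r// => t _; exact: cst_continuous.
  rewrite big_cons; case Pb: (P b).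
    rewrite (_ : (fun t => _) = (fun t => x 0 b * 'D_(delta_mx 0 b) g (dilation t x)
       + \sum_(a <- r | P a) x 0 a * 'D_(delta_mx 0 a) g (dilation t x))).
      split; first by apply: cont01D => //; exact: cont01Z.
      rewrite int01D//; last exact: cont01Z.
      rewrite IH2 int01Z//; congr (_ * _ + _).
      by apply: eq_int01 => t _; rewrite expr0 mul1r.
    by apply/funext => t; rewrite big_cons Pb.
  by rewrite (_ : (fun t => _) = (fun t => \sum_(a <- r | P a)
       x 0 a * 'D_(delta_mx 0 a) g (dilation t x)))//;
     apply/funext => t; rewrite big_cons Pb.
have [c2 I2] := csum (index_enum _).
have c3 : cont01 (fun t => g (dilation t x)).
  by apply: cont01_dilation => // y Vy; exact: Cinfty_cont cg Vy.
have D (t : R) : 0 < t < 1 -> is_derive t 1 (fun t => g (dilation t x)) (phi t).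
  move=> /andP[t0 t1].
  have Vt : V (dilation t x) by apply: sV => //; rewrite !ltW.
  have [dg gr] := C1_differentiable oV Vt (cg 1%N).
  have E1 := @line_growth R n g (dilation 0 x) v t.
  have F : (fun s => g (dilation s x)) = (fun s => g (s *: v + dilation 0 x)).
    by apply/funext => s; rewrite dilation_line.
  have dv : derivable g (dilation t x) v by exact: diff_derivable.
  apply: DeriveDef.
    by rewrite F /derivable E1 -dilation_line.
  rewrite F /derive E1 -dilation_line -/(derive _ _ _) gr /gradient /phi.
  rewrite [RHS]big_mkcond.
  by apply: eq_bigr => a _; rewrite mxE; case: (P a); rewrite ?mul0r.
have := int01_FTC c2 c3 D; rewrite I2 => ->.
by rewrite dilation1 addrC subrK.
Qed.

End Fixed.
End Radial.

(** * Weighted ideals *)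

Section Gluing.
Context {R : realType} {n : nat}.
Local Notation E := ('rV[R]_n).

Lemma sum_telescope_prod (chi : nat -> R) (K : nat) :
  \sum_(j < K) chi j * \prod_(i < j) (1 - chi i) = 1 - \prod_(i < K) (1 - chi i).
Proof.
elim: K => [|K IH]; first by rewrite !big_ord0 subrr.
by rewrite !big_ord_recr/= IH; ring.
Qed.

Lemma rational_cube (U : set E) (x : E) : nbhs x U -> exists (p : 'rV[rat]_n) (m : nat),
  (forall a, `|x 0 a - ratr (p 0 a)| < m.+1%:R^-1) /\
  forall y : E, (forall a, `|y 0 a - ratr (p 0 a)| <= 2 * m.+1%:R^-1) -> U y.
Proof.
move=> /nbhs_cube[e e0 eU].
(* With [rho] the inverse of [m.+1], the centre is within [rho] of [x] and the outer cube has
   half-width [2 * rho], so [3 * rho < e] keeps that cube inside the [e]-cube around [x]. *)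
have [m m4] : exists m : nat, m.+1%:R^-1 < e / 3.
  have /cvgrPdist_lt/(_ _ (divr_gt0 e0 (ltr0n _ 3%N))) := @cvg_harmonic R.
  move=> [m _ /(_ m (leqnn m))]; rewrite /= sub0r normrN ger0_norm//.
  by exists m.
have m0 : 0 < (m.+1%:R^-1 : R) by rewrite invr_gt0.
have ex_q (a : 'I_n) : exists q : rat, `|x 0 a - ratr q| < m.+1%:R^-1.
  have xx : x 0 a - m.+1%:R^-1 < x 0 a + m.+1%:R^-1.
    by rewrite (@lt_trans _ _ (x 0 a))// ?ltrDl// gtrDl oppr_lt0.
  have [q] := rat_in_itvoo xx; rewrite in_itv/= => /andP[q1 q2]; exists q.
  by rewrite distrC ltr_distl q1 q2.
exists (\row_a sval (cid (ex_q a))), m; split=> [a|y Hy].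
  by rewrite mxE; case: (cid _).
apply: eU => a; have := Hy a; rewrite mxE; case: (cid _) => q /= xq yq.
rewrite -(subrKA (ratr q)) (le_lt_trans (ler_normD _ _))//.
rewrite [X in _ + X]distrC; move: (m.+1%:R^-1) m4 xq yq => z; lra.
Qed.

(* A family of local solutions of [g = \sum_s h s * mu s] is glued with the
   functions [chi_j * \prod_(i < j) (1 - chi_i)], for bump functions [chi_j]
   indexed by the rational cubes: they form a partition of unity that is locally
   finite because [chi_j = 1] on the [j]-th cube. *)
Lemma glue_coefficients (S : finType) (mu : S -> E -> R) (g : E -> R)
    (V : set E) : open V ->
  (forall x, V x -> exists U, [/\ open U, U x &
     exists h : S -> E -> R, (forall s, Cinfty U (h s)) /\
       forall y, U y -> g y = \sum_s h s y * mu s y]) ->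
  exists h : S -> E -> R, (forall s, Cinfty V (h s)) /\
    forall y, V y -> g y = \sum_s h s y * mu s y.
Proof.
move=> oV loc.
pose Q : Type := ('rV[rat]_n * nat)%type.
pose rad (q : Q) : R := q.2.+1%:R^-1.
have rad0 q : 0 < rad q by rewrite invr_gt0.
pose inner (q : Q) : set E := [set x | forall a, `|x 0 a - ratr (q.1 0 a)| < rad q].
pose outer (q : Q) : set E := [set x | forall a, `|x 0 a - ratr (q.1 0 a)| <= 2 * rad q].
have o_inner q : open (inner q).
  rewrite openE => x Hx; apply/nbhs_cube.
  have H (a : 'I_n) : 0 < rad q - `|x 0 a - ratr (q.1 0 a)| by rewrite subr_gt0.
  exists (\big[Order.min/1]_a (rad q - `|x 0 a - ratr (q.1 0 a)|)).
    by elim/big_ind: _ => // ? ? ? ?; rewrite lt_min; apply/andP.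
  move=> y Hy a; have : `|y 0 a - x 0 a| < rad q - `|x 0 a - ratr (q.1 0 a)|.
    by apply: lt_le_trans (Hy a) _; exact: bigmin_le_cond.
  have := ler_normD (y 0 a - x 0 a) (x 0 a - ratr (q.1 0 a)).
  by rewrite subrKA; lra.
have c_outer q : open (~` outer q).
  rewrite openE => x /= /asboolP; rewrite asbool_neg => /asboolP.
  move=> /existsNP[a /negP]; rewrite -ltNge => Ha.
  apply/nbhs_cube; exists (`|x 0 a - ratr (q.1 0 a)| - 2 * rad q).
    by rewrite subr_gt0.
  move=> y Hy /(_ a) ya; have := Hy a; rewrite distrC.
  have := ler_normD (x 0 a - y 0 a) (y 0 a - ratr (q.1 0 a)).
  by rewrite subrKA; lra.
pose good (q : Q) (Uh : set E * (S -> E -> R)) := [/\ open Uh.1, outer q `<=` Uh.1,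
  forall s, Cinfty Uh.1 (Uh.2 s) & forall y, Uh.1 y -> g y = \sum_s Uh.2 s y * mu s y].
have ex_chi (q : Q) : exists chi : E -> R, [/\ Cinfty setT chi,
    forall x, inner q x -> chi x = 1 & forall x, ~ outer q x -> chi x = 0].
  have [chi [c1 c2 c3]] := cube_bump (map_mx ratr q.1 : E) (rad0 q).
  exists chi; split=> // x Hx.
    by apply: c2 => a; rewrite mxE; apply/ltW/Hx.
  have [a Ha] : exists a, ~ (`|x 0 a - ratr (q.1 0 a)| <= 2 * rad q).
    exact/existsNP.
  by apply: (c3 x a); rewrite mxE leNgt; apply/negP => /ltW.
(* index [j] : the [j]-th cube if it is contained in a good open set *)
pose ok (o : option Q) (ch : (E -> R) * (S -> E -> R)) := [/\ Cinfty setT ch.1,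
    forall q, o = Some q -> (exists Uh, good q Uh) ->
       forall x, inner q x -> ch.1 x = 1,
    forall s, Cinfty V (fun x => ch.1 x * ch.2 s x) &
    forall x, ch.1 x * g x = \sum_s (ch.1 x * ch.2 s x) * mu s x].
(* Indices that code no cube, or a cube in no good open set, get the zero bump and contribute
   nothing. *)
have ex_pair (j : nat) : exists ch, ok (pickle_inv j) ch.
  have triv (o : option Q) : (forall q, o = Some q -> ~ exists Uh, good q Uh) ->
      exists ch, ok o ch.
    move=> H; exists (fun=> 0, fun _ _ => 0); split=> //=.
    - exact: Cinfty_cst.
    - by move=> q /H.
    - by move=> s; apply: eq_Cinfty (Cinfty_cst V 0) => // x _; rewrite mulr0.
    - by move=> x; rewrite mul0r big1// => s _; rewrite !mul0r.
  case: (pickle_inv j) => [q|]; last exact: triv.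
  have [[[U h] [/= oU qU ch gh]]|nex] := pselect (exists Uh, good q Uh); last first.
    by apply: triv => q' [<-].
  have [chi [c1 c2 c3]] := ex_chi q.
  exists (chi, h); split => //=.
  - by move=> q' [<-] _.
  - move=> s; apply: Cinfty_local => x Vx.
    have [qx|nqx] := pselect (outer q x).
      exists U; first exact: qU.
      by apply: Cinfty_mul => //; apply: Cinfty_sub c1.
    exists (~` outer q) => //.
    by apply: eq_Cinfty (Cinfty_cst _ 0) => // y /c3 ->; rewrite mul0r.
  - move=> x; have [qx|nqx] := pselect (outer q x).
      rewrite gh; last exact: qU.
      by rewrite mulr_sumr; apply: eq_bigr => s _; rewrite mulrA.
    by rewrite c3// mul0r big1// => s _; rewrite !mul0r.
pose chi j := (sval (cid (ex_pair j))).1.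
pose h j := (sval (cid (ex_pair j))).2.
have chiC j : Cinfty setT (chi j) by rewrite /chi; case: (cid _) => ? [].
have hC j s : Cinfty V (fun x => chi j x * h j s x).
  by rewrite /chi /h; case: (cid _) => ? [].
have hE j x : chi j x * g x = \sum_s (chi j x * h j s x) * mu s x.
  by rewrite /chi /h; case: (cid _) => ? [].
have cov x : V x -> exists j, exists2 U, open U /\ U x & forall y, U y -> chi j y = 1.
  move=> /loc[U [oU Ux [h' [ch' gh']]]].
  have [p [m [p1 p2]]] := rational_cube (open_nbhs_nbhs (conj oU Ux)).
  pose q : Q := (p, m); exists (pickle q); exists (inner q) => [|y qy]; first by split.
  rewrite /chi; case: (cid _) => ? [_ /= H _ _]; apply: H qy.
    by rewrite pickleK_inv.
  by exists (U, h'); split.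
pose F j s x := (\prod_(i < j) (1 - chi i x)) * (chi j x * h j s x).
have FC j s : Cinfty V (F j s).
  apply: Cinfty_mul => //; apply: Cinfty_prod => // i _.
  by apply: Cinfty_sub_fun => //; [exact: Cinfty_cst|apply: Cinfty_sub (chiC i)].
(* [J x] is chosen pointwise, without any continuity. The partial sum up to [J x] is smooth
   nevertheless: terms after an index [k] with [chi k x = 1] vanish, so near each point it agrees
   with the sum up to one fixed [k]. *)
pose J x : nat := if pselect (V x) is left Vx then sval (cid (cov x Vx)) else 0%N.
have JP x : V x -> chi (J x) x = 1.
  by move=> Vx; rewrite /J; case: pselect => // Vx'; case: (cid _) => j [U [_ Ux]] /=; exact.
have F0 j k s x : chi k x = 1 -> (k < j)%N -> F j s x = 0.
  by move=> ck kj; rewrite /F (bigD1 (Ordinal kj))//= ck subrr !mul0r.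
have Fsum k l s x : chi k x = 1 -> (k <= l)%N ->
    \sum_(j < l.+1) F j s x = \sum_(j < k.+1) F j s x.
  move=> ck /subnK <-; elim: (l - k)%N => [//|d IH].
  by rewrite addSn big_ord_recr/= IH (F0 _ k)// ?addr0// ltnS leq_addl.
have Fsum' k l s x : chi k x = 1 -> chi l x = 1 ->
    \sum_(j < l.+1) F j s x = \sum_(j < k.+1) F j s x.
  by move=> ck cl; case/orP: (leq_total k l) => kl; [|apply/esym]; exact: Fsum.
exists (fun s x => \sum_(j < (J x).+1) F j s x); split.
  move=> s; apply: Cinfty_local => x Vx.
  have [k [U [oU Ux] Uk]] := cov x Vx.
  exists (U `&` V) => //; have oUV : open (U `&` V) by exact: openI.
  apply: eq_Cinfty (_ : Cinfty _ (fun y => \sum_(j < k.+1) F j s y)) => //.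
    by move=> y [Uy Vy]; apply: Fsum'; [exact: JP|exact: Uk].
  apply: Cinfty_sum => // j _; by apply: Cinfty_sub (FC j s) => ? [].
move=> x Vx; under eq_bigr do rewrite mulr_suml.
rewrite exchange_big/=.
have E1 (j : nat) : \sum_s F j s x * mu s x =
    (chi j x * \prod_(i < j) (1 - chi i x)) * g x.
  rewrite mulrAC hE mulr_suml; apply: eq_bigr => s _.
  by rewrite /F; ring.
under eq_bigr do rewrite E1.
rewrite -mulr_suml (sum_telescope_prod (chi^~ x)) big_ord_recr/= JP//.
by rewrite subrr mulr0 subr0 mul1r.
Qed.

End Gluing.

(** * Operations on weighted ideals *)

Section WeightedIdeal.
Context {R : realType} {n : nat}.
Local Notation E := ('rV[R]_n).
Variable w : 'I_n -> nat.
Implicit Types (V : set E) (f g : E -> R).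

Definition wdeg (s : 'I_n -> nat) : nat := \sum_(a < n) s a * w a.
Definition mono (s : 'I_n -> nat) (x : E) : R := \prod_(a < n) x 0 a ^+ s a.

Lemma Cinfty_mono V s : open V -> Cinfty V (mono s).
Proof.
move=> oV; apply: Cinfty_prod => // a _; apply: Cinfty_exp => //.
exact: Cinfty_coord.
Qed.

Lemma wideal_intro (T : finType) V i g (s : T -> 'I_n -> nat) (h : T -> E -> R) :
  (forall l, (i <= wdeg (s l))%N) -> (forall l, Cinfty V (h l)) ->
  (forall x, V x -> g x = \sum_l h l x * mono (s l) x) ->
  weighted_ideal w V i g.
Proof.
move=> si hC gE; exists #|T|, (fun k => s (enum_val k)), (fun k => h (enum_val k)).
split=> [l|l|x Vx]; [exact: si|exact: hC|].
by rewrite gE// (reindex_onto enum_val enum_rank)//= => [|l _];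
  [apply: eq_bigl => l; rewrite enum_valK eqxx|rewrite enum_rankK].
Qed.

Lemma wideal_ext V i g g' : (forall x, V x -> g x = g' x) ->
  weighted_ideal w V i g -> weighted_ideal w V i g'.
Proof.
by move=> E1 [k [s [h [h1 h2 h3]]]]; exists k, s, h; split=> // x Vx; rewrite -E1// h3.
Qed.

Lemma wideal_sub V U i g : U `<=` V -> weighted_ideal w V i g ->
  weighted_ideal w U i g.
Proof.
move=> UV [k [s [h [h1 h2 h3]]]]; exists k, s, h; split=> // [l|x /UV Vx].
  exact: Cinfty_sub (h2 l).
exact: h3.
Qed.

Lemma wideal_Cinfty V i g : open V -> weighted_ideal w V i g -> Cinfty V g.
Proof.
move=> oV [k [s [h [h1 h2 h3]]]].
apply: eq_Cinfty (_ : Cinfty V (fun x => \sum_(l < k) h l x * mono (s l) x)) => //.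
  by move=> x Vx; rewrite h3.
by apply: Cinfty_sum => // l _; apply: Cinfty_mul => //; exact: Cinfty_mono.
Qed.

Lemma wideal_le V i j g : (j <= i)%N -> weighted_ideal w V i g ->
  weighted_ideal w V j g.
Proof.
move=> ji [k [s [h [h1 h2 h3]]]]; exists k, s, h; split=> // l.
exact: leq_trans ji (h1 l).
Qed.

Lemma wideal0 V g : Cinfty V g -> weighted_ideal w V 0 g.
Proof.
move=> cg; exists 1%N, (fun _ _ => 0%N), (fun _ => g); split => // x _.
by rewrite big_ord1 big1 ?mulr1// => a _; rewrite expr0.
Qed.

Lemma wideal_zero V i : weighted_ideal w V i (fun=> 0).
Proof.
by exists 0%N, (fun _ _ => 0%N), (fun _ _ => 0); split=> [[]|[]|] //= x _; rewrite big_ord0.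
Qed.

Lemma wideal_add V i f g : weighted_ideal w V i f -> weighted_ideal w V i g ->
  weighted_ideal w V i (fun x => f x + g x).
Proof.
move=> [k [s [h [h1 h2 h3]]]] [k' [s' [h' [h1' h2' h3']]]].
apply: (@wideal_intro ('I_k + 'I_k')%type _ _ _
  (fun l => match l with inl l => s l | inr l => s' l end)
  (fun l => match l with inl l => h l | inr l => h' l end)).
- by case.
- by case.
- by move=> x Vx; rewrite big_sumType/= h3// h3'.
Qed.

Lemma wideal_mul V i j f g : open V ->
  weighted_ideal w V i f -> weighted_ideal w V j g ->
  weighted_ideal w V (i + j) (fun x => f x * g x).
Proof.
move=> oV [k [s [h [h1 h2 h3]]]] [k' [s' [h' [h1' h2' h3']]]].
apply: (@wideal_intro ('I_k * 'I_k')%type _ _ _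
  (fun l a => (s l.1 a + s' l.2 a)%N) (fun l x => h l.1 x * h' l.2 x)).
- move=> [l l'] /=; rewrite /wdeg; under eq_bigr do rewrite mulnDl.
  by rewrite big_split/= leq_add.
- by move=> [l l'] /=; exact: Cinfty_mul.
- move=> x Vx; rewrite h3// h3'// mulr_suml.
  rewrite -(pair_bigA _ (fun l l' => h l x * h' l' x *
     mono (fun a => (s l a + s' l' a)%N) x))/=; apply: eq_bigr => l _.
  rewrite mulr_sumr; apply: eq_bigr => l' _; rewrite /mono.
  by under [in RHS]eq_bigr do rewrite exprD; rewrite big_split/=; ring.
Qed.

Lemma wideal_mull V i f g : open V -> Cinfty V f -> weighted_ideal w V i g ->
  weighted_ideal w V i (fun x => f x * g x).
Proof. by move=> oV cf gi; rewrite -[i]add0n; apply: wideal_mul => //; exact: wideal0. Qed.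

Lemma wideal_sum (I : Type) (r : seq I) (P : pred I) V i (F : I -> E -> R) :
  (forall l, P l -> weighted_ideal w V i (F l)) ->
  weighted_ideal w V i (fun x => \sum_(l <- r | P l) F l x).
Proof.
move=> H; elim: r => [|l r IH].
  by apply: wideal_ext (wideal_zero V i) => x _; rewrite big_nil.
case Pl: (P l).
  by apply: wideal_ext (wideal_add (H l Pl) IH) => x _; rewrite big_cons Pl.
by apply: wideal_ext IH => x _; rewrite big_cons Pl.
Qed.

Lemma wideal_coord V a : weighted_ideal w V (w a) (fun x => x 0 a).
Proof.
exists 1%N, (fun _ b => (b == a)%N : nat), (fun _ _ => 1); split.
- by move=> _; rewrite (bigD1 a)//= eqxx mul1n leq_addr.
- by move=> _; exact: Cinfty_cst.
- move=> x _; rewrite big_ord1 mul1r (bigD1 a)//= eqxx expr1 big1 ?mulr1//.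
  by move=> b /negbTE ->; rewrite expr0.
Qed.

Lemma wideal_exp V i k g : open V -> weighted_ideal w V i g ->
  weighted_ideal w V (k * i) (fun x => g x ^+ k).
Proof.
move=> oV gi; elim: k => [|k IH].
  by rewrite mul0n; apply: wideal0; exact: Cinfty_cst.
rewrite mulSn; apply: wideal_ext (wideal_mul oV gi IH) => x _.
by rewrite exprS.
Qed.

(** [g = (g / x_a^i) * x_a^i], and [x_a^i] has weight [i * w a >= i]. *)
Lemma wideal_off V a i g : open V -> (0 < w a)%N -> (forall x, V x -> x 0 a != 0) ->
  Cinfty V g -> weighted_ideal w V i g.
Proof.
move=> oV wa H cg.
have c1 : weighted_ideal w V (i * w a) (fun x : E => x 0 a ^+ i).
  by apply: wideal_exp => //; exact: wideal_coord.
have c2 : Cinfty V (fun x : E => g x * (x 0 a ^+ i)^-1).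
  apply: Cinfty_mul => //; apply: Cinfty_inv => //.
    by move=> x /H; exact: expf_neq0.
  by apply: Cinfty_exp => //; exact: Cinfty_coord.
apply: wideal_ext (wideal_le _ (wideal_mull oV c2 c1)); last by rewrite leq_pmulr.
by move=> x Vx /=; rewrite divfK// expf_neq0// H.
Qed.

(* Only the finitely many exponents [s <= i] are needed. *)
Lemma wideal_normal V i g : open V -> weighted_ideal w V i g ->
  exists h : {s : {ffun 'I_n -> 'I_i.+1} | (i <= wdeg (fun a => s a))%N} -> E -> R,
    (forall s, Cinfty V (h s)) /\
    forall x, V x -> g x = \sum_s h s x * mono (fun a => val s a) x.
Proof.
move=> oV [k [s [h [h1 h2 h3]]]].
pose cap (l : 'I_k) : {ffun 'I_n -> 'I_i.+1} := [ffun a => inord (minn (s l a) i)].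
have capE l a : cap l a = minn (s l a) i :> nat.
  by rewrite ffunE inordK// ltnS geq_minr.
(* If the exponent of some coordinate of positive weight reaches [i], its capped factor alone has
   weight at least [i]; otherwise capping does not change the weight. *)
have capP l : (i <= wdeg (fun a => cap l a))%N.
  have [[a [wa sa]]|H] := pselect (exists a, (0 < w a)%N /\ (i <= s l a)%N).
    rewrite /wdeg (bigD1 a)//= capE (minn_idPr sa).
    by apply: leq_trans (leq_addr _ _); rewrite leq_pmulr.
  apply: leq_trans (h1 l) _; apply: leq_sum => a _; rewrite capE.
  have [->|wa] := posnP (w a); first by rewrite !muln0.
  rewrite leq_mul2r; apply/orP; right; rewrite leq_min leqnn/=.
  by rewrite leqNgt; apply/negP => sa; apply: H; exists a; split=> //; exact: ltnW.
pose c l : {s : {ffun 'I_n -> 'I_i.+1} | (i <= wdeg (fun a => s a))%N} :=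
  exist _ (cap l) (capP l).
exists (fun t x => \sum_(l < k | c l == t) h l x *
   mono (fun a => (s l a - cap l a)%N) x); split.
  move=> t; apply: Cinfty_sum => // l _; apply: Cinfty_mul => //.
  exact: Cinfty_mono.
move=> x Vx; rewrite h3// (partition_big c xpredT)//=; apply: eq_bigr => t _.
rewrite mulr_suml; apply: eq_bigr => l /eqP <-; rewrite -mulrA; congr (_ * _).
rewrite -big_split/=; apply: eq_bigr => a _; rewrite -exprD; congr (_ ^+ _).
by rewrite subnK// capE geq_minl.
Qed.

(** Local expansions may use different monomials; [wideal_normal] rewrites them over one finite
    family, whose coefficients can be glued. *)
Lemma wideal_local V i g : open V ->
  (forall x, V x -> exists U, [/\ open U, U x & weighted_ideal w U i g]) ->
  weighted_ideal w V i g.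
Proof.
move=> oV loc.
pose S := {s : {ffun 'I_n -> 'I_i.+1} | (i <= wdeg (fun a => s a))%N}.
have [|h [h1 h2]] := @glue_coefficients R n S
   (fun s => mono (fun a => val s a)) g V oV.
  move=> x /loc[U [oU Ux gU]]; exists U; split=> //.
  by have [h [h1 h2]] := wideal_normal oU gU; exists h.
by apply: (@wideal_intro S _ _ _ (fun s a => val s a) h) => // -[].
Qed.

(** [good] records the order of a function together with that of its derivative; the Leibniz rule
    makes it stable under products, so it passes from the coordinates to the monomials. *)
Lemma wideal_derive V i g a : open V -> weighted_ideal w V i g ->
  weighted_ideal w V (i - w a) ('D_(delta_mx 0 a) g).
Proof.
move=> oV.
pose D f := 'D_(delta_mx 0 a) f : E -> R.
pose good i f := weighted_ideal w V i f /\ weighted_ideal w V (i - w a) (D f).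
have goodC f : Cinfty V f -> good 0%N f.
  move=> cf; split; first exact: wideal0.
  by rewrite sub0n; apply: wideal0; exact: Cinfty_derive.
have good_mul i1 i2 f1 f2 : good i1 f1 -> good i2 f2 ->
    good (i1 + i2)%N (fun x => f1 x * f2 x).
  move=> [a1 b1] [a2 b2]; split; first exact: wideal_mul.
  have c1 := wideal_Cinfty oV a1; have c2 := wideal_Cinfty oV a2.
  have m1 := wideal_le (_ : i1 + i2 - w a <= i1 + (i2 - w a))%N (wideal_mul oV a1 b2).
  have m2 := wideal_le (_ : i1 + i2 - w a <= i2 + (i1 - w a))%N (wideal_mul oV a2 b1).
  have l1 : (i1 + i2 - w a <= i1 + (i2 - w a))%N by lia.
  have l2 : (i1 + i2 - w a <= i2 + (i1 - w a))%N by lia.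
  apply: wideal_ext (wideal_add (m1 l1) (m2 l2)) => x Vx.
  rewrite /D [RHS]deriveM//; exact: Cinfty_derivable Vx.
have good_exp k i1 f : good i1 f -> good (k * i1)%N (fun x => f x ^+ k).
  move=> gf; elim: k => [|k IH].
    by rewrite mul0n; apply: goodC; exact: Cinfty_cst.
  have [m1 m2] := good_mul _ _ _ _ gf IH.
  have E1 : (fun x => f x ^+ k.+1) = (fun x => f x * f x ^+ k).
    by apply/funext => x; rewrite exprS.
  by rewrite mulSn E1.
have good_coord b : good (w b) (fun x => x 0 b).
  split; first exact: wideal_coord.
  apply: wideal_ext (_ : weighted_ideal w V _ (fun=> (a == b)%:R)).
    by move=> x _; rewrite /D derive_coord mxE eqxx/= eq_sym.
  have [->|_] := eqVneq a b; last exact: wideal_zero.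
  by rewrite subnn; apply: wideal0; exact: Cinfty_cst.
have good_mono s : good (wdeg s) (mono s).
  rewrite /wdeg /mono; elim: (index_enum _) => [|b r IH].
    have -> : (fun x : E => \prod_(b <- [::]) x 0 b ^+ s b) = fun=> 1.
      by apply/funext => x; rewrite big_nil.
    by rewrite big_nil; apply: goodC; exact: Cinfty_cst.
  have -> : (fun x : E => \prod_(b <- b :: r) x 0 b ^+ s b) =
     fun x => x 0 b ^+ s b * \prod_(b <- r) x 0 b ^+ s b.
    by apply/funext => x; rewrite big_cons.
  by rewrite big_cons; apply: good_mul => //; exact: good_exp.
have good_le i1 i2 f : (i2 <= i1)%N -> good i1 f -> good i2 f.
  move=> le [a1 b1]; split; first exact: wideal_le a1.
  by apply: wideal_le b1; exact: leq_sub2r.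
move=> [k [s [h [h1 h2 h3]]]].
have gl (l : 'I_k) : good i (fun x => h l x * mono (s l) x).
  apply: (good_le (0 + wdeg (s l))%N); first exact: h1.
  by apply: good_mul => //; exact: goodC.
apply: wideal_ext (_ : weighted_ideal w V _
    (fun x => \sum_(l < k) D (fun x => h l x * mono (s l) x) x)); last first.
  by apply: wideal_sum => l _; have [] := gl l.
move=> x Vx; rewrite /D.
have -> : 'D_(delta_mx 0 a) g x = 'D_(delta_mx 0 a)
    (\sum_(l < k) (fun x => h l x * mono (s l) x)) x.
  apply: near_eq_derive; have : nbhs x V by exact: open_nbhs_nbhs.
  by apply: filterS => y Vy; rewrite h3// fct_sumE.
rewrite derive_sum// => l; have [m1 _] := gl l.
exact: Cinfty_derivable (wideal_Cinfty oV m1) Vx.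
Qed.

Let P : pred 'I_n := fun a => (0 < w a)%N.

Lemma mono_dilation s t x :
  mono s (dilation P t x) = t ^+ (\sum_(a | P a) s a) * mono s x.
Proof.
rewrite /mono -prodrXr [X in _ = X * _]big_mkcond/= -big_split/=; apply: eq_bigr => a _.
by rewrite mxE; case: (P a); rewrite ?mul1r// exprMn.
Qed.

(** Under dilation a monomial releases [t] to the power of its degree in the coordinates of positive
    weight. This power joins the radial integral of the coefficient, and the monomials stay the
    same. *)
Lemma wideal_radial V i k g : open V -> starlike P V ->
  weighted_ideal w V i g -> weighted_ideal w V i (radial_integral P k g).
Proof.
move=> oV sV [m [s [h [h1 h2 h3]]]].
exists m, s, (fun l => radial_integral P (k + \sum_(a | P a) s l a) (h l)); split=> //.
  by move=> l; exact: Cinfty_radial.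
move=> x Vx.
have ch (l : 'I_m) : cont01 (fun t => h l (dilation P t x)).
  by apply: (cont01_dilation (V := V)) => // y Vy; exact: Cinfty_cont (h2 l) Vy.
rewrite /radial_integral (eq_int01 (psi := fun t => \sum_(l < m)
   mono (s l) x * (t ^+ (k + \sum_(a | P a) s l a) * h l (dilation P t x)))).
  have csum (r : seq 'I_m) : cont01 (fun t => \sum_(l <- r) mono (s l) x *
       (t ^+ (k + \sum_(a | P a) s l a) * h l (dilation P t x))) /\
     int01 (fun t => \sum_(l <- r) mono (s l) x *
       (t ^+ (k + \sum_(a | P a) s l a) * h l (dilation P t x))) =
     \sum_(l <- r) int01 (fun t => t ^+ (k + \sum_(a | P a) s l a) *
        h l (dilation P t x)) * mono (s l) x.
    elim: r => [|l r [IH1 IH2]].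
      have -> : (fun t : R => \sum_(l <- [::]) mono (s l) x *
        (t ^+ (k + \sum_(a | P a) s l a) * h l (dilation P t x))) = fun=> 0 * 0.
        by apply/funext => t; rewrite big_nil mul0r.
      split=> [t _|]; first exact: cst_continuous.
      by rewrite big_nil int01Z ?mul0r// => t _; exact: cst_continuous.
    have -> : (fun t : R => \sum_(l <- l :: r) mono (s l) x *
        (t ^+ (k + \sum_(a | P a) s l a) * h l (dilation P t x))) =
      (fun t => mono (s l) x * (t ^+ (k + \sum_(a | P a) s l a) * h l (dilation P t x))
        + \sum_(l <- r) mono (s l) x *
        (t ^+ (k + \sum_(a | P a) s l a) * h l (dilation P t x))).
      by apply/funext => t; rewrite big_cons.
    have c1 := cont01X (k := k + \sum_(a | P a) s l a) (ch l).
    split; first by apply: cont01D => //; exact: cont01Z.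
    rewrite int01D//; last exact: cont01Z.
    by rewrite IH2 int01Z// big_cons [_ * int01 _]mulrC.
  by have [_ ->] := csum (index_enum _).
move=> t t01; rewrite h3; last exact: sV.
rewrite mulr_sumr; apply: eq_bigr => l _.
by rewrite -/(mono _ _) mono_dilation exprD; ring.
Qed.

(** Each term of Hadamard's formula carries a factor [x_b], which restores the weight [w b] lost by
    the derivative. *)
Lemma wideal_hadamard V i f : open V -> starlike P V -> Cinfty V f ->
  (forall x, V x -> f (dilation P 0 x) = 0) ->
  (forall b, P b -> weighted_ideal w V (i - w b) ('D_(delta_mx 0 b) f)) ->
  weighted_ideal w V i f.
Proof.
move=> oV sV cf f0 H.
apply: wideal_ext (_ : weighted_ideal w V i (fun x => \sum_(a | P a)
   x 0 a * radial_integral P 0 ('D_(delta_mx 0 a) f) x)).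
  by move=> x Vx; rewrite [RHS](hadamard oV sV cf Vx) f0// add0r.
apply: wideal_sum => b Pb.
have m1 := wideal_mul oV (wideal_coord V b) (wideal_radial 0 oV sV (H b Pb)).
by apply: wideal_le m1; lia.
Qed.

End WeightedIdeal.

(** * Charts and smooth functions *)

Section Charts.
Context {R : realType} {n : nat}.
Local Notation E := ('rV[R]_n).

Section Topological.
Context {M : topologicalType}.
Implicit Types (c : chart R n M) (U : set M).

Definition cimg c U : set E := cmap c @` (cdom c `&` U).

Lemma cimgP c U x : cimg c U x <->
  [/\ cdom c (cinv c x), U (cinv c x) & cmap c (cinv c x) = x].
Proof.
split; last by move=> [d u E1]; exists (cinv c x).
by move=> [m [dm Um] <-]; rewrite (cmapK dm).
Qed.

Lemma cimg_cmap c U m : cdom c m -> U m -> cimg c U (cmap c m).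
Proof. by move=> dm Um; exists m. Qed.

Lemma sub_cimg c U V : U `<=` V -> cimg c U `<=` cimg c V.
Proof. by move=> UV x [m [dm /UV Vm] <-]; exists m. Qed.

Lemma open_cimg c U : open U -> open (cimg c U).
Proof.
move=> oU; rewrite openE => _ [m [dm Um] <-].
have ix : (cmap c @` cdom c) (cmap c m) by exists m.
have nU : nbhs (cinv c (cmap c m)) U by rewrite cmapK//; exact: open_nbhs_nbhs.
have n1 := open_nbhs_nbhs (conj (@cimg_open _ _ _ c) ix).
have n2 : nbhs (cmap c m) (cinv c @^-1` U) := cinv_cont ix nU.
apply: filterS2 n1 n2 => _ [p dp <-]; rewrite /preimage/= cmapK// => Up.
by exists p.
Qed.

Lemma open_cpreim c (A : set E) : open A -> open (cdom c `&` cmap c @^-1` A).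
Proof.
move=> oA; rewrite openE => m [dm Am].
have n1 := open_nbhs_nbhs (conj (cdom_open c) dm).
have n2 : nbhs m (cmap c @^-1` A).
  by apply: (cmap_cont dm); exact: open_nbhs_nbhs.
by apply: filterS2 n1 n2 => p; split.
Qed.

Lemma Cinfty_transfer c c' U (f : M -> R) : open U ->
  (forall a, Cinfty (overlap c' c) (fun x => transition c' c x 0 a)) ->
  Cinfty (cimg c U) (f \o cinv c) ->
  Cinfty (cimg c' (cdom c `&` U)) (f \o cinv c').
Proof.
move=> oU tr cf.
have oV : open (cimg c' (cdom c `&` U)).
  by apply/open_cimg/openI => //; exact: cdom_open.
apply: eq_Cinfty (_ : Cinfty _ ((f \o cinv c) \o transition c' c)) => //.
  by move=> _ [p [d' [d u]] <-]; rewrite /transition/= !cmapK.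
apply: Cinfty_comp cf => //; first exact: open_cimg.
- by move=> _ [p [d' [d u]] <-]; rewrite /transition/= cmapK//; exists p.
- move=> b; apply: Cinfty_sub (tr b) => _ [p [d' [d u]] <-].
  by exists p.
Qed.

End Topological.

Context {M : smooth_manifold R n}.
Implicit Types (c : chart R n M) (U V : set M) (f g : M -> R).

Lemma smooth_ext U f g : open U -> (forall m, U m -> f m = g m) ->
  smooth U f -> smooth U g.
Proof.
move=> oU fg sf c Ac; apply: eq_Cinfty (sf c Ac); first exact: open_cimg.
by move=> _ [p [d u] <-] /=; rewrite cmapK// fg.
Qed.

Lemma smooth_local U f : (forall m, U m -> exists2 V, V m & smooth V f) ->
  smooth U f.
Proof.
move=> loc c Ac; apply: Cinfty_local => _ [m [d u] <-].
have [V Vm sV] := loc m u; exists (cimg c V); last exact: sV.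
exact: cimg_cmap.
Qed.

Lemma smooth_sub U V f : V `<=` U -> smooth U f -> smooth V f.
Proof. by move=> VU sf; apply: smooth_local => m /VU; exists U. Qed.

Lemma smooth_cst U (a : R) : smooth U (fun=> a).
Proof. by move=> c Ac; exact: Cinfty_cst. Qed.

Lemma smooth_add U f g : open U -> smooth U f -> smooth U g ->
  smooth U (fun m => f m + g m).
Proof.
move=> oU sf sg c Ac; apply: Cinfty_add (sf c Ac) (sg c Ac).
exact: open_cimg.
Qed.

Lemma smooth_mul U f g : open U -> smooth U f -> smooth U g ->
  smooth U (fun m => f m * g m).
Proof.
move=> oU sf sg c Ac; apply: Cinfty_mul (sf c Ac) (sg c Ac).
exact: open_cimg.
Qed.

Lemma smooth_opp U f : open U -> smooth U f -> smooth U (fun m => - f m).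
Proof.
move=> oU sf c Ac; apply: Cinfty_opp (sf c Ac); exact: open_cimg.
Qed.

Lemma smooth_subf U f g : open U -> smooth U f -> smooth U g ->
  smooth U (fun m => f m - g m).
Proof. by move=> oU sf sg; apply: smooth_add => //; exact: smooth_opp. Qed.

Lemma smooth_sum U (I : Type) (r : seq I) (P : pred I) (F : I -> M -> R) :
  open U -> (forall i, P i -> smooth U (F i)) ->
  smooth U (fun m => \sum_(i <- r | P i) F i m).
Proof.
move=> oU HF c Ac.
apply: (@Cinfty_sum R n _ _ r P (fun i => F i \o cinv c)) => [|i Pi].
  exact: open_cimg.
exact: HF.
Qed.

Lemma smooth_chart_atlas c : atlas c -> smooth_chart c.
Proof. by move=> Ac c' Ac'; exact: atlas_compatible. Qed.

(** [smooth] speaks of the charts of [atlas] only; this lemma and [Cinfty_smooth] pass to arbitrary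
    charts of the maximal atlas. *)
Lemma smooth_Cinfty c U f : smooth_chart c -> open U -> smooth U f ->
  Cinfty (cimg c U) (f \o cinv c).
Proof.
move=> sc oU sf; apply: Cinfty_local => _ [m [d u] <-].
have [c' Ac' d'] := atlas_cover m.
exists (cimg c (cdom c' `&` U)); first exact: cimg_cmap.
apply: Cinfty_transfer (sf c' Ac') => // a.
by have [+ _] := sc c' Ac'; exact.
Qed.

Lemma Cinfty_smooth c U f : smooth_chart c -> open U ->
  Cinfty (cimg c U) (f \o cinv c) -> smooth (cdom c `&` U) f.
Proof.
move=> sc oU sf c' Ac'; apply: Cinfty_transfer sf => // a.
by have [_] := sc c' Ac'; exact.
Qed.

Lemma smooth_comp_chart c U (h : E -> R) : smooth_chart c -> open U ->
  Cinfty (cimg c U) h -> smooth (cdom c `&` U) (h \o cmap c).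
Proof.
move=> sc oU ch; apply: Cinfty_smooth => //.
apply: eq_Cinfty ch; first exact: open_cimg.
by move=> _ [m [d u] <-] /=; rewrite cmapK.
Qed.

Lemma smooth_coord c a : smooth_chart c -> smooth (cdom c) (fun p => cmap c p 0 a).
Proof.
move=> sc; have := @smooth_comp_chart c setT (fun x => x 0 a) sc openT _.
by rewrite setIT; apply; exact: Cinfty_coord.
Qed.

Lemma smooth_chartP c : (forall a, smooth (cdom c) (fun p => cmap c p 0 a)) ->
  (forall U f, open U -> smooth U f -> Cinfty (cimg c U) (f \o cinv c)) ->
  smooth_chart c.
Proof.
move=> H1 H2 c' Ac'; split=> a.
  have := H2 _ _ (cdom_open c') (smooth_coord a (smooth_chart_atlas Ac')).
  exact.
exact: H1 c' Ac'.
Qed.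

Lemma smooth_nearI U m f : open U -> U m -> smooth U f -> smooth_near m f.
Proof. by move=> oU Um sf; exists U. Qed.

Lemma smooth_near_coord c m a : smooth_chart c -> cdom c m ->
  smooth_near m (fun p => cmap c p 0 a).
Proof.
move=> sc dm; apply: smooth_nearI dm _; first exact: cdom_open.
exact: smooth_coord.
Qed.

Lemma smooth_near_cst m (a : R) : smooth_near (M := M) m (fun=> a).
Proof. by apply: (smooth_nearI (U := setT)) => //; [exact: openT|exact: smooth_cst]. Qed.

Lemma smooth_near_add m f g : smooth_near m f -> smooth_near m g ->
  smooth_near m (fun p => f p + g p).
Proof.
move=> [U [oU Um sU]] [V [oV Vm sV]].
apply: (@smooth_nearI (U `&` V)) => //; first exact: openI.
apply: smooth_add; [exact: openI|apply: smooth_sub sU|apply: smooth_sub sV];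
by move=> ? [].
Qed.

Lemma smooth_near_mul m f g : smooth_near m f -> smooth_near m g ->
  smooth_near m (fun p => f p * g p).
Proof.
move=> [U [oU Um sU]] [V [oV Vm sV]].
apply: (@smooth_nearI (U `&` V)) => //; first exact: openI.
apply: smooth_mul; [exact: openI|apply: smooth_sub sU|apply: smooth_sub sV];
by move=> ? [].
Qed.

Lemma smooth_near_sum m (I : Type) (r : seq I) (P : pred I) (F : I -> M -> R) :
  (forall i, P i -> smooth_near m (F i)) ->
  smooth_near m (fun p => \sum_(i <- r | P i) F i p).
Proof.
move=> H; elim: r => [|i r IH].
  have -> : (fun p => \sum_(i <- [::] | P i) F i p) = fun=> 0.
    by apply/funext => p; rewrite big_nil.
  exact: smooth_near_cst.
case Pi: (P i).
  have -> : (fun p => \sum_(i <- i :: r | P i) F i p) =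
      fun p => F i p + \sum_(i <- r | P i) F i p.
    by apply/funext => p; rewrite big_cons Pi.
  by apply: smooth_near_add => //; exact: H.
have -> : (fun p => \sum_(i <- i :: r | P i) F i p) =
    fun p => \sum_(i <- r | P i) F i p.
  by apply/funext => p; rewrite big_cons Pi.
exact: IH.
Qed.

Lemma smooth_near_Cinfty c m f : smooth_chart c -> cdom c m -> smooth_near m f ->
  exists V : set E, [/\ open V, V (cmap c m) & Cinfty V (f \o cinv c)].
Proof.
move=> sc dm [U [oU Um sf]]; exists (cimg c U); split.
- exact: open_cimg.
- exact: cimg_cmap.
- exact: smooth_Cinfty.
Qed.

(* The pitfall that [smooth_near] speaks of total functions is harmless: only
   germs matter. *)
Lemma smooth_near_ext m f g : (\forall p \near m, f p = g p) ->
  smooth_near m f -> smooth_near m g.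
Proof.
rewrite -nbhs_nearE nbhsE => -[W [oW Wm] fg] [U [oU Um sU]].
apply: (@smooth_nearI (U `&` W)) => //; first exact: openI.
apply: (@smooth_ext _ f); first exact: openI.
  by move=> p [_ /fg].
by apply: smooth_sub sU => ? [].
Qed.

(* A compact cube of a chart is closed in [M] because [M] is Hausdorff, so that a
   bump function on the chart extends by zero. *)
Lemma manifold_bump (U : set M) m : open U -> U m ->
  exists chi : M -> R, [/\ smooth setT chi,
    exists W, [/\ open W, W m & forall p, W p -> chi p = 1] &
    exists K, [/\ closed K, K `<=` U & forall p, ~ K p -> chi p = 0]].
Proof.
move=> oU Um; have [c Ac dm] := atlas_cover m.
have sc := smooth_chart_atlas Ac.
have nU : nbhs (cmap c m) (cimg c U).
  by apply: open_nbhs_nbhs; split; [exact: open_cimg|exact: cimg_cmap].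
have /nbhs_cube[e e0 eU] := nU.
have e30 : 0 < e / 3 by rewrite divr_gt0.
have [chi [chiC chi1 chi0]] := cube_bump (cmap c m) e30.
pose cube := [set x : E | forall a, x 0 a \in
  `[cmap c m 0 a - 2 * (e / 3), cmap c m 0 a + 2 * (e / 3)]].
have cubeP x : cube x <-> forall a, `|x 0 a - cmap c m 0 a| <= 2 * (e / 3).
  by split=> H a; have := H a; rewrite in_itv/= ler_distl.
have ccube : compact cube.
  apply: (@rV_compact _ _ (fun a => `[cmap c m 0 a - 2 * (e / 3),
     cmap c m 0 a + 2 * (e / 3)]%classic)) => a.
  exact: segment_compact.
have cubeU : cube `<=` cimg c U.
  move=> x /cubeP Hx; apply: eU => a; apply: le_lt_trans (Hx a) _; lra.
pose K := cinv c @` cube.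
have cK : closed K.
  apply: compact_closed; first exact: man_hausdorff.
  apply: continuous_compact => //; apply: continuous_in_subspaceT => x.
  rewrite inE => /cubeU/cimgP[d _ E1]; apply: cinv_cont.
  by exists (cinv c x).
have KU p : K p -> cdom c p /\ U p.
  by move=> [x /cubeU/cimgP[d u _] <-].
pose X (p : M) : R := if `[< cdom c p >] then chi (cmap c p) else 0.
have X0 p : ~ K p -> X p = 0.
  rewrite /X; case: asboolP => // dp nK.
  have [a Ha] : exists a, ~ (`|cmap c p 0 a - cmap c m 0 a| <= 2 * (e / 3)).
    apply/existsNP => H; apply: nK; exists (cmap c p); last exact: cmapK.
    exact/cubeP.
  by apply: (chi0 _ a); rewrite leNgt; apply/negP => /ltW.
exists X; split.
- apply: smooth_local => p _; have [dp|ndp] := pselect (cdom c p).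
    exists (cdom c) => //.
    apply: (@smooth_ext _ (chi \o cmap c)); first exact: cdom_open.
      by move=> q dq; rewrite /X asboolT.
    have := @smooth_comp_chart c setT chi sc openT.
    by rewrite setIT; apply; exact: Cinfty_sub chiC.
  exists (~` K); first by move=> /KU[].
  apply: (@smooth_ext _ (fun=> 0)); first exact: closed_openC.
    by move=> q /X0.
  exact: smooth_cst.
- exists (cdom c `&` cmap c @^-1` (ball (cmap c m) (e / 3))); split.
  + apply: open_cpreim; exact: ball_open.
  + by split => //; exact: ballxx.
  + move=> p [dp [_ bp]]; rewrite /X asboolT//; apply: chi1 => a; apply: ltW.
    by have := bp 0 a; rewrite /ball/= distrC.
- by exists K; split=> // p /KU[].
Qed.

End Charts.

(** * Tangent vectors *)

Section Tangent.
Context {R : realType} {n : nat} {M : smooth_manifold R n}.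
Local Notation E := ('rV[R]_n).
Implicit Types (c : chart R n M) (U V : set M) (f g : M -> R) (m : M).
Implicit Types (v u : @tvec R n M).

Lemma tvecD u v f : (u + v) f = u f + v f. Proof. by []. Qed.
Lemma tvecZ (a : R) v f : (a *: v) f = a * v f. Proof. by []. Qed.
Lemma tvec_sum (I : Type) (r : seq I) (P : pred I) (F : I -> @tvec R n M) f :
  (\sum_(i <- r | P i) F i) f = \sum_(i <- r | P i) F i f.
Proof. by rewrite fct_sumE. Qed.

Section Fixed.
Variables (m : M) (v : @tvec R n M).
Hypothesis tv : tangent m v.

Lemma tangent_near f g : smooth_near m f ->
  (\forall p \near m, f p = g p) -> v f = v g.
Proof.
move=> sf fg; case: tv => _ _ H _; apply: H => //.
exact: smooth_near_ext fg sf.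
Qed.

Lemma tangent_cst (a : R) : v (fun=> a) = 0.
Proof.
case: tv => lin leib _ _; have s1 := smooth_near_cst m (1 : R).
have v1 : v (fun=> 1) = 0.
  have := leib _ _ s1 s1; rewrite !mul1r.
  by move=> /eqP; rewrite -subr_eq subrr eq_sym => /eqP.
have v0 : v (fun=> 0) = 0.
  have s0 := smooth_near_cst m (0 : R).
  have := lin _ _ 1 s0 s0.
  have -> : (fun p : M => 1 * (0 : R) + 0) = fun=> 0 by apply/funext => p; rewrite mul1r addr0.
  by rewrite mul1r => /eqP; rewrite -subr_eq subrr eq_sym => /eqP.
have := lin _ _ a s1 (smooth_near_cst m 0).
have -> : (fun p : M => a * 1 + 0) = fun=> a by apply/funext => p; rewrite mulr1 addr0.
by rewrite v1 v0 mulr0 addr0.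
Qed.

Lemma tangent_add f g : smooth_near m f -> smooth_near m g ->
  v (fun p => f p + g p) = v f + v g.
Proof.
case: tv => lin _ _ _ sf sg; have := lin _ _ 1 sf sg.
have -> : (fun p => 1 * f p + g p) = fun p => f p + g p.
  by apply/funext => p; rewrite mul1r.
by rewrite mul1r.
Qed.

Lemma tangent_mul f g : smooth_near m f -> smooth_near m g ->
  v (fun p => f p * g p) = f m * v g + g m * v f.
Proof. by case: tv => _ leib _ _; exact: leib. Qed.

Lemma tangent_scale (a : R) f : smooth_near m f -> v (fun p => a * f p) = a * v f.
Proof.
move=> sf; rewrite tangent_mul//; last exact: smooth_near_cst.
by rewrite tangent_cst mulr0 addr0.
Qed.

Lemma tangent_sub_fun f g : smooth_near m f -> smooth_near m g ->
  v (fun p => f p - g p) = v f - v g.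
Proof.
move=> sf sg.
have E1 : (fun p => f p - g p) = fun p => f p + (-1) * g p.
  by apply/funext => p; rewrite mulN1r.
rewrite E1 tangent_add ?tangent_scale ?mulN1r//.
by apply: smooth_near_mul => //; exact: smooth_near_cst.
Qed.

Lemma tangent_sum (I : Type) (r : seq I) (P : pred I) (F : I -> M -> R) :
  (forall i, P i -> smooth_near m (F i)) ->
  v (fun p => \sum_(i <- r | P i) F i p) = \sum_(i <- r | P i) v (F i).
Proof.
move=> H; elim: r => [|i r IH].
  have -> : (fun p => \sum_(i <- [::] | P i) F i p) = fun=> 0.
    by apply/funext => p; rewrite big_nil.
  by rewrite tangent_cst big_nil.
rewrite big_cons; case Pi: (P i).
  have -> : (fun p => \sum_(i <- i :: r | P i) F i p) =
      fun p => F i p + \sum_(i <- r | P i) F i p.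
    by apply/funext => p; rewrite big_cons Pi.
  by rewrite tangent_add ?IH//; [exact: H|exact: smooth_near_sum].
have -> : (fun p => \sum_(i <- i :: r | P i) F i p) =
    fun p => \sum_(i <- r | P i) F i p.
  by apply/funext => p; rewrite big_cons Pi.
exact: IH.
Qed.

(* Hadamard's lemma around [cmap c m]. *)
Lemma tangent_coord c f : smooth_chart c -> cdom c m -> smooth_near m f ->
  v f = \sum_a 'D_(delta_mx 0 a) (f \o cinv c) (cmap c m) *
          v (fun p => cmap c p 0 a).
Proof.
move=> sc dm sf; set p := cmap c m.
have [V [oV Vp cF]] := smooth_near_Cinfty sc dm sf.
have /nbhs_cube[e e0 eV] : nbhs p V by exact: open_nbhs_nbhs.
pose B : set E := ball 0 e.
have oB : open B by exact: ball_open.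
have BP (y : E) : B y -> forall a, `|y 0 a| < e.
  by move=> [_ H] a; have := H 0 a; rewrite /ball/= mxE sub0r normrN.
have BPr (y : E) : (forall a, `|y 0 a| < e) -> B y.
  move=> H; split=> // i a; rewrite ord1 /ball/= mxE sub0r normrN; exact: H.
have sB : starlike (xpredT : pred 'I_n) B.
  move=> x t Bx /andP[t0 t1]; apply: BPr => a; rewrite mxE normrM ger0_norm//.
  by apply: le_lt_trans (BP _ Bx a); rewrite ler_piMl.
(* Translated so that the base point becomes [0], the centre of the dilations of all coordinates. *)
pose G (y : E) := f (cinv c (y + p)).
have GV (y : E) : B y -> V (y + p).
  by move=> By; apply: eV => a; rewrite mxE addrK; exact: BP.
have cshift (W : set E) b : Cinfty W (fun y : E => (y + p) 0 b).
  apply: (@Cinfty_sub _ _ setT) => //.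
  apply: eq_Cinfty (_ : Cinfty setT (fun y : E => y 0 b + p 0 b)) => //.
  - exact: openT.
  - by move=> y _; rewrite mxE.
  - by apply: Cinfty_add; [exact: openT|exact: Cinfty_coord|exact: Cinfty_cst].
have cG : Cinfty B G.
  exact: (Cinfty_comp oB oV GV (cshift B) cF).
have B0 : B 0 by exact: ballxx.
pose k a (y : E) := radial_integral (xpredT : pred 'I_n) 0 ('D_(delta_mx 0 a) G) y.
have ck a : Cinfty B (k a) by apply: Cinfty_radial => //; exact: Cinfty_derive.
have dil0 (y : E) : dilation (xpredT : pred 'I_n) 0 y = 0.
  by apply/rowP => a; rewrite !mxE mul0r.
have k0 a : k a 0 = 'D_(delta_mx 0 a) (f \o cinv c) p.
  have dilt (t : R) : dilation (xpredT : pred 'I_n) t 0 = 0.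
    by apply/rowP => b; rewrite !mxE mulr0.
  rewrite /k /radial_integral (eq_int01 (psi := fun t => 'D_(delta_mx 0 a) G 0 * 1)).
    have c1 : cont01 (fun _ : R => 1 : R) by move=> t _; exact: cst_continuous.
    rewrite int01Z// /int01 Rintegral_cst//= lebesgue_measure_itv/= lte_fin ltr01/=.
    have Eh : (fun h : R => h^-1 *: ((G \o shift 0) (h *: delta_mx 0 a) - G 0)) =
      (fun h : R => h^-1 *: (((f \o cinv c) \o shift p) (h *: delta_mx 0 a) -
         (f \o cinv c) p)).
      by apply/funext => h; rewrite /= /G addr0 add0r.
    by rewrite /derive Eh subr0 !mulr1.
  by move=> t _; rewrite expr0 mul1r dilt mulr1.
pose xa a (q : M) := cmap c q 0 a - p 0 a.
pose ka a (q : M) := k a (cmap c q - p).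
pose W := cdom c `&` cmap c @^-1` (ball p e).
have oW : open W by apply: open_cpreim; exact: ball_open.
have Wm : W m by split=> //; exact: ballxx.
have WB q : W q -> B (cmap c q - p).
  move=> [_ [_ H]]; apply: BPr => a; have := H 0 a.
  by rewrite /ball/= distrC !mxE.
have s_xa a : smooth_near m (xa a).
  apply: smooth_near_add; first exact: smooth_near_coord.
  exact: smooth_near_cst.
have s_ka a : smooth_near m (ka a).
  apply: (smooth_nearI oW Wm).
  have := @smooth_comp_chart _ _ M c W (fun x => k a (x - p)) sc oW.
  have -> : cdom c `&` W = W by apply/seteqP; split=> [? []|? []].
  apply; apply: (@Cinfty_comp _ _ _ (cimg c W) B (fun x => x - p) (k a)) => //.
  - exact: open_cimg.
  - by move=> _ [q [dq Wq] <-]; exact: WB.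
  - move=> b; apply: eq_Cinfty (_ : Cinfty (cimg c W) (fun y : E => y 0 b - p 0 b)).
    + exact: open_cimg.
    + by move=> y _; rewrite !mxE.
    + apply: Cinfty_sub_fun; [exact: open_cimg|exact: Cinfty_coord|exact: Cinfty_cst].
have fE : \forall q \near m, f q = f m + \sum_a xa a q * ka a q.
  have : nbhs m W by exact: open_nbhs_nbhs.
  apply: filterS => q Wq.
  have := hadamard oB sB cG (WB q Wq); rewrite dil0 /G subrK add0r !cmapK//; last by case: Wq.
  by move=> ->; congr (_ + _); apply: eq_bigr => a _; rewrite !mxE.
rewrite (tangent_near sf fE) tangent_add; last 2 first.
- exact: smooth_near_cst.
- by apply: smooth_near_sum => a _; exact: smooth_near_mul.
rewrite tangent_cst add0r tangent_sum => [|a _]; last exact: smooth_near_mul.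
apply: eq_bigr => a _; rewrite tangent_mul// /xa subrr mul0r add0r.
rewrite /ka subrr k0 tangent_sub_fun ?tangent_cst ?subr0//.
- exact: smooth_near_coord.
- exact: smooth_near_cst.
Qed.

End Fixed.

(** Equality on all total functions also uses that tangent vectors are [0] on functions not smooth
    near [m]. *)
Lemma tangent_eq m v u c : smooth_chart c -> cdom c m -> tangent m v -> tangent m u ->
  (forall a, v (fun p => cmap c p 0 a) = u (fun p => cmap c p 0 a)) -> v = u.
Proof.
move=> sc dm tv tu H; apply/funext => f.
have [sf|nf] := pselect (smooth_near m f).
  rewrite (tangent_coord tv sc dm sf) (tangent_coord tu sc dm sf).
  by apply: eq_bigr => a _; rewrite H.
by case: tv => _ _ _ ->//; case: tu => _ _ _ ->.
Qed.

Lemma tangent0 m : tangent m (0 : @tvec R n M).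
Proof.
by split=> // [f g a _ _|f g _ _] /=; rewrite /GRing.zero/= ?mulr0 ?addr0.
Qed.

Lemma tangentD m v u : tangent m v -> tangent m u -> tangent m (v + u).
Proof.
move=> tv tu; case: (tv) (tu) => [l1 m1 e1 z1] [l2 m2 e2 z2]; split.
- by move=> f g a sf sg; rewrite !tvecD l1// l2//; ring.
- by move=> f g sf sg; rewrite !tvecD m1// m2//; ring.
- by move=> f g sf sg fg; rewrite !tvecD (e1 _ _ sf sg fg) (e2 _ _ sf sg fg).
- by move=> f nf; rewrite !tvecD z1// z2// addr0.
Qed.

Lemma tangentZ m (b : R) v : tangent m v -> tangent m (b *: v).
Proof.
move=> [l1 m1 e1 z1]; split.
- by move=> f g a sf sg; rewrite !tvecZ l1//; ring.
- by move=> f g sf sg; rewrite !tvecZ m1//; ring.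
- by move=> f g sf sg fg; rewrite !tvecZ (e1 _ _ sf sg fg).
- by move=> f nf; rewrite !tvecZ z1// mulr0.
Qed.

Lemma tangent_sumv m (I : Type) (r : seq I) (P : pred I) (F : I -> @tvec R n M) :
  (forall i, P i -> tangent m (F i)) -> tangent m (\sum_(i <- r | P i) F i).
Proof.
by move=> H; elim/big_ind: _ => //; [exact: tangent0|exact: tangentD].
Qed.

Definition coord_vec c (a : 'I_n) (m : M) : @tvec R n M := fun f =>
  if `[< smooth_near m f >] then 'D_(delta_mx 0 a) (f \o cinv c) (cmap c m) else 0.

Lemma coord_vecE c a m f : smooth_near m f ->
  coord_vec c a m f = 'D_(delta_mx 0 a) (f \o cinv c) (cmap c m).
Proof. by move=> sf; rewrite /coord_vec asboolT. Qed.

Lemma coord_vec_tangent c a m : smooth_chart c -> cdom c m ->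
  tangent m (coord_vec c a m).
Proof.
move=> sc dm.
have D f : smooth_near m f -> derivable (f \o cinv c) (cmap c m) (delta_mx 0 a).
  move=> /(smooth_near_Cinfty sc dm)[V [_ Vm cf]]; exact: Cinfty_derivable cf Vm.
split.
- move=> f g b sf sg.
  have sbf : smooth_near m (fun p => b * f p).
    by apply: smooth_near_mul => //; exact: smooth_near_cst.
  rewrite !coord_vecE//; last exact: smooth_near_add.
  have := deriveD (derivableZ (k := b) (D f sf)) (D g sg).
  by rewrite deriveZ; [exact|exact: D].
- move=> f g sf sg; rewrite !coord_vecE//; last exact: smooth_near_mul.
  have := deriveM (D f sf) (D g sg).
  by rewrite /= cmapK//; exact.
- move=> f g sf sg fg; rewrite !coord_vecE//; apply: near_eq_derive.
  move: fg; rewrite -nbhs_nearE nbhsE => -[W [oW Wm] fg].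
  have : nbhs (cmap c m) (cimg c W).
    by apply: open_nbhs_nbhs; split; [exact: open_cimg|exact: cimg_cmap].
  by apply: filterS => _ [q [dq Wq] <-] /=; rewrite cmapK//; exact: fg.
- by move=> f nf; rewrite /coord_vec asboolF.
Qed.

Lemma coord_vec_coord c a b m : smooth_chart c -> cdom c m ->
  coord_vec c a m (fun p => cmap c p 0 b) = (a == b)%:R.
Proof.
move=> sc dm; rewrite coord_vecE; last exact: smooth_near_coord.
rewrite (near_eq_derive (g := fun x : E => x 0 b)).
  by rewrite derive_coord mxE eqxx/= eq_sym.
have : nbhs (cmap c m) (cimg c setT).
  by apply: open_nbhs_nbhs; split; [exact/open_cimg/openT|exact: cimg_cmap].
by apply: filterS => _ [q [dq _] <-] /=; rewrite cmapK.
Qed.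

Lemma tangent_decomp c m v : smooth_chart c -> cdom c m -> tangent m v ->
  v = \sum_a v (fun p => cmap c p 0 a) *: coord_vec c a m.
Proof.
move=> sc dm tv; apply: (tangent_eq sc dm tv).
  by apply: tangent_sumv => a _; apply: tangentZ; exact: coord_vec_tangent.
move=> b; rewrite tvec_sum (bigD1 b)//= tvecZ coord_vec_coord// eqxx mulr1.
rewrite big1 ?addr0// => a ab.
by rewrite tvecZ coord_vec_coord// (negbTE ab) mulr0.
Qed.

Lemma smooth_lieD_coord c a V f : smooth_chart c -> open V -> V `<=` cdom c ->
  smooth V f -> smooth V (lieD (coord_vec c a) f).
Proof.
move=> sc oV Vc sf.
have VE : cdom c `&` V = V by apply/seteqP; split=> [? []|p Vp]//; split=> //; exact: Vc.
have := smooth_comp_chart sc oV (Cinfty_derive a (smooth_Cinfty sc oV sf)).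
rewrite VE; apply: smooth_ext => // m Vm.
by rewrite /lieD coord_vecE//; exact: smooth_nearI sf.
Qed.

Lemma coord_vfield c a : smooth_chart c -> vfield (cdom c) (coord_vec c a).
Proof.
move=> sc; split; first by move=> m dm; exact: coord_vec_tangent.
by move=> V f oV Vc; exact: smooth_lieD_coord.
Qed.

Lemma vfield_sub U V X : V `<=` U -> vfield U X -> vfield (M := M) V X.
Proof.
move=> VU [X1 X2]; split; first by move=> m /VU; exact: X1.
by move=> W f oW WV; apply: X2 => //; exact: subset_trans VU.
Qed.

Lemma vfieldZ U (b : R) X : vfield (M := M) U X -> vfield U (fun m => b *: X m).
Proof.
move=> [X1 X2]; split=> [m /X1|V f oV VU sf]; first exact: tangentZ.
by apply: smooth_mul => //; [exact: smooth_cst|exact: X2].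
Qed.

Lemma vfield_sumv U (I : Type) (r : seq I) (P : pred I) (X : I -> M -> @tvec R n M) :
  (forall i, P i -> vfield U (X i)) ->
  vfield U (fun m => \sum_(i <- r | P i) X i m).
Proof.
move=> H; split=> [m Um|V f oV VU sf].
  by apply: tangent_sumv => i Pi; have [+ _] := H i Pi; exact.
apply: (@smooth_ext _ _ _ _ (fun m => \sum_(i <- r | P i) lieD (X i) f m)) => //.
  by move=> m _; rewrite /lieD tvec_sum.
by apply: smooth_sum => // i Pi; have [_] := H i Pi; exact.
Qed.

Lemma vfield_lieD U X f : open U -> vfield (M := M) U X -> smooth U f ->
  smooth U (lieD X f).
Proof. by move=> oU [_ H]; exact: H. Qed.

Lemma lieD_coord U X f c m : open U -> U m -> vfield (M := M) U X -> smooth U f ->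
  smooth_chart c -> cdom c m ->
  lieD X f m = \sum_a 'D_(delta_mx 0 a) (f \o cinv c) (cmap c m) *
     lieD X (fun p => cmap c p 0 a) m.
Proof.
move=> oU Um [tX _] sf sc dm.
by apply: (tangent_coord (tX m Um)) => //; exact: smooth_nearI sf.
Qed.

(* Local sections extend, away from a smaller neighborhood: multiply by a bump
   function. *)
Lemma extend_section D U V X m : singular_distribution (M := M) D ->
  open U -> open V -> V `<=` U -> V m -> D V X ->
  exists Y, D U Y /\ exists W, [/\ open W, W m, W `<=` V & forall p, W p -> Y p = X p].
Proof.
move=> sD oU oV VU Vm DX.
have [chi [schi [W [oW Wm W1]] [K [cK KV K0]]]] := manifold_bump oV Vm.
exists (fun p => chi p *: X p); split; last first.
  exists (W `&` V); split; [exact: openI|by []|by move=> p []|].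
  by move=> p [/W1 -> _]; rewrite scale1r.
apply: (sd_glue sD oU) => p Up; have [Kp|nKp] := pselect (K p).
  exists V; split=> //; first exact: KV.
  by apply: (sd_scale sD) => //; exact: smooth_sub schi.
exists (U `&` ~` K).
have oUK : open (U `&` ~` K) by apply: openI => //; exact: closed_openC.
split=> //.
apply: (sd_ext sD oUK (sd_zero sD oUK)) => q [_ nKq].
by rewrite K0// scale0r.
Qed.

End Tangent.

(** * Iterated Lie derivatives *)

Section LieOrder.
Context {R : realType} {n : nat} {M : smooth_manifold R n}.
Local Notation tv := (@tvec R n M).
Local Notation vf := (M -> tv).
Implicit Types (U V W : set M) (f g : M -> R) (m : M) (X Y : vf).
Implicit Types (L : seq (nat * vf)).

(** The head of the list is the outermost factor; the last entry acts first. *)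
Definition lieDs (Xs : seq vf) f : M -> R := foldr lieD f Xs.

Lemma lieDs_cat Xs Ys f : lieDs (Xs ++ Ys) f = lieDs Xs (lieDs Ys f).
Proof. by rewrite /lieDs foldr_cat. Qed.

Lemma lieDs_rcons Xs X f : lieDs (rcons Xs X) f = lieDs Xs (lieD X f).
Proof. by rewrite /lieDs foldr_rcons. Qed.

Fixpoint all_vfield U (Xs : seq vf) : Prop :=
  if Xs is X :: Xs' then vfield U X /\ all_vfield U Xs' else True.

Lemma lieDs_smooth U Xs f : open U -> all_vfield U Xs -> smooth U f ->
  smooth U (lieDs Xs f).
Proof.
move=> oU; elim: Xs => [//|X Xs IH] [vX vXs] sf /=.
by apply: vfield_lieD => //; exact: IH.
Qed.

Section LieD.
Variables (U : set M) (X : vf).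
Hypotheses (oU : open U) (vX : vfield U X).

Lemma lieD_ext f g m : U m -> smooth U f -> (forall p, U p -> f p = g p) ->
  lieD X f m = lieD X g m.
Proof.
move=> Um sf fg; apply: (tangent_near (vX.1 m Um)); first exact: smooth_nearI sf.
by rewrite -nbhs_nearE nbhsE; exists U.
Qed.

Lemma lieD_add f g m : U m -> smooth U f -> smooth U g ->
  lieD X (fun p => f p + g p) m = lieD X f m + lieD X g m.
Proof.
by move=> Um sf sg; apply: (tangent_add (vX.1 m Um)); exact: smooth_nearI oU Um _.
Qed.

Lemma lieD_sub f g m : U m -> smooth U f -> smooth U g ->
  lieD X (fun p => f p - g p) m = lieD X f m - lieD X g m.
Proof.
by move=> Um sf sg; apply: (tangent_sub_fun (vX.1 m Um)); exact: smooth_nearI oU Um _.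
Qed.

Lemma lieD_mul f g m : U m -> smooth U f -> smooth U g ->
  lieD X (fun p => f p * g p) m = f m * lieD X g m + g m * lieD X f m.
Proof.
by move=> Um sf sg; apply: (tangent_mul (vX.1 m Um)); exact: smooth_nearI oU Um _.
Qed.

Lemma lieD_cst (a : R) m : U m -> lieD X (fun=> a) m = 0.
Proof. by move=> Um; exact: (tangent_cst (vX.1 m Um)). Qed.

Lemma lieD_sum (I : Type) (r : seq I) (P : pred I) (F : I -> M -> R) m : U m ->
  (forall i, P i -> smooth U (F i)) ->
  lieD X (fun p => \sum_(i <- r | P i) F i p) m = \sum_(i <- r | P i) lieD X (F i) m.
Proof.
move=> Um HF; apply: (tangent_sum (vX.1 m Um)) => i Pi.
by apply: smooth_nearI oU Um _; exact: HF.
Qed.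

End LieD.

Lemma lieDs_ext U Xs f g m : open U -> all_vfield U Xs -> U m -> smooth U f ->
  (forall p, U p -> f p = g p) -> lieDs Xs f m = lieDs Xs g m.
Proof.
move=> oU vXs Um sf fg; move: vXs m Um; elim: Xs => [_ m Um|X Xs IH [vX vXs] m Um] /=.
  exact: fg.
apply: (lieD_ext oU vX Um); first exact: lieDs_smooth.
by move=> p Up; exact: IH.
Qed.

Lemma lieDs_add U Xs f g m : open U -> all_vfield U Xs -> U m ->
  smooth U f -> smooth U g ->
  lieDs Xs (fun p => f p + g p) m = lieDs Xs f m + lieDs Xs g m.
Proof.
move=> oU vXs Um sf sg; move: vXs m Um; elim: Xs => [//|X Xs IH [vX vXs] m Um] /=.
rewrite -(lieD_add oU vX Um); try exact: lieDs_smooth.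
apply: (lieD_ext oU vX Um); last by move=> p Up; exact: IH.
by apply: lieDs_smooth => //; exact: smooth_add.
Qed.

Lemma lieDs_sum U Xs (I : Type) (r : seq I) (P : pred I) (F : I -> M -> R) m :
  open U -> all_vfield U Xs -> U m -> (forall i, P i -> smooth U (F i)) ->
  lieDs Xs (fun p => \sum_(i <- r | P i) F i p) m = \sum_(i <- r | P i) lieDs Xs (F i) m.
Proof.
move=> oU vXs Um HF; move: vXs m Um; elim: Xs => [//|X Xs IH [vX vXs] m Um] /=.
rewrite -(lieD_sum oU vX _ Um) => [|i Pi].
  apply: (lieD_ext oU vX Um); last by move=> p Up; exact: IH.
  by apply: lieDs_smooth => //; exact: smooth_sum.
by apply: lieDs_smooth => //; exact: HF.
Qed.

Lemma lieDs_sub U Xs f g m : open U -> all_vfield U Xs -> U m ->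
  smooth U f -> smooth U g ->
  lieDs Xs (fun p => f p - g p) m = lieDs Xs f m - lieDs Xs g m.
Proof.
move=> oU vXs Um sf sg; move: vXs m Um; elim: Xs => [//|X Xs IH [vX vXs] m Um] /=.
rewrite -(lieD_sub oU vX Um); try exact: lieDs_smooth.
apply: (lieD_ext oU vX Um); last by move=> p Up; exact: IH.
by apply: lieDs_smooth => //; exact: smooth_subf.
Qed.

(** * Orders of vanishing along [N] *)

Section Order.
Variables (H : nat -> set M -> set vf) (N : set M).
Hypothesis hv : forall j U X, open U -> H j U X -> vfield U X.

Fixpoint sections U L : Prop :=
  if L is p :: L' then [/\ (0 < p.1)%N, H p.1 U p.2 & sections U L'] else True.

Definition weight L : nat := sumn (map fst L).

Lemma sections_cat U L L' : sections U (L ++ L') <-> sections U L /\ sections U L'.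
Proof.
elim: L => [|p L IH] /=; first by split=> [?|[]].
by split=> [[? ? /IH[]]|[[? ? ?] ?]]; split=> //; apply/IH.
Qed.

Lemma weight_cat L L' : weight (L ++ L') = (weight L + weight L')%N.
Proof. by rewrite /weight map_cat sumn_cat. Qed.

Lemma weight_cons p L : weight (p :: L) = (p.1 + weight L)%N. Proof. by []. Qed.

Lemma sections_vfield U L : open U -> sections U L -> all_vfield U (map snd L).
Proof.
move=> oU; elim: L => [//|p L IH] [_ Hp /IH vL] /=; split=> //.
exact: hv Hp.
Qed.

(* [lie_ideal], with its recursion unfolded. *)
Definition lie_order i U f := smooth U f /\ forall L, sections U L ->
  (weight L < i)%N -> forall m, U m -> N m -> lieDs (map snd L) f m = 0.

Lemma lie_order_vanish i U f m : lie_order i U f -> (0 < i)%N -> U m -> N m -> f m = 0.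
Proof. by move=> [_ Hf] i0; exact: (Hf [::]). Qed.

Lemma lie_order0 U f : lie_order 0 U f <-> smooth U f.
Proof. by split=> [[]|sf]. Qed.

Lemma lie_order1 U f : (forall m, U m -> N m -> f m = 0) -> smooth U f ->
  lie_order 1 U f.
Proof.
move=> f0 sf; split=> // -[|[j X] L] /=; first by move=> _ _; exact: f0.
by move=> [/= j0 _ _]; rewrite /weight/= ltnS leqn0 addn_eq0 -leqn0 leqNgt j0.
Qed.

Lemma lie_order_le i j U f : (j <= i)%N -> lie_order i U f -> lie_order j U f.
Proof.
move=> ji [sf Hf]; split=> // L sL wL; apply: Hf => //; exact: leq_trans wL ji.
Qed.

Lemma lie_order_lieD i j U f X : open U -> (0 < j)%N -> lie_order i U f -> H j U X ->
  lie_order (i - j) U (lieD X f).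
Proof.
move=> oU j0 [sf Hf] HX; split; first by apply: vfield_lieD => //; exact: hv HX.
move=> L sL wL m Um Nm; rewrite -lieDs_rcons -[X](_ : (j, X).2 = X)// -map_rcons.
apply: Hf => //; first by rewrite -cats1; apply/sections_cat; split.
rewrite -cats1 weight_cat; set wL' := weight L in wL *.
by rewrite /weight/= addn0; lia.
Qed.

Lemma lie_order_intro i U f : open U -> smooth U f ->
  ((0 < i)%N -> forall m, U m -> N m -> f m = 0) ->
  (forall j X, (0 < j < i)%N -> H j U X -> lie_order (i - j) U (lieD X f)) ->
  lie_order i U f.
Proof.
move=> oU sf f0 HX; split=> // L; case/lastP: L => [_ i0|L [j X]].
  exact: f0.
rewrite -cats1 => /sections_cat[sL [/= j0 HjX _]]; rewrite weight_cat.
set wL' := weight L; rewrite /weight/= addn0 => wL m Um Nm; rewrite map_cat lieDs_cat/=.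
have ji : (0 < j < i)%N by rewrite j0 (leq_ltn_trans _ wL)// leq_addl.
have [_] := HX j X ji HjX; apply => //; rewrite -/wL'; lia.
Qed.

Lemma lie_ideal_order i U f : open U -> lie_ideal H N i U f <-> lie_order i U f.
Proof.
move=> oU; split.
  move=> C; move: oU; elim: C => {i U f} [U f sf|U f [sf f0]|i U f i1 [sf f0] _ IH] oU.
  - exact/lie_order0.
  - by apply: lie_order1 => // m; exact: f0.
  - by apply: lie_order_intro => // j X ji HX; exact: IH.
elim/ltn_ind: i f => -[|[|i]] IH f Cf.
- by apply: lie_ideal0; case: Cf.
- apply: lie_ideal1; split; first by case: Cf.
  by move=> m Um Nm; exact: lie_order_vanish Cf _ Um Nm.
- apply: lie_idealS => //.
    by split; [case: Cf|move=> m Um Nm; exact: lie_order_vanish Cf _ Um Nm].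
  move=> j X /andP[j0 ji] HX; apply: IH; first by rewrite ltn_subrL j0.
  exact: lie_order_lieD.
Qed.

Lemma lie_order_ext i U f g : open U -> (forall m, U m -> f m = g m) ->
  lie_order i U f -> lie_order i U g.
Proof.
move=> oU fg [sf Hf]; split; first exact: smooth_ext sf.
move=> L sL wL m Um Nm; rewrite -(lieDs_ext oU _ Um sf fg); first exact: Hf.
exact: sections_vfield.
Qed.

Lemma lie_order_off i U f : open U -> (forall m, U m -> ~ N m) -> smooth U f ->
  lie_order i U f.
Proof. by move=> oU UN sf; split=> // L _ _ m /UN. Qed.

Lemma lie_order_add i U f g : open U -> lie_order i U f -> lie_order i U g ->
  lie_order i U (fun m => f m + g m).
Proof.
move=> oU [sf Hf] [sg Hg]; split; first exact: smooth_add.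
move=> L sL wL m Um Nm; rewrite (lieDs_add oU _ Um)//; last exact: sections_vfield.
by rewrite Hf// Hg// addr0.
Qed.

Lemma lie_order_zero i U : open U -> lie_order i U (fun=> 0).
Proof.
move=> oU; elim/ltn_ind: i => i IH.
apply: lie_order_intro => //; first exact: smooth_cst.
move=> j X /andP[j0 ji] HX.
apply: (@lie_order_ext _ _ (fun=> 0)) => //.
  by move=> m Um; rewrite (lieD_cst (hv oU HX) _ Um).
by apply: IH; rewrite ltn_subrL j0 (leq_ltn_trans _ ji).
Qed.

Lemma lie_order_sum i U (I : Type) (r : seq I) (P : pred I) (F : I -> M -> R) :
  open U -> (forall k, P k -> lie_order i U (F k)) ->
  lie_order i U (fun m => \sum_(k <- r | P k) F k m).
Proof.
move=> oU HF; elim: r => [|k r IH].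
  by apply: lie_order_ext (lie_order_zero i oU) => // m _; rewrite big_nil.
case Pk: (P k).
  by apply: lie_order_ext (lie_order_add oU (HF k Pk) IH) => // m _; rewrite big_cons Pk.
by apply: lie_order_ext IH => // m _; rewrite big_cons Pk.
Qed.

(** Induction on [i + j] through the Leibniz rule: a section of weight [l] lowers the order of one
    factor by [l]. *)
Lemma lie_order_mul i j U f g : open U -> lie_order i U f -> lie_order j U g ->
  lie_order (i + j) U (fun m => f m * g m).
Proof.
move=> oU; move: {2}(i + j)%N (leqnn (i + j)) => k.
elim: k i j f g => [|k IH] i j f g ijk Cf Cg.
  move: ijk Cf Cg; rewrite leqn0 addn_eq0 => /andP[/eqP -> /eqP ->] [sf _] [sg _].
  by apply/lie_order0; exact: smooth_mul.
have [sf _] := Cf; have [sg _] := Cg.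
apply: lie_order_intro => //; first exact: smooth_mul.
  move=> ij0 m Um Nm; have [i0|i0] := posnP i.
    rewrite (lie_order_vanish Cg _ Um Nm) ?mulr0//.
    by move: ij0; rewrite i0.
  by rewrite (lie_order_vanish Cf i0 Um Nm) mul0r.
move=> l X /andP[l0 lij] HX.
have vX := hv oU HX.
(* Subtraction is truncated: if [l > j], the order of [f] is first lowered so that the two orders
   add up to exactly [i + j - l]. *)
have C1 := IH _ _ _ _ _ (lie_order_le (_ : i + j - l - (j - l) <= i)%N Cf)
  (lie_order_lieD oU l0 Cg HX).
have C2 := IH _ _ _ _ _ (lie_order_le (_ : i + j - l - (i - l) <= j)%N Cg)
  (lie_order_lieD oU l0 Cf HX).
have E1 : (i + j - l - (j - l) + (j - l) = i + j - l)%N by lia.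
have E2 : (i + j - l - (i - l) + (i - l) = i + j - l)%N by lia.
rewrite E1 in C1; rewrite E2 in C2.
apply: (@lie_order_ext _ _ (fun m => f m * lieD X g m + g m * lieD X f m)) => //.
  by move=> m Um; rewrite (lieD_mul oU vX Um).
by apply: lie_order_add => //; [apply: C1|apply: C2]; lia.
Qed.

Lemma lie_order_mull i U f g : open U -> smooth U f -> lie_order i U g ->
  lie_order i U (fun m => f m * g m).
Proof.
by move=> oU sf Cg; rewrite -[i]add0n; apply: lie_order_mul => //; exact/lie_order0.
Qed.

Lemma lie_order_exp k i U f : open U -> lie_order i U f ->
  lie_order (k * i) U (fun m => f m ^+ k).
Proof.
move=> oU Cf; elim: k => [|k IH].
  by rewrite mul0n; apply/lie_order0; exact: smooth_cst.
by rewrite mulSn; apply: lie_order_ext (lie_order_mul oU Cf IH) => // m _; rewrite exprS.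
Qed.

Lemma lie_order_prod U (I : Type) (r : seq I) (F : I -> M -> R) (d : I -> nat) :
  open U -> (forall k, lie_order (d k) U (F k)) ->
  lie_order (\sum_(k <- r) d k) U (fun m => \prod_(k <- r) F k m).
Proof.
move=> oU HF; elim: r => [|k r IH].
  rewrite big_nil; apply/lie_order0; apply: smooth_ext (smooth_cst U 1) => // m _.
  by rewrite big_nil.
rewrite big_cons; apply: lie_order_ext (lie_order_mul oU (HF k) IH) => // m _.
by rewrite big_cons.
Qed.

Section Local.
Hypothesis hD : forall j, singular_distribution (H j).

Lemma lie_order_local i U f : open U ->
  (forall m, U m -> exists V, [/\ open V, V m, V `<=` U & lie_order i V f]) ->
  lie_order i U f.
Proof.
move=> oU loc; split.
  by apply: smooth_local => m /loc[V [_ Vm _ [sf _]]]; exists V.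
move=> L sL wL m Um Nm; have [V [oV Vm VU [_ HV]]] := loc m Um.
apply: HV => //; elim: L sL {wL} => [//|p L IH] [p0 Hp /IH sL] /=; split=> //.
exact: (sd_res (hD p.1) oU oV VU Hp).
Qed.

Lemma extend_sections U V L m : open U -> open V -> V `<=` U -> V m ->
  sections V L -> exists L', [/\ sections U L', weight L' = weight L &
    exists W, [/\ open W, W m, W `<=` V & forall W0 f p, open W0 -> W0 `<=` W ->
      W0 p -> smooth W0 f ->
      lieDs (map snd L') f p = lieDs (map snd L) f p]].
Proof.
move=> oU oV VU Vm; elim: L => [_|[j X] L IH].
  by exists [::]; split=> //; exists V; split.
move=> [/= j0 HX sL]; have [L' [sL' wL' [W [oW Wm WV WL]]]] := IH sL.
have [Y [HY [W' [oW' Wm' W'V W'Y]]]] := extend_section (hD j) oU oV VU Vm HX.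
exists ((j, Y) :: L'); split=> //; first by rewrite /weight/= -/(weight L') wL'.
exists (W `&` W'); split; [exact: openI|by []|by move=> p [/WV]|].
move=> W0 f p oW0 W0W W0p sf /=.
have vX : vfield W0 X.
  by apply: vfield_sub (hv oV HX) => q /W0W[/WV].
have vL' : all_vfield W0 (map snd L').
  have := sections_vfield oU sL'; elim: (map snd L') => [//|Z Zs IHZ] [vZ /IHZ vZs].
  by split=> //; apply: vfield_sub vZ => q /W0W[/WV/VU].
have -> : lieD Y (lieDs (map snd L') f) p = lieD X (lieDs (map snd L') f) p.
  by rewrite /lieD W'Y//; have [] := W0W p W0p.
apply: (lieD_ext oW0 vX) => //; first exact: lieDs_smooth.
by move=> q W0q; apply: (WL W0) => // x /W0W[].
Qed.

(** Not immediate, since there may be more sections, hence more tests, over [V] than over [U]. *)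
Lemma lie_order_restrict i U V f : open U -> open V -> V `<=` U ->
  lie_order i U f -> lie_order i V f.
Proof.
move=> oU oV VU [sf Hf]; split; first exact: smooth_sub sf.
move=> L sL wL m Vm Nm.
have [L' [sL' wL' [W [oW Wm WV WL]]]] := extend_sections oU oV VU Vm sL.
rewrite -(WL W)//; last by apply: smooth_sub sf => p /WV/VU.
by apply: Hf => //; [rewrite wL'|exact: VU].
Qed.

End Local.

(* A frame of the filtration along [N]; compositions of vector fields may be
   reordered up to shorter compositions of the same weight, and the outermost
   factor only matters modulo [TN]. *)
Section Frame.
Hypothesis hbr : forall i j U X Y, open U -> H i U X -> H j U Y ->
  H (i + j)%N U (lie_bracket X Y).
Variables (U : set M) (w : 'I_n -> nat) (Z : 'I_n -> vf).
Hypotheses (oU : open U) (HZ : forall b, (0 < w b)%N -> H (w b) U (Z b)).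
Hypothesis spanZ : forall j m v, (0 < j)%N -> U m -> N m -> values_at (H j) m v ->
  exists c : 'I_n -> R,
    tangent_sub N m (v - \sum_(b | (0 < w b <= j)%N) c b *: Z b m).

Definition frame_seq (s : seq 'I_n) : seq (nat * vf) := [seq (w b, Z b) | b <- s].

Lemma frame_sections s : all (fun b => 0 < w b)%N s -> sections U (frame_seq s).
Proof. by elim: s => [//|b s IH] /= /andP[wb /IH]; split=> //; exact: HZ. Qed.

Lemma lie_bracketE X Y f m : vfield U X -> vfield U Y -> U m -> smooth U f ->
  lieD X (lieD Y f) m = lieD Y (lieD X f) m + lieD (lie_bracket X Y) f m.
Proof.
move=> vX vY Um sf; rewrite /lieD /lie_bracket asboolT.
  by rewrite addrC subrK.
exact: smooth_nearI sf.
Qed.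

Section Vanishing.
Variables (f : M -> R) (sf : smooth U f).
Let vanish L := forall m, U m -> N m -> lieDs (map snd L) f m = 0.

(** [X Y = Y X + [X, Y]], where the bracket counts as a single factor of the same total weight. *)
Lemma vanish_swap A p q B : sections U (A ++ [:: p, q & B]) ->
  vanish (A ++ ((p.1 + q.1)%N, lie_bracket p.2 q.2) :: B) ->
  vanish (A ++ [:: q, p & B]) -> vanish (A ++ [:: p, q & B]).
Proof.
move=> /sections_cat[sA [p0 Hp [q0 Hq sB]]] v1 v2 m Um Nm.
have vA := sections_vfield oU sA; have vB := sections_vfield oU sB.
have vp := hv oU Hp; have vq := hv oU Hq; have vpq := hv oU (hbr oU Hp Hq).
rewrite map_cat lieDs_cat /=.
set F := lieDs (map snd B) f; have sF : smooth U F by exact: lieDs_smooth.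
have s1 := vfield_lieD oU vp (vfield_lieD oU vq sF).
have s2 := vfield_lieD oU vq (vfield_lieD oU vp sF).
have s3 := vfield_lieD oU vpq sF.
rewrite (lieDs_ext oU vA Um s1 (g := fun x => lieD q.2 (lieD p.2 F) x +
   lieD (lie_bracket p.2 q.2) F x)); last first.
  by move=> x Ux; exact: lie_bracketE.
rewrite (lieDs_add oU vA Um s2 s3).
have := v1 m Um Nm; rewrite map_cat lieDs_cat/= -/F => ->.
by have := v2 m Um Nm; rewrite map_cat lieDs_cat/= -/F => ->; rewrite addr0.
Qed.

Variable k : nat.
Hypothesis IHweight : forall L, sections U L -> (weight L < k)%N -> vanish L.

Section Length.
Variable len : nat.
Hypothesis IHlen : forall L, sections U L -> weight L = k -> (size L < len)%N -> vanish L.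

Lemma vanish_move A p B C : sections U (A ++ p :: B ++ C) ->
  weight (A ++ p :: B ++ C) = k -> size (A ++ p :: B ++ C) = len ->
  vanish (A ++ B ++ p :: C) -> vanish (A ++ p :: B ++ C).
Proof.
elim: B A => [//|q B IH] A /= sL wL zL v.
have /sections_cat[sA [p0 Hp [q0 Hq sBC]]] := sL.
apply: vanish_swap => //.
  apply: IHlen.
  - by apply/sections_cat; split=> //=; split=> //; [rewrite addn_gt0 p0|exact: hbr].
  - by rewrite -wL !weight_cat /weight/=; lia.
  - by rewrite -zL !size_cat/=; lia.
rewrite -cat_rcons; apply: IH; rewrite cat_rcons//.
- by apply/sections_cat; split=> //=; split.
- by rewrite -wL !weight_cat /weight/=; lia.
- by rewrite -zL !size_cat/=; lia.
Qed.

(** The inner composition [F] has smaller weight, so it vanishes on [N], and its derivative along a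
    vector at [N] depends only on the class modulo [TN]. By [spanZ] this class is a combination of
    the [Z_b] with [w b <= p.1]; those with [w b < p.1] give compositions of weight below [k]. *)
Lemma vanish_head p B : sections U (p :: B) -> weight (p :: B) = k ->
  (forall b, (0 < w b)%N -> w b = p.1 -> vanish ((w b, Z b) :: B)) ->
  vanish (p :: B).
Proof.
move=> [p0 Hp sB] wk Hb m Um Nm /=.
set F := lieDs (map snd B) f.
have sF : smooth U F by apply: lieDs_smooth => //; exact: sections_vfield.
have nF : smooth_near m F by exact: smooth_nearI sF.
have F0 x : U x -> N x -> F x = 0.
  by apply: IHweight => //; rewrite -wk weight_cons -[ltnLHS]add0n ltn_add2r.
have [c [tt0 tc]] : exists c : 'I_n -> R,
    tangent_sub N m (p.2 m - \sum_(b | (0 < w b <= p.1)%N) c b *: Z b m).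
  by apply: spanZ => //; exists U, p.2.
have := tc F (fun=> 0) nF (smooth_near_cst _ _) _.
rewrite (tangent_cst tt0 0).
move=> /(_ _)/wrap[|].
  rewrite -nbhs_nearE nbhsE; exists U => // x Ux Nx; exact: F0.
have -> : (p.2 m - \sum_(b | (0 < w b <= p.1)%N) c b *: Z b m) F =
   lieD p.2 F m - \sum_(b | (0 < w b <= p.1)%N) c b * lieD (Z b) F m.
  rewrite -scaleN1r tvecD tvecZ tvec_sum mulN1r; congr (_ - _).
rewrite big1 ?subr0// => b /andP[wb wbp].
have -> : lieD (Z b) F m = 0; last by rewrite mulr0.
move: wbp; rewrite leq_eqVlt => /orP[/eqP wbp|wbp].
  by have := Hb b wb wbp m Um Nm.
have := @IHweight ((w b, Z b) :: B); apply => //.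
  by split=> //; exact: HZ.
by rewrite -wk /weight/= ltn_add2r.
Qed.

Lemma sorted_insert (b : 'I_n) s : pairwise (fun x y : 'I_n => x <= y)%N s ->
  exists s1 s2, s = s1 ++ s2 /\ pairwise (fun x y : 'I_n => x <= y)%N (s1 ++ b :: s2).
Proof.
elim: s => [|x s IH] /=; first by exists [::], [::].
move=> /andP[xs ps]; have [bx|xb] := leqP b x.
  exists [::], (x :: s); split=> //=; rewrite bx xs ps !andbT/=.
  by apply: sub_all xs => y; exact: leq_trans.
have [s1 [s2 [Es ps12]]] := IH ps; exists (x :: s1), s2; split; first by rewrite Es.
rewrite /= ps12 andbT; move: xs; rewrite Es !all_cat/= => /andP[-> ->].
by rewrite (ltnW xb).
Qed.

Hypothesis sorted_vanish : forall s, pairwise (fun x y : 'I_n => x <= y)%N s ->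
  all (fun b => 0 < w b)%N s -> weight (frame_seq s) = k -> vanish (frame_seq s).

(** Induction on the unsorted prefix: the outermost factor becomes some [Z_b] by [vanish_head] and
    is then moved through the rest of the prefix to its sorted place in [s], which leaves a shorter
    prefix. *)
Lemma vanish_mixed L s : sections U L -> pairwise (fun x y : 'I_n => x <= y)%N s ->
  all (fun b => 0 < w b)%N s -> weight (L ++ frame_seq s) = k ->
  size (L ++ frame_seq s) = len -> vanish (L ++ frame_seq s).
Proof.
elim: L s => [|p L IH] s /=; first by move=> _ ps ws wk _; exact: sorted_vanish.
move=> [p0 Hp sL] ps ws wk zk.
have sf' := frame_sections ws.
apply: vanish_head => //.
  by split=> //; apply/sections_cat.
move=> b wb wbp; have [s1 [s2 [Es ps12]]] := sorted_insert b ps.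
have -> : (w b, Z b) :: L ++ frame_seq s =
    [::] ++ (w b, Z b) :: (L ++ frame_seq s1) ++ frame_seq s2.
  by rewrite /frame_seq Es map_cat catA.
have Efs : frame_seq s = frame_seq s1 ++ frame_seq s2 by rewrite /frame_seq Es map_cat.
have Efs' : frame_seq (s1 ++ b :: s2) = frame_seq s1 ++ (w b, Z b) :: frame_seq s2.
  by rewrite /frame_seq map_cat.
have all12 : all (fun b => 0 < w b)%N (s1 ++ b :: s2).
  by move: ws; rewrite Es !all_cat/= wb.
apply: vanish_move => /=.
- split=> //; first exact: HZ.
  by rewrite -catA /frame_seq -map_cat -Es; apply/sections_cat.
- by rewrite -wk Efs -catA /weight /= wbp.
- by rewrite -zk /frame_seq Es map_cat -catA/=.
- rewrite -catA -[_ :: frame_seq s2]/(frame_seq (b :: s2)) /frame_seq -map_cat.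
  apply: IH => //.
    rewrite -wk Efs Efs' weight_cons !weight_cat weight_cons /= wbp.
    by rewrite [(weight (frame_seq s1) + _)%N]addnCA addnCA.
  by rewrite -zk Efs Efs' !size_cat/= !addnS.
Qed.

End Length.

Lemma vanish_weight : (forall s, pairwise (fun x y : 'I_n => x <= y)%N s ->
  all (fun b => 0 < w b)%N s -> weight (frame_seq s) = k -> vanish (frame_seq s)) ->
  forall L, sections U L -> weight L = k -> vanish L.
Proof.
move=> sv L; move: {2}(size L) (erefl (size L)) => len.
elim/ltn_ind: len L => len IH L zL sL wL.
rewrite -[L]cats0 -[[::]]/(frame_seq [::]).
apply: (vanish_mixed (len := len)) => //; rewrite ?cats0//.
by move=> L' sL' wL' zL'; exact: IH zL' _ _ _ _.
Qed.

End Vanishing.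

(** The outer induction on the weight absorbs the [Z_b] of smaller weight; the inner one on the
    length, in [vanish_weight], absorbs the brackets. *)
Lemma frame_test i f : smooth U f ->
  (forall s, pairwise (fun x y : 'I_n => x <= y)%N s -> all (fun b => 0 < w b)%N s ->
     (weight (frame_seq s) < i)%N ->
     forall m, U m -> N m -> lieDs (map snd (frame_seq s)) f m = 0) ->
  lie_order i U f.
Proof.
move=> sf Hs; split=> // L sL; move: {2}(weight L) (erefl (weight L)) => k.
elim/ltn_ind: k L sL => k IH L sL wL ki.
apply: (vanish_weight sf (k := k)) => //.
- move=> L' sL' wL'; apply: (IH _ wL') => //; rewrite (leq_ltn_trans _ ki)// wL ltnW//.
- by move=> s ps ws wk; apply: Hs => //; rewrite wk -wL.
Qed.

End Frame.
End Order.
End LieOrder.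

(** * Changes of charts *)

Section LinearAlgebra.
Context {R : realType} {V : lmodType R}.
Implicit Types (S : set V).

Lemma lin_span_mul k l (b : 'I_k -> V) (b' : 'I_l -> V) (A : 'M[R]_(l, k)) :
  (forall j, b' j = \sum_i A j i *: b i) -> forall u : 'rV[R]_l,
  \sum_j u 0 j *: b' j = \sum_i (u *m A) 0 i *: b i.
Proof.
move=> bA u; under eq_bigr do rewrite bA scaler_sumr.
rewrite exchange_big/=; apply: eq_bigr => i _; rewrite mxE scaler_suml.
by apply: eq_bigr => j _; rewrite scalerA.
Qed.

Lemma lin_span_matrix k l (b : 'I_k -> V) (b' : 'I_l -> V) :
  (forall j, lin_span b (b' j)) ->
  exists A : 'M[R]_(l, k), forall j, b' j = \sum_i A j i *: b i.
Proof.
move=> H; pose a j := sval (cid (H j)).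
have aE j : b' j = \sum_i a j i *: b i := svalP (cid (H j)).
by exists (\matrix_(j, i) a j i) => j; rewrite {1}aE; apply: eq_bigr => i _; rewrite mxE.
Qed.

(** The matrix of [b] in a basis of [S] is square with trivial kernel, hence invertible. *)
Lemma has_dim_span S k (b : 'I_k -> V) : has_dim S k -> lin_indep b ->
  (forall j, S (b j)) -> S `<=` lin_span b.
Proof.
move=> [b' [ib' SE]] ib Sb v; rewrite SE => -[a ->].
have [A bA] : exists A : 'M[R]_(k, k), forall j, b j = \sum_i A j i *: b' i.
  by apply: lin_span_matrix => j; rewrite -SE.
have uA : A \in unitmx.
  rewrite -row_free_unit -kermx_eq0; apply/eqP/row_matrixP => i; rewrite row0.
  set u := row i _; have uA0 : u *m A = 0 by rewrite -row_mul mulmx_ker row0.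
  apply/rowP => j; rewrite [RHS]mxE; apply: (ib (fun j => u 0 j)).
  rewrite (lin_span_mul bA) uA0 big1// => l _; by rewrite mxE scale0r.
pose u : 'rV[R]_k := (\row_j a j) *m invmx A; exists (fun j => u 0 j).
rewrite (lin_span_mul bA) /u mulmxKV//.
by apply: eq_bigr => j _; rewrite mxE.
Qed.

(** Otherwise a basis of [S] would have a [k] by [l] matrix over [b], with nonzero left kernel as
    [l < k]. *)
Lemma has_dim_escape S k l (b : 'I_l -> V) : has_dim S k -> (l < k)%N ->
  exists2 s, S s & ~ lin_span b s.
Proof.
move=> [b' [ib' SE]] lk; apply: contrapT => Hn.
have [A bA] : exists A : 'M[R]_(k, l), forall j, b' j = \sum_i A j i *: b i.
  apply: lin_span_matrix => j; apply: contrapT => nb; apply: Hn; exists (b' j) => //.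
  rewrite SE; exists (fun i => (i == j)%:R).
  by rewrite (bigD1 j)//= eqxx scale1r big1 ?addr0// => i /negbTE ->; rewrite scale0r.
have : kermx A != 0.
  rewrite kermx_eq0 -row_leq_rank -ltnNge; apply: leq_ltn_trans lk.
  exact: rank_leq_col.
case/rowV0Pn => u /sub_kermxP uA0 /negP; apply.
apply/eqP/rowP => j; rewrite [RHS]mxE; apply: (ib' (fun j => u 0 j)).
rewrite (lin_span_mul bA) uA0 big1// => i _; by rewrite mxE scale0r.
Qed.

Lemma has_dim_le S S' k k' : has_dim S k -> has_dim S' k' -> S `<=` S' -> (k <= k')%N.
Proof.
move=> hS [b [_ S'E]] SS; rewrite leqNgt; apply/negP => lt.
by have [s /SS] := has_dim_escape b hS lt; rewrite S'E.
Qed.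

Lemma has_dim_eq S k k' : has_dim S k -> has_dim S k' -> k = k'.
Proof.
move=> h h'; apply/eqP; rewrite eqn_leq.
by rewrite (has_dim_le h h' (@subset_refl _ _)) (has_dim_le h' h (@subset_refl _ _)).
Qed.

Lemma lin_indep_extend k (z : nat -> V) : lin_indep (fun j : 'I_k => z j) ->
  ~ lin_span (fun j : 'I_k => z j) (z k) -> lin_indep (fun j : 'I_k.+1 => z j).
Proof.
move=> iz nz a; rewrite big_ord_recr/= => E1.
have ak : a ord_max = 0.
  apply: contrapT => /eqP a0; apply: nz.
  exists (fun j => - (a ord_max)^-1 * a (widen_ord (leqnSn k) j)).
  move/eqP: E1; rewrite addrC addr_eq0 => /eqP E1.
  rewrite -[LHS]scale1r -(mulVf a0) -scalerA E1 scalerN -scaleNr scaler_sumr.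
  by apply: eq_bigr => j _; rewrite scalerA.
move: E1; rewrite ak scale0r addr0 => /iz H j.
have [jk|jk] := ltnP j k.
  by have := H (Ordinal jk); congr (a _ = 0); apply: val_inj.
rewrite -ak; congr (a _); apply: val_inj => /=; apply/eqP.
by rewrite eqn_leq jk andbT -ltnS.
Qed.

End LinearAlgebra.

(** * Charts obtained by explicit coordinate changes *)

Section NewCharts.
Context {R : realType} {n : nat} {M : smooth_manifold R n}.
Local Notation E := ('rV[R]_n).

Lemma Cinfty_row_continuous (V : set E) (phi : E -> E) x :
  (forall b, Cinfty V (fun y => phi y 0 b)) -> V x -> {for x, continuous phi}.
Proof.
move=> cphi Vx; apply: (@cvg_rowP R n _ _ (@nbhs_filter _ x)) => b.
exact: Cinfty_cont (cphi b) Vx.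
Qed.

Lemma open_preimage (V W : set E) (phi : E -> E) : open V -> open W ->
  (forall b, Cinfty V (fun y => phi y 0 b)) -> open (V `&` phi @^-1` W).
Proof.
move=> oV oW cphi; rewrite openE => x [Vx Wx].
have n1 : nbhs x V by exact: open_nbhs_nbhs.
have n2 : nbhs x (phi @^-1` W).
  by apply: (Cinfty_row_continuous cphi Vx); exact: open_nbhs_nbhs.
by apply: filterS2 n1 n2 => y; split.
Qed.

Lemma smooth_chart_continuous (U : set M) (f : M -> R) m : open U -> U m -> smooth U f ->
  {for m, continuous f}.
Proof.
move=> oU Um sf; have [c Ac dm] := atlas_cover m.
have c1 : {for cmap c m, continuous (f \o cinv c)}.
  by apply: (Cinfty_cont (sf c Ac)); exact: cimg_cmap.
have c2 : {for m, continuous (f \o cinv c \o cmap c)}.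
  exact: (continuous_comp (cmap_cont dm) c1).
apply: near_eq_continuous c2.
have : nbhs m (cdom c) by apply: open_nbhs_nbhs; split=> //; exact: cdom_open.
by apply: filterS => p dp /=; rewrite cmapK.
Qed.

Lemma smooth_neq0_near (U : set M) (f : M -> R) m : open U -> U m -> smooth U f ->
  f m != 0 -> exists W, [/\ open W, W m, W `<=` U & forall p, W p -> f p != 0].
Proof.
move=> oU Um sf fm.
have n1 : nbhs m (f @^-1` (fun y => y != 0)).
  apply: (smooth_chart_continuous oU Um sf).
  exact: (open_nbhs_nbhs (conj (@open_neq _ 0) fm)).
have n2 : nbhs m U by exact: open_nbhs_nbhs.
have : nbhs m (U `&` f @^-1` (fun y => y != 0)) by exact: filterI.
by rewrite nbhsE => -[W [oW Wm] WU]; exists W; split=> // p /WU[].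
Qed.

Section Comp.
Variables (c : chart R n M) (O O' : set E) (psi theta : E -> E).
Hypotheses (sc : smooth_chart c) (oO : open O) (oO' : open O')
  (Oc : O `<=` cmap c @` cdom c)
  (cpsi : forall b, Cinfty O (fun x => psi x 0 b))
  (ctheta : forall b, Cinfty O' (fun x => theta x 0 b))
  (psiO : forall x, O x -> O' (psi x)) (thetaO : forall y, O' y -> O (theta y))
  (psiK : forall x, O x -> theta (psi x) = x)
  (thetaK : forall y, O' y -> psi (theta y) = y).

Let dom : set M := cdom c `&` cmap c @^-1` O.

Let img : (psi \o cmap c) @` dom = O'.
Proof.
apply/seteqP; split=> [_ [m [dm Om] <-]|y O'y]; first exact: psiO.
have [m dm Em] := Oc (thetaO O'y).
exists m; last by rewrite /= Em thetaK.
by split=> //; rewrite /preimage/= Em; exact: thetaO.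
Qed.

Lemma comp_chart : exists c' : chart R n M, [/\ smooth_chart c',
  cdom c' = cdom c `&` cmap c @^-1` O, forall m, cmap c' m = psi (cmap c m) &
  cmap c' @` cdom c' = O'].
Proof.
have o1 : open dom by exact: open_cpreim.
have o2 : open ((psi \o cmap c) @` dom) by rewrite img.
have K m : dom m -> (cinv c \o theta) ((psi \o cmap c) m) = m.
  by move=> [dm Om] /=; rewrite psiK// cmapK.
have C1 m : dom m -> {for m, continuous (psi \o cmap c)}.
  move=> [dm Om]; apply: (continuous_comp (cmap_cont dm)).
  exact: Cinfty_row_continuous cpsi Om.
have C2 y : ((psi \o cmap c) @` dom) y -> {for y, continuous (cinv c \o theta)}.
  rewrite img => O'y; apply: continuous_comp.
    exact: Cinfty_row_continuous ctheta O'y.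
  by apply: cinv_cont; apply: Oc; exact: thetaO.
pose c' := Chart o1 o2 K C1 C2.
exists c'; split=> //.
apply: smooth_chartP.
  move=> a; have := @smooth_comp_chart _ _ M c (cmap c @^-1` O `&` cdom c)
    (fun x => psi x 0 a) sc _ _.
  have -> : cdom c `&` (cmap c @^-1` O `&` cdom c) = cdom c'.
    by apply/seteqP; split=> m /=; rewrite /dom; [move=> [? [? ?]]|move=> [? ?]].
  apply; first by rewrite setIC; exact: open_cpreim.
  by apply: Cinfty_sub (cpsi a) => _ [m [_ [Om _]] <-].
move=> U f oU sf.
have cf := smooth_Cinfty sc oU sf.
apply: (@Cinfty_comp _ _ _ _ (cimg c U `&` O) theta (f \o cinv c)).
- exact: open_cimg.
- by apply: openI => //; exact: open_cimg.
- move=> _ [m [[dm Om] Um] <-] /=; rewrite psiK//; split=> //.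
  exact: cimg_cmap.
- by move=> b; apply: Cinfty_sub (ctheta b) => _ [m [[dm Om] Um] <-]; exact: psiO.
- by apply: Cinfty_sub cf => ? [].
Qed.

End Comp.

Lemma restrict_chart (c : chart R n M) (U : set M) : smooth_chart c -> open U ->
  U `<=` cdom c -> exists c' : chart R n M, [/\ smooth_chart c', cdom c' = U,
    forall m, cmap c' m = cmap c m & cmap c' @` cdom c' = cimg c U].
Proof.
move=> sc oU Uc.
have oI := open_cimg (c := c) oU.
have [|c' [sc' d1 m1 i1]] := comp_chart (O := cimg c U) (O' := cimg c U)
  (psi := id) (theta := id) sc oI oI _ (fun b => Cinfty_coord _ b)
  (fun b => Cinfty_coord _ b)
  (fun _ => id) (fun _ => id) (fun _ _ => erefl) (fun _ _ => erefl).
  by move=> _ [m [dm _] <-]; exists m.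
exists c'; split=> //; rewrite d1; apply/seteqP; split=> [m [dm]|m Um].
  by rewrite /preimage/= => -[p [dp Up] pm]; rewrite -(cmapK dm) -pm cmapK.
by split; [exact: Uc|apply: cimg_cmap => //; exact: Uc].
Qed.

End NewCharts.

(** * The tangent spaces of [N] in coordinates *)

Section TangentSub.
Context {R : realType} {n : nat} {M : smooth_manifold R n}.
Local Notation E := ('rV[R]_n).
Variables (N : set M) (c : chart R n M) (P : pred 'I_n).
Hypothesis sc : smooth_chart c.
Hypothesis NP : forall p, cdom c p -> N p <-> forall a, P a -> cmap c p 0 a = 0.

(** For the converse, [v (f - g)] is expanded by [tangent_coord]: the factors [v x_a] vanish for [a]
    in [P], and the remaining partial derivatives vanish because [f - g] is [0] along the coordinate
    lines that stay in [N]. *)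
Lemma tangent_subP m v : cdom c m -> N m ->
  tangent_sub N m v <->
  tangent m v /\ forall a, P a -> v (fun p => cmap c p 0 a) = 0.
Proof.
move=> dm Nm; have nd : nbhs m (cdom c).
  by apply: open_nbhs_nbhs; split=> //; exact: cdom_open.
split=> [[tv Hv]|[tv Hv]]; split=> //.
  move=> a Pa; rewrite -(tangent_cst tv 0); apply: Hv.
  - exact: smooth_near_coord.
  - exact: smooth_near_cst.
  - by apply: filterS nd => p dp Np; apply: (NP dp).1.
move=> f g sf sg fg.
have ssub : smooth_near m (fun p => f p - g p).
  have E1 : (fun p => f p - g p) = fun p => f p + (-1) * g p.
    by apply/funext => p; rewrite mulN1r.
  rewrite E1; apply: smooth_near_add => //.
  by apply: smooth_near_mul => //; exact: smooth_near_cst.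
apply/eqP; rewrite -subr_eq0 -(tangent_sub_fun tv sf sg); apply/eqP.
rewrite (tangent_coord tv sc dm ssub) big1// => a _.
have [Pa|nPa] := boolP (P a); first by rewrite Hv// mulr0.
suff -> : 'D_(delta_mx 0 a) ((fun p => f p - g p) \o cinv c) (cmap c m) = 0.
  by rewrite mul0r.
move: fg; rewrite -nbhs_nearE nbhsE => -[W [oW Wm] fg].
have : nbhs (cmap c m) (cimg c W).
  by apply: open_nbhs_nbhs; split; [exact: open_cimg|exact: cimg_cmap].
move=> /nbhs_cube[e e0 eW].
apply: lim_near_cst => //; near=> h.
have he : `|h| < e by near: h; exact: dnbhs0_lt.
have : cimg c W (h *: delta_mx 0 a + cmap c m).
  apply: eW => b; rewrite !mxE addrK eqxx/=; case: eqP => _; rewrite ?mulr1//.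
  by rewrite mulr0 normr0.
move=> [q [dq Wq] qE] /=; rewrite -qE (cmapK dq) (cmapK dm).
have Nq : N q.
  apply/(NP dq) => b Pb; rewrite qE !mxE eqxx/=.
  have /negbTE -> : b != a by apply: contraNneq nPa => <-.
  by rewrite mulr0 add0r; apply: (NP dm).1.
by rewrite (fg q Wq Nq) subrr (fg m Wm Nm) subrr subr0 scaler0.
Unshelve. all: by end_near. Qed.

Lemma tangent_sub_coord_vec m a : cdom c m -> N m -> ~~ P a ->
  tangent_sub N m (coord_vec c a m).
Proof.
move=> dm Nm nPa; apply/tangent_subP => //; split; first exact: coord_vec_tangent.
move=> b Pb; rewrite coord_vec_coord//.
by have /negbTE -> : a != b by apply: contraNneq nPa => ->.
Qed.

Lemma tangent_sub_decomp m v : cdom c m -> N m -> tangent_sub N m v ->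
  v = \sum_(a | ~~ P a) v (fun p => cmap c p 0 a) *: coord_vec c a m.
Proof.
move=> dm Nm /(tangent_subP _ dm Nm)[tv Hv]; rewrite {1}(tangent_decomp sc dm tv).
rewrite [RHS]big_mkcond; apply: eq_bigr => a _; case: ifPn => //.
by rewrite negbK => Pa; rewrite Hv// scale0r.
Qed.

End TangentSub.

Section TangentSubSpace.
Context {R : realType} {n : nat} {M : smooth_manifold R n}.
Variables (N : set M) (m : M).

Lemma tangent_sub0 : tangent_sub N m 0.
Proof. by split; [exact: tangent0|]. Qed.

Lemma tangent_subD u v : tangent_sub N m u -> tangent_sub N m v ->
  tangent_sub N m (u + v).
Proof.
move=> [tu Hu] [tv Hv]; split; first exact: tangentD.
by move=> f g sf sg fg; rewrite !tvecD (Hu f g)// (Hv f g).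
Qed.

Lemma tangent_subZ (a : R) u : tangent_sub N m u -> tangent_sub N m (a *: u).
Proof.
move=> [tu Hu]; split; first exact: tangentZ.
by move=> f g sf sg fg; rewrite !tvecZ (Hu f g).
Qed.

Lemma tangent_sub_sum (I : Type) (r : seq I) (P : pred I) (F : I -> @tvec R n M) :
  (forall i, P i -> tangent_sub N m (F i)) ->
  tangent_sub N m (\sum_(i <- r | P i) F i).
Proof.
by move=> HF; elim/big_ind: _ => //; [exact: tangent_sub0|exact: tangent_subD].
Qed.

End TangentSubSpace.

(** * Adapted charts *)

Section NatFamilies.
Context {R : realType} {V : lmodType R}.
Implicit Types (z : nat -> V).

(** Extension by [0], so that sums over ['I_k] can be compared with sums over larger index sets. *)
Definition nat_coef k (a : 'I_k -> R) (j : nat) : R :=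
  if insub j is Some i then a i else 0.

Lemma nat_coefE k (a : 'I_k -> R) (i : 'I_k) : nat_coef a i = a i.
Proof. by rewrite /nat_coef valK. Qed.

Lemma lin_indep_nat k z : lin_indep (fun j : 'I_k => z j) <->
  forall a : nat -> R, \sum_(j < k) a j *: z j = 0 -> forall j, (j < k)%N -> a j = 0.
Proof.
split=> [iz a E1 j jk|iz a E1 j]; first exact: (iz (fun j => a j) E1 (Ordinal jk)).
rewrite -(nat_coefE a); apply: iz => //.
by rewrite -[RHS]E1; apply: eq_bigr => i _; rewrite nat_coefE.
Qed.

Lemma lin_indep_prefix k l z : (k <= l)%N -> lin_indep (fun j : 'I_l => z j) ->
  lin_indep (fun j : 'I_k => z j).
Proof.
move=> kl /lin_indep_nat iz; apply/lin_indep_nat => a E1 j jk.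
have := iz (fun j => if (j < k)%N then a j else 0) _ j (leq_trans jk kl).
rewrite jk; apply; rewrite -[RHS]E1 (big_ord_widen l (fun j => a j *: z j))//.
rewrite [RHS]big_mkcond; apply: eq_bigr => i _.
by case: ifP => //; rewrite scale0r.
Qed.

Lemma lin_span_nat k l z v : (k <= l)%N -> lin_span (fun j : 'I_k => z j) v ->
  exists a : 'I_l -> R, v = \sum_(j < l | (j < k)%N) a j *: z j.
Proof.
move=> kl [a ->]; exists (fun j => nat_coef a j).
rewrite -(big_ord_widen l (fun j => nat_coef a j *: z j))//.
by apply: eq_bigr => i _; rewrite nat_coefE.
Qed.

Lemma lin_spanD k (b : 'I_k -> V) u v : lin_span b u -> lin_span b v ->
  lin_span b (u + v).
Proof.
move=> [a ->] [a' ->]; exists (fun j => a j + a' j).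
by rewrite -big_split; apply: eq_bigr => j _; rewrite scalerDl.
Qed.

End NatFamilies.

Section SmoothMatrices.
Context {R : realType} {n : nat}.
Local Notation E := ('rV[R]_n).

Lemma Cinfty_det (V : set E) k (A : E -> 'M[R]_k) : open V ->
  (forall i j, Cinfty V (fun x => A x i j)) -> Cinfty V (fun x => \det (A x)).
Proof.
move=> oV cA; apply: Cinfty_sum => // s _; apply: Cinfty_mul => //.
  exact: Cinfty_cst.
by apply: Cinfty_prod.
Qed.

Lemma Cinfty_invmx (V : set E) k (A : E -> 'M[R]_k) : open V ->
  (forall x, V x -> A x \in unitmx) ->
  (forall i j, Cinfty V (fun x => A x i j)) ->
  forall i j, Cinfty V (fun x => invmx (A x) i j).
Proof.
move=> oV uA cA i j.
apply: eq_Cinfty (_ : Cinfty V (fun x => (\det (A x))^-1 * cofactor (A x) j i)) => //.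
  by move=> x Vx; rewrite /invmx uA// !mxE.
apply: Cinfty_mul => //.
  apply: Cinfty_inv => //; last exact: Cinfty_det.
  by move=> x /uA; rewrite unitmxE unitfE.
apply: Cinfty_mul => //; first exact: Cinfty_cst.
apply: Cinfty_det => // i' j'.
by apply: eq_Cinfty (cA (lift j i') (lift i j')) => // x _; rewrite !mxE.
Qed.

End SmoothMatrices.

(** * Values of the filtration at a point *)

Section Values.
Context {R : realType} {n : nat} {M : smooth_manifold R n}.
Local Notation vf := (M -> @tvec R n M).
Variables (r : nat) (H : nat -> set M -> set vf).
Hypothesis hH : singular_lie_filtration r H.

Lemma slf_vfield j U X : open U -> H j U X -> vfield U X.
Proof. by move=> oU; exact: (sd_vfield (slf_distribution hH j) oU). Qed.

Lemma values_at_tangent i m v : values_at (H i) m v -> tangent m v.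
Proof. by move=> [U [X [oU Um HX ->]]]; have [+ _] := slf_vfield oU HX; exact. Qed.

Lemma values_at_le i j m v : (i <= j)%N -> values_at (H i) m v -> values_at (H j) m v.
Proof.
move=> /subnK <-; elim: (j - i)%N => [//|k IH] /IH [U [X [oU Um HX ->]]].
by exists U, X; split=> //; exact: (slf_decr hH oU HX).
Qed.

Lemma values_at_top i m v : (r <= i)%N -> tangent m v -> values_at (H i) m v.
Proof.
move=> ri tv; have [c Ac dm] := atlas_cover m.
have sc := smooth_chart_atlas Ac; have od := cdom_open c.
exists (cdom c), (fun p => \sum_a v (fun p => cmap c p 0 a) *: coord_vec c a p); split=> //.
  apply/(slf_top hH) => //; apply: vfield_sumv => a _; apply: vfieldZ.
  exact: coord_vfield.
exact: tangent_decomp.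
Qed.

Lemma values_at_section i m v : values_at (H i) m v ->
  exists Y, H i setT Y /\ Y m = v.
Proof.
move=> [U [X [oU Um HX ->]]].
have [Y [HY [W [oW Wm WU WY]]]] :=
  extend_section (slf_distribution hH i) openT oU (@subsetT _ _) Um HX.
by exists Y; split=> //; exact: WY.
Qed.

End Values.

(** * Frames and coordinates adapted to a clean submanifold *)

Section Adapted.
Context {R : realType} {n r d : nat} {M : smooth_manifold R n}.
Local Notation E := ('rV[R]_n).
Local Notation vf := (M -> @tvec R n M).
Variables (H : nat -> set M -> set vf) (N : set M).
Hypotheses (hH : singular_lie_filtration r H) (hH0 : zero_distribution (H 0%N))
  (hNsub : embedded_submanifold d N) (hNclean : clean H N).

Definition clean_dim (i : nat) : nat := sval (cid (hNclean i)).

Let S i m := sum_space (tangent_sub N m) (values_at (H i) m).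

Lemma clean_dimP i m : N m -> has_dim (S i m) (clean_dim i).
Proof. exact: (svalP (cid (hNclean i))). Qed.

Lemma sum_space_tangent i m v : S i m v -> tangent m v.
Proof. move=> [a [b [[ta _] vb ->]]]; apply: tangentD; first by [].
exact: (values_at_tangent hH vb). Qed.

Lemma sum_space_le i j m : (i <= j)%N -> S i m `<=` S j m.
Proof.
move=> ij v [a [b [ta vb ->]]]; exists a, b; split; [by []| |by []].
exact: (values_at_le hH ij vb).
Qed.

Lemma values_at0 i m : values_at (H i) m 0.
Proof.
exists setT, (fun=> 0); split=> //; [exact: openT|].
by apply: (sd_zero (slf_distribution hH i)); exact: openT.
Qed.

Lemma sum_space_values i m v : values_at (H i) m v -> S i m v.
Proof. by move=> vv; exists 0, v; rewrite add0r; split=> //; exact: tangent_sub0. Qed.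

Lemma sum_space_tangent_sub i m v : tangent_sub N m v -> S i m v.
Proof. by move=> vv; exists v, 0; rewrite addr0; split=> //; exact: values_at0. Qed.

Let P : pred 'I_n := fun a => (d <= a)%N.

Section Point.
Variables (m : M) (c : chart R n M).
Hypotheses (sc : smooth_chart c) (dm : cdom c m) (Nm : N m)
  (NP : forall p, cdom c p -> N p <-> forall a : 'I_n, P a -> cmap c p 0 a = 0).

Lemma coord_vec_indep (a : 'I_n -> R) (Q : pred 'I_n) :
  \sum_(j | Q j) a j *: coord_vec c j m = 0 -> forall j, Q j -> a j = 0.
Proof.
move=> E1 j Qj; have := congr1 (fun v : @tvec R n M => v (fun p => cmap c p 0 j)) E1.
rewrite tvec_sum (bigD1 j)//= tvecZ coord_vec_coord// eqxx mulr1 big1 ?addr0//.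
by move=> i /andP[_ /negbTE ij]; rewrite tvecZ coord_vec_coord// ij mulr0.
Qed.

Lemma dim_tangent_sub : has_dim (tangent_sub N m) d.
Proof.
have [dn _] := hNsub.
exists (fun j : 'I_d => coord_vec c (widen_ord dn j) m); split.
  move=> a E1 j; pose a' (i : 'I_n) := nat_coef a i.
  have := @coord_vec_indep a' (fun i => i < d)%N _ (widen_ord dn j) (ltn_ord j).
  rewrite /a' /= nat_coefE; apply; rewrite (big_ord_narrow dn) -[RHS]E1.
  by apply: eq_bigr => i _; rewrite /a' /= nat_coefE.
apply/seteqP; split=> v.
  move=> /(tangent_sub_decomp sc NP dm Nm) E1.
  exists (fun j => v (fun p => cmap c p 0 (widen_ord dn j))); rewrite {1}E1.
  under eq_bigl do rewrite /P -ltnNge.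
  by rewrite (big_ord_narrow dn).
move=> [a ->]; apply: tangent_sub_sum => j _; apply: tangent_subZ.
by apply: (tangent_sub_coord_vec sc NP dm Nm); rewrite /P -ltnNge /=.
Qed.

Lemma dim_tangent : has_dim (@tangent R n M m) n.
Proof.
exists (fun j => coord_vec c j m); split.
  by move=> a E1 j; apply: (@coord_vec_indep a xpredT).
apply/seteqP; split=> v.
  by move=> tv; exists (fun a => v (fun p => cmap c p 0 a)); exact: tangent_decomp.
by move=> [a ->]; apply: tangent_sumv => j _; apply: tangentZ; exact: coord_vec_tangent.
Qed.

Lemma sum_space0 : S 0 m = tangent_sub N m.
Proof.
apply/seteqP; split=> v; last exact: sum_space_tangent_sub.
move=> [a [b [ta [U [X [oU Um HX ->]]] ->]]].
by rewrite ((@hH0 U X oU).1 HX m Um) addr0.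
Qed.

End Point.

Lemma sub_chart m : N m -> exists c : chart R n M, [/\ smooth_chart c, cdom c m &
  forall p, cdom c p -> N p <-> forall a : 'I_n, P a -> cmap c p 0 a = 0].
Proof. by move=> /(hNsub.2)[c [sc dm NP]]; exists c. Qed.

Section Weights.
Variables (m1 : M) (Nm1 : N m1).

(** The point [m1] of [N] ties [clean_dim] to actual dimensions; for empty [N] it is an arbitrary
    choice. *)
Lemma clean_dim_le i j : (i <= j)%N -> (clean_dim i <= clean_dim j)%N.
Proof.
move=> ij; apply: has_dim_le (clean_dimP i Nm1) (clean_dimP j Nm1) _.
exact: sum_space_le.
Qed.

Lemma clean_dim0 : clean_dim 0 = d.
Proof.
have [c [sc dm NP]] := sub_chart Nm1.
have := clean_dimP 0 Nm1; rewrite (sum_space0 m1) => h.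
exact: has_dim_eq h (dim_tangent_sub sc dm Nm1 NP).
Qed.

Lemma clean_dim_top i : (r <= i)%N -> clean_dim i = n.
Proof.
move=> ri; have [c [sc dm NP]] := sub_chart Nm1.
have := clean_dimP i Nm1.
have -> : S i m1 = @tangent R n M m1.
  apply/seteqP; split=> v; first exact: sum_space_tangent.
  by move=> tv; apply: sum_space_values; exact: (values_at_top hH).
by move=> h; exact: has_dim_eq h (dim_tangent sc dm).
Qed.

Lemma clean_dim_leq_n i : (clean_dim i <= n)%N.
Proof.
rewrite -(clean_dim_top (leq_maxl r i)); apply: clean_dim_le; exact: leq_maxr.
Qed.

(* The weights for which [clean_dim i] counts the [a] with [w_a <= i]; see
   [clean_weightP].  The value is [0] (junk) when [a >= n]. *)
Definition clean_weight (a : nat) : nat :=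
  if pselect (exists i, (a < clean_dim i)%N) is left p then ex_minn p else 0%N.

Lemma clean_weightP a i : (a < n)%N -> (clean_weight a <= i)%N = (a < clean_dim i)%N.
Proof.
move=> an; rewrite /clean_weight; case: pselect => [p|[]]; last first.
  by exists r; rewrite clean_dim_top.
case: ex_minnP => k ak kmin; apply/idP/idP => [ki|/kmin//].
exact: leq_trans ak (clean_dim_le ki).
Qed.

Lemma clean_weight_gt0 (a : 'I_n) : (0 < clean_weight a)%N = (d <= a)%N.
Proof. by rewrite ltnNge clean_weightP// clean_dim0 -leqNgt. Qed.

Lemma clean_weight_mono (a b : 'I_n) : (a <= b)%N -> (clean_weight a <= clean_weight b)%N.
Proof.
by move=> ab; rewrite clean_weightP// (leq_ltn_trans ab)// -clean_weightP.
Qed.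

Lemma clean_weight_le_r (a : 'I_n) : (clean_weight a <= r)%N.
Proof. by rewrite clean_weightP// clean_dim_top. Qed.

(** A basis of [T_mN] is extended one vector at a time. For [a = d + k] and [i = clean_weight a],
    the space [TN + H_(-i)] has dimension above [a], so some vector escapes the span so far; its
    [TN] part lies in that span, so its [H_(-i)] part escapes too. *)
Lemma adapted_vectors m c : smooth_chart c -> cdom c m -> N m ->
  (forall p, cdom c p -> N p <-> forall a : 'I_n, P a -> cmap c p 0 a = 0) ->
  exists z : nat -> @tvec R n M,
   [/\ forall a : 'I_n, (a < d)%N -> z a = coord_vec c a m,
       forall a, (d <= a < n)%N -> values_at (H (clean_weight a)) m (z a) &
       lin_indep (fun j : 'I_n => z j)].
Proof.
move=> sc dm Nm NP; have [dn _] := hNsub.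
suff : forall k, (d + k <= n)%N -> exists z : nat -> @tvec R n M,
   [/\ forall a : 'I_n, (a < d)%N -> z a = coord_vec c a m,
       forall a, (d <= a < d + k)%N -> values_at (H (clean_weight a)) m (z a) &
       lin_indep (fun j : 'I_(d + k) => z j)].
  by move=> /(_ (n - d)%N); rewrite subnKC//; apply.
elim=> [|k IH] dk.
  pose z (a : nat) : @tvec R n M := if insub a is Some i then coord_vec c i m else 0.
  exists z; split.
  - by move=> a _; rewrite /z valK.
  - by move=> a; rewrite addn0; case: leqP => // /ltnW.
  - rewrite addn0; apply: (lin_indep_prefix dn).
    move=> a E1 j; apply: (@coord_vec_indep m c sc dm a xpredT) => //.
    by rewrite -[RHS]E1; apply: eq_bigr => i _; rewrite /z valK.
have [|z [z1 z2 z3]] := IH; first by rewrite (leq_trans _ dk)// leq_add2l.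
have dkn : (d + k < n)%N by rewrite addnS in dk.
set i := clean_weight (d + k).
have ki : (d + k < clean_dim i)%N by rewrite -clean_weightP.
have [s [t [h [tt vh ->]]] ns] :=
  has_dim_escape (fun j : 'I_(d + k) => z j) (clean_dimP i Nm) ki.
have nh : ~ lin_span (fun j : 'I_(d + k) => z j) h.
  move=> sh; apply: ns; apply: lin_spanD => //.
  rewrite (tangent_sub_decomp sc NP dm Nm tt).
  pose t' := nat_coef (fun a : 'I_n => t (fun p => cmap c p 0 a)).
  exists (fun j => if (j < d)%N then t' j else 0).
  under eq_bigl do rewrite /P -ltnNge.
  rewrite (big_ord_narrow dn).
  transitivity (\sum_(i0 < d) t' i0 *: z i0).
    apply: eq_bigr => l _; rewrite -[nat_of_ord l]/(nat_of_ord (widen_ord dn l)).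
    by rewrite /t' nat_coefE z1//=.
  rewrite (big_ord_widen (d + k) (fun j => t' j *: z j) (leq_addr _ _)) big_mkcond.
  by apply: eq_bigr => l _; case: ifP; rewrite ?scale0r.
exists (fun a => if a == (d + k)%N then h else z a); split.
- move=> a ad; rewrite ifF ?z1//; apply/negbTE; rewrite neq_ltn.
  by rewrite (leq_trans ad)// leq_addr.
- move=> a; rewrite addnS ltnS [(a <= _)%N]leq_eqVlt => /andP[da /orP[/eqP ->|adk]].
    by rewrite eqxx.
  by rewrite ltn_eqF//; apply: z2; rewrite da.
- rewrite addnS.
  have E1 : (fun j : 'I_(d + k) => if (j : nat) == (d + k)%N then h else z j) =
      (fun j : 'I_(d + k) => z j).
    by apply/funext => j; rewrite ltn_eqF.
  apply: (@lin_indep_extend _ _ (d + k) (fun a => if a == (d + k)%N then h else z a)).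
    by rewrite E1.
  by rewrite E1 eqxx.
Qed.

(* [Z] frames the filtration transversally to [N]; the coordinates are dual to
   [Z] along [N] only. *)
Definition adapted_chart (w : 'I_n -> nat) (c : chart R n M) (Z : 'I_n -> vf) :=
  [/\ smooth_chart c,
      forall p, cdom c p -> N p <-> forall a, (0 < w a)%N -> cmap c p 0 a = 0,
      forall b, (0 < w b)%N -> H (w b) (cdom c) (Z b),
      forall a b m, (0 < w a)%N -> (0 < w b)%N -> cdom c m -> N m ->
        lieD (Z a) (fun p => cmap c p 0 b) m = (a == b)%:R &
      forall j m v, (0 < j)%N -> cdom c m -> N m -> values_at (H j) m v ->
        exists k : 'I_n -> R,
          tangent_sub N m (v - \sum_(b | (0 < w b <= j)%N) k b *: Z b m)].

(** Let [V x] be the matrix of the derivatives [Y_a x_b] over the transverse indices, taken at the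
    projection of [x] to [N]. The new coordinates [y = x V^-1] are linear in the transverse
    directions, and the product rule on [N] gives [Y_a y_b = (V V^-1)_ab]. *)
Lemma exists_adapted_chart m : N m -> exists c Z,
  cdom c m /\ adapted_chart (fun a : 'I_n => clean_weight a) c Z.
Proof.
move=> Nm; have [c [sc dm NP]] := sub_chart Nm.
have [z [z1 z2 z3]] := adapted_vectors sc dm Nm NP.
have exY (a : 'I_n) : exists Y : vf, P a -> H (clean_weight a) setT Y /\ Y m = z a.
  have [da|nda] := boolP (P a); last by exists (fun=> 0).
  have dan : (d <= a < n)%N by rewrite ltn_ord andbT.
  have [Y HY] := values_at_section hH (z2 a dan).
  by exists Y.
pose Y a := sval (cid (exY a)).
have HY a : P a -> H (clean_weight a) setT (Y a) := fun Pa => (svalP (cid (exY a)) Pa).1.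
have Ym a : P a -> Y a m = z a := fun Pa => (svalP (cid (exY a)) Pa).2.
have oc := cdom_open c.
have vY a : P a -> vfield (cdom c) (Y a).
  by move=> Pa; apply: vfield_sub (slf_vfield hH openT (HY a Pa)).
(* Padded with the identity outside the transverse block, to stay with square matrices of size
   [n]. *)
pose B (p : M) : 'M[R]_n := \matrix_(a, b)
  if P a && P b then lieD (Y a) (fun q => cmap c q 0 b) p else (a == b)%:R.
have sB a b : smooth (cdom c) (fun p => B p a b).
  have [/andP[Pa Pb]|nP] := boolP (P a && P b).
    apply: smooth_ext (vfield_lieD oc (vY a Pa) (smooth_coord b sc)) => // p _.
    by rewrite mxE Pa Pb.
  by apply: smooth_ext (smooth_cst (cdom c) (a == b)%:R) => // p _; rewrite mxE (negbTE nP).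
have Bv p (u : 'I_n -> R) b : P b ->
    \sum_a (if P a then u a else 0) * B p a b =
    \sum_(a | P a) u a * lieD (Y a) (fun q => cmap c q 0 b) p.
  move=> Pb; rewrite [RHS]big_mkcond; apply: eq_bigr => a _.
  by rewrite mxE Pb andbT; case: (P a); rewrite ?mul0r.
have zzE p (u : 'I_n -> R) b : cdom c p ->
    (\sum_a u a *: (if P a then Y a p else coord_vec c a p)) (fun q => cmap c q 0 b) =
    \sum_(a | P a) u a * lieD (Y a) (fun q => cmap c q 0 b) p +
    (if P b then 0 else u b).
  move=> dp; rewrite tvec_sum (bigID P)/=; congr (_ + _).
    by apply: eq_bigr => a Pa; rewrite Pa.
  have E1 a : ~~ P a -> (u a *: (if P a then Y a p else coord_vec c a p))
      (fun q => cmap c q 0 b) = u a * (a == b)%:R.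
    by move=> /negbTE ->; rewrite tvecZ coord_vec_coord.
  rewrite (eq_bigr _ E1); have [Pb|nPb] := boolP (P b).
    rewrite big1// => a nPa; have /negbTE -> : a != b by apply: contraNneq nPa => ->.
    by rewrite mulr0.
  rewrite (bigD1 b)//= eqxx mulr1 big1 ?addr0// => a /andP[_ /negbTE ->].
  by rewrite mulr0.
(* A row [u] in the kernel is supported on [P], and then the sum of the [u_a z_a] is tangent to [N],
   that is, a combination of the [z_b] with [b < d]; independence of [z] gives [u = 0]. *)
have unitB : B m \in unitmx.
  rewrite -row_free_unit -kermx_eq0; apply/eqP/row_matrixP => i; rewrite row0.
  have := row_mul i (kermx (B m)) (B m); rewrite mulmx_ker row0.
  move: (row i (kermx (B m))) => u /esym uA0.
  have u0 a : ~~ P a -> u 0 a = 0.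
    move=> nPa; have := congr1 (fun A : 'rV[R]_n => A 0 a) uA0.
    rewrite mxE [RHS]mxE (bigD1 a)//= mxE (negbTE nPa) andbF eqxx mulr1 big1 ?addr0//.
    by move=> b /negbTE ba; rewrite mxE (negbTE nPa) andbF ba mulr0.
  pose y := \sum_(a | P a) u 0 a *: z a.
  have ty : tangent_sub N m y.
    apply/(tangent_subP sc NP y dm Nm); split.
      apply: tangent_sumv => a Pa; apply: tangentZ.
      by rewrite -Ym//; have [+ _] := vY a Pa; exact.
    move=> b Pb; rewrite /y tvec_sum.
    transitivity ((u *m B m) 0 b); last by rewrite uA0 mxE.
    rewrite mxE [LHS]big_mkcond; apply: eq_bigr => a _; rewrite mxE Pb andbT.
    by case: ifPn => [Pa|/u0 ->]; rewrite ?mul0r// tvecZ -Ym.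
  have E1 := tangent_sub_decomp sc NP dm Nm ty.
  pose k (a : 'I_n) := if P a then u 0 a else - y (fun q => cmap c q 0 a).
  apply/rowP => a; rewrite [RHS]mxE; have [Pa|/u0//] := boolP (P a).
  have -> : u 0 a = k a by rewrite /k Pa.
  apply: z3; rewrite (bigID P)/=.
  have -> : \sum_(a | P a) k a *: z a = y.
    by apply: eq_bigr => b Pb; rewrite /k Pb.
  rewrite {1}E1 -big_split/= big1// => b nPb.
  rewrite /k (negbTE nPb) z1; last by rewrite ltnNge.
  by rewrite scaleNr subrr.
(* a cube on which the frame stays transverse *)
have cdet : Cinfty (cimg c (cdom c)) (fun x => \det (B (cinv c x))).
  apply: Cinfty_det => [|a b]; first exact: open_cimg.
  exact: (smooth_Cinfty sc oc (sB a b)).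
have sdet : smooth (cdom c) (fun p => \det (B p)).
  have := @smooth_comp_chart _ _ M c (cdom c) _ sc oc cdet; rewrite setIid.
  by apply: smooth_ext => // p dp /=; rewrite cmapK.
have [|W [oW Wm Wc W0]] := smooth_neq0_near oc dm sdet.
  by move: unitB; rewrite unitmxE unitfE.
have nW : nbhs (cmap c m) (cimg c W).
  by apply: open_nbhs_nbhs; split; [exact: open_cimg|exact: cimg_cmap].
have /nbhs_cube[e e0 eW] := nW.
pose O : set E := ball (cmap c m) e.
have oO : open O by exact: ball_open.
have OP (x : E) : O x <-> forall a, `|x 0 a - cmap c m 0 a| < e.
  split=> [[_ H1] a|H1]; first by have := H1 0 a; rewrite /ball/= distrC.
  by split=> // i a; rewrite ord1 /ball/= distrC; exact: H1.
have OW : O `<=` cimg c W by move=> x /OP; exact: eW.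
pose pi (x : E) := dilation P 0 x.
have pm0 a : P a -> cmap c m 0 a = 0 by move=> Pa; exact: (NP _ dm).1 Nm a Pa.
have piO x : O x -> O (pi x).
  move=> /OP Ox; apply/OP => a; rewrite mxE; case: ifP => // Pa.
  by rewrite mul0r (pm0 a Pa) subrr normr0.
have cpi (A : set E) b : Cinfty A (fun x => pi x 0 b).
  apply: (@Cinfty_sub _ _ setT) => //.
  apply: eq_Cinfty (_ : Cinfty setT (fun x : E => (if P b then 0 else 1) * x 0 b)).
  - exact: openT.
  - by move=> x _; rewrite mxE; case: (P b); rewrite ?mul1r.
  - by apply: Cinfty_mul; [exact: openT|exact: Cinfty_cst|exact: Cinfty_coord].
pose A : set E := pi @^-1` O.
have oA : open A.
  have := @open_preimage R n setT O pi openT oO (cpi setT).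
  by rewrite setTI.
have OA : O `<=` A by move=> x; exact: piO.
pose V (x : E) := B (cinv c (pi x)).
have cV i j : Cinfty A (fun x => V x i j).
  apply: (@Cinfty_comp _ _ _ A O pi (fun x => B (cinv c x) i j)) => //.
  apply: Cinfty_sub (smooth_Cinfty sc oc (sB i j)).
  by move=> x /OW [p [dp _] <-]; exact: cimg_cmap.
have uV x : A x -> V x \in unitmx.
  by rewrite unitmxE unitfE => /OW/cimgP[dp Wp _]; exact: W0.
pose G x := invmx (V x).
have cG i j : Cinfty O (fun x => G x i j).
  apply: Cinfty_invmx => // [x /OA|i' j']; first exact: uV.
  exact: Cinfty_sub (cV i' j').
have VP x i j : ~~ (P i && P j) -> V x i j = (i == j)%:R.
  by move=> /negbTE nP; rewrite mxE nP.
have GPr x i j : A x -> ~~ P j -> G x i j = (i == j)%:R.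
  move=> Ax nPj; have := congr1 (fun C : 'M[R]_n => C i j) (mulVmx (uV x Ax)).
  rewrite !mxE => <-; rewrite (bigD1 j)//= VP ?(negbTE nPj) ?andbF// eqxx mulr1.
  rewrite big1 ?addr0// => l /negbTE lj; by rewrite VP ?(negbTE nPj) ?andbF// lj mulr0.
have GPl x i j : A x -> ~~ P i -> G x i j = (i == j)%:R.
  move=> Ax nPi; have := congr1 (fun C : 'M[R]_n => C i j) (mulmxV (uV x Ax)).
  rewrite !mxE => <-; rewrite (bigD1 i)//= VP ?(negbTE nPi)// eqxx mul1r.
  rewrite big1 ?addr0// => l li; by rewrite VP ?(negbTE nPi)// eq_sym (negbTE li) mul0r.
(* Both maps preserve [pi], through which alone the matrices depend on the point, so each inverts
   the other. *)
pose psi x := x *m G x; pose theta y := y *m V y.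
have pipsi x : A x -> pi (psi x) = pi x.
  move=> Ax; apply/rowP => b; rewrite !mxE; case: ifPn => [_|nPb]; first by rewrite !mul0r.
  rewrite (bigD1 b)//= GPr// eqxx mulr1 big1 ?addr0// => l /negbTE lb.
  by rewrite GPr// lb mulr0.
have pitheta x : pi (theta x) = pi x.
  apply/rowP => b; rewrite !mxE; case: ifPn => [_|nPb]; first by rewrite !mul0r.
  rewrite (bigD1 b)//= VP ?(negbTE nPb) ?andbF// eqxx mulr1 big1 ?addr0// => l /negbTE lb.
  by rewrite VP ?(negbTE nPb) ?andbF// lb mulr0.
have ctheta b : Cinfty A (fun x => theta x 0 b).
  apply: eq_Cinfty (_ : Cinfty A (fun x => \sum_l x 0 l * V x l b)) => //.
    by move=> x _; rewrite mxE.
  by apply: Cinfty_sum => // l _; apply: Cinfty_mul => //; exact: Cinfty_coord.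
have cpsi b : Cinfty O (fun x => psi x 0 b).
  apply: eq_Cinfty (_ : Cinfty O (fun x => \sum_l x 0 l * G x l b)) => //.
    by move=> x _; rewrite mxE.
  by apply: Cinfty_sum => // l _; apply: Cinfty_mul => //; exact: Cinfty_coord.
have psiK x : O x -> theta (psi x) = x.
  move=> /OA Ax; rewrite /theta /V pipsi// -/(V x) /psi /G.
  by rewrite mulmxKV// uV.
have thetaK x : A x -> psi (theta x) = x.
  move=> Ax; rewrite /psi /G /V pitheta -/(V x) /theta.
  by rewrite mulmxK// uV.
pose O' := A `&` theta @^-1` O.
have oO' : open O' by exact: open_preimage.
have [||||||c' [sc' d' m' _]] := comp_chart (O := O) (O' := O') (psi := psi)
    (theta := theta) sc oO oO' _ cpsi.
- by move=> x /OW[p [dp _] <-]; exists p.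
- by move=> b; apply: Cinfty_sub (ctheta b) => ? [].
- move=> x Ox; split; last by rewrite /preimage/= psiK.
  by rewrite /A /preimage/= pipsi; [exact: piO|exact: OA].
- by move=> y [].
- exact: psiK.
- by move=> y [Ay _]; exact: thetaK.
have dd' p : cdom c' p -> cdom c p /\ O (cmap c p) by rewrite d' => -[].
have wP (a : 'I_n) : (0 < clean_weight a)%N = P a by exact: clean_weight_gt0.
have BN p : cdom c' p -> N p -> V (cmap c p) = B p.
  move=> /dd'[dp Op] Np; rewrite /V; congr (B _); rewrite -[RHS](cmapK dp).
  congr (cinv c _); apply/rowP => a; rewrite mxE; case: ifP => // Pa.
  by rewrite mul0r (NP p dp).1.
exists c', Y; split.
  by rewrite d'; split=> //; apply/OP => a; rewrite subrr normr0.
split=> //.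
- move=> p /dd'[dp Op]; rewrite (NP p dp) m'; have Ap := OA _ Op.
  split=> H1 a; rewrite ?wP => Pa.
    rewrite mxE big1// => l _; have [Pl|nPl] := boolP (P l).
      by rewrite H1// mul0r.
    rewrite GPl//; have /negbTE -> : l != a by apply: contraNneq nPl => ->.
    by rewrite mulr0.
  rewrite -(psiK _ Op) /theta mxE big1// => l _; have [Pl|nPl] := boolP (P l).
    by rewrite H1 ?wP// mul0r.
  rewrite VP ?(negbTE nPl)//; have /negbTE -> : l != a by apply: contraNneq nPl => ->.
  by rewrite mulr0.
- move=> b; rewrite wP => Pb.
  exact: (sd_res (slf_distribution hH _) openT (cdom_open c') (@subsetT _ _) (HY b Pb)).
- move=> a b p; rewrite !wP => Pa Pb dp Np; have [cp Op] := dd' _ dp.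
  have Ap := OA _ Op.
  have oc' := cdom_open c'.
  have vYa : vfield (cdom c') (Y a).
    by apply: vfield_sub (vY a Pa) => q /dd'[].
  have sx l : smooth (cdom c') (fun q => cmap c q 0 l).
    by apply: smooth_sub (smooth_coord l sc) => q /dd'[].
  have sg l : smooth (cdom c') (fun q => G (cmap c q) l b).
    rewrite d' [_ `&` _](_ : _ = cdom c `&` (cdom c `&` cmap c @^-1` O)); last first.
      by rewrite setIA setIid.
    apply: (@smooth_comp_chart _ _ M c (cdom c `&` cmap c @^-1` O)
      (fun x => G x l b) sc) => //; first by rewrite -d'.
    by apply: Cinfty_sub (cG l b) => _ [q [_ [_ Oq]] <-].
  transitivity (lieD (Y a) (fun q => \sum_l cmap c q 0 l * G (cmap c q) l b) p).
    apply: (lieD_ext oc' vYa dp); first exact: smooth_coord.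
    by move=> q _; rewrite m' mxE.
  rewrite (lieD_sum oc' vYa _ dp) => [|l _]; last exact: smooth_mul.
  transitivity ((V (cmap c p) *m G (cmap c p)) a b); last first.
    by rewrite mulmxV ?uV// mxE.
  rewrite mxE BN//; apply: eq_bigr => l _; rewrite (lieD_mul oc' vYa dp)//.
  rewrite mxE Pa/=; case: ifPn => [Pl|nPl].
    by rewrite (NP p cp).1// mul0r add0r mulrC.
  have lb : (l == b) = false by apply/negbTE; apply: contraNneq nPl => ->.
  have al : (a == l) = false by apply/negbTE; apply: contraNneq nPl => <-.
  rewrite al mul0r GPl// lb mul0r addr0.
  rewrite (_ : lieD (Y a) (fun q => G (cmap c q) l b) p = lieD (Y a) (fun=> 0) p).
    by rewrite (lieD_cst vYa _ dp) mulr0.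
  apply: (lieD_ext oc' vYa dp) => // q /dd'[_ Oq].
  by rewrite GPl ?lb//; exact: OA.
- move=> j p v j0 dp Np vv; have [cp Op] := dd' _ dp.
  have Bp : B p \in unitmx by rewrite -BN// uV//; exact: OA.
  (* The frame at another point [p] of [N], completed by coordinate vectors along [N]. By cleanness
     [TN + H_(-j)] has dimension [clean_dim j] at [p] too, and the first [clean_dim j] of these
     vectors lie in it, so they span it. *)
  pose zz (a : nat) : @tvec R n M :=
    if insub a is Some i then (if P i then Y i p else coord_vec c i p) else 0.
  have zzP (i : 'I_n) : zz i = if P i then Y i p else coord_vec c i p.
    by rewrite /zz valK.
  have izz : lin_indep (fun i : 'I_n => zz i).
    move=> u E1.
    have E2 : \sum_a u a *: (if P a then Y a p else coord_vec c a p) = 0.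
      by rewrite -[RHS]E1; apply: eq_bigr => a _; rewrite zzP.
    have E3 b : \sum_(a | P a) u a * lieD (Y a) (fun q => cmap c q 0 b) p +
        (if P b then 0 else u b) = 0 by rewrite -zzE// E2.
    pose u' : 'rV[R]_n := \row_a (if P a then u a else 0).
    have u'B : u' *m B p = 0.
      apply/rowP => b; rewrite [RHS]mxE mxE.
      under eq_bigr do rewrite mxE.
      have [Pb|nPb] := boolP (P b).
        by rewrite Bv//; have := E3 b; rewrite Pb addr0.
      rewrite big1// => a _; rewrite mxE (negbTE nPb) andbF.
      have [Pa|nPa] := boolP (P a); last by rewrite mul0r.
      have /negbTE -> : a != b by apply: contraNneq nPb => <-.
      by rewrite mulr0.
    have u'0 : u' = 0 by rewrite -(mulmxK Bp u') u'B mul0mx.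
    have uP a : P a -> u a = 0.
      move=> Pa; have := congr1 (fun C : 'rV[R]_n => C 0 a) u'0.
      by rewrite !mxE Pa.
    move=> b; have [Pb|nPb] := boolP (P b); first exact: uP.
    have := E3 b; rewrite (negbTE nPb) big1 ?add0r// => a Pa.
    by rewrite uP// mul0r.
  have kn := clean_dim_leq_n j.
  have Szz (i : 'I_(clean_dim j)) : S j p (zz i).
    rewrite -[nat_of_ord i]/(nat_of_ord (widen_ord kn i)) zzP; case: ifPn => Pi.
      apply: sum_space_values; apply: (values_at_le hH (i := clean_weight (widen_ord kn i))).
        by rewrite clean_weightP//; exact: (ltn_ord i).
      by exists setT, (Y (widen_ord kn i)); split=> //; [exact: openT|exact: HY].
    by apply: sum_space_tangent_sub; exact: (tangent_sub_coord_vec sc NP cp Np).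
  have /(lin_span_nat kn)[k ->] :=
    has_dim_span (clean_dimP j Np) (lin_indep_prefix kn izz) Szz (sum_space_values vv).
  exists k; rewrite (bigID P)/=.
  rewrite (_ : \sum_(i < n | (i < clean_dim j)%N && P i) k i *: zz i =
    \sum_(b < n | (0 < clean_weight b <= j)%N) k b *: Y b p).
    rewrite [X in tangent_sub _ _ (X - _)]addrC addrK; apply: tangent_sub_sum => i /andP[_ nPi].
    apply: tangent_subZ; rewrite zzP (negbTE nPi).
    exact: (tangent_sub_coord_vec sc NP cp Np).
  apply: eq_big => [i|i /andP[_ Pi]]; last by rewrite zzP Pi.
  by rewrite wP clean_weightP// andbC.
Qed.

End Weights.
End Adapted.

(** * Bellaiche's correction *)

Section Shear.
Context {R : realType} {n : nat} {M : smooth_manifold R n}.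
Local Notation E := ('rV[R]_n).

(** As [q] does not depend on the [a]-th coordinate, adding it back inverts the subtraction. *)
Lemma shear_chart (c : chart R n M) (a : 'I_n) (q : E -> R) : smooth_chart c ->
  (forall x x' : E, (forall b, b != a -> x 0 b = x' 0 b) -> q x = q x') ->
  Cinfty (cimg c (cdom c)) q ->
  exists c' : chart R n M, [/\ smooth_chart c', cdom c' = cdom c &
    forall m b, cmap c' m 0 b = cmap c m 0 b - (if b == a then q (cmap c m) else 0)].
Proof.
move=> sc qa cq; set O := cimg c (cdom c).
have oO : open O by apply: open_cimg; exact: cdom_open.
pose psi (x : E) : E := x - q x *: delta_mx 0 a.
pose theta (x : E) : E := x + q x *: delta_mx 0 a.
have psiE x b : psi x 0 b = x 0 b - (if b == a then q x else 0).
  by rewrite !mxE eqxx/=; case: eqP => _; rewrite ?mulr1// mulr0.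
have thetaE x b : theta x 0 b = x 0 b + (if b == a then q x else 0).
  by rewrite !mxE eqxx/=; case: eqP => _; rewrite ?mulr1// mulr0.
have qpsi x : q (psi x) = q x.
  by apply: qa => b /negbTE ba; rewrite psiE ba subr0.
have qtheta x : q (theta x) = q x.
  by apply: qa => b /negbTE ba; rewrite thetaE ba addr0.
pose sh (t : R) (x : E) : E := x + t *: delta_mx 0 a.
have csh (t : R) (W : set E) b : Cinfty W (fun x => sh t x 0 b).
  apply: (@Cinfty_sub _ _ setT) => //.
  apply: eq_Cinfty (_ : Cinfty setT (fun y : E => y 0 b + t * (delta_mx 0 a : E) 0 b)).
  - exact: openT.
  - by move=> y _; rewrite !mxE.
  - by apply: Cinfty_add; [exact: openT|exact: Cinfty_coord|exact: Cinfty_cst].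
have osh t : open (sh t @^-1` O).
  by have := @open_preimage R n setT O (sh t) openT oO (csh t setT); rewrite setTI.
(* [q] is smooth on every translate of [O] in the direction [a], and the image of [psi] lies in
   their union. *)
pose A : set E := \bigcup_t (sh t @^-1` O).
have oA : open A by apply: bigcup_open => t _; exact: osh.
have qA : Cinfty A q.
  apply: Cinfty_local => x [t _ Ot]; exists (sh t @^-1` O) => //.
  apply: eq_Cinfty (Cinfty_comp (osh t) oO (fun y Hy => Hy) (csh t _) cq) => //.
  move=> y _ /=; apply: qa => b ba; rewrite !mxE eqxx/= (negbTE ba) mulr0 addr0//.
have ctheta b : Cinfty A (fun x => theta x 0 b).
  apply: eq_Cinfty (_ : Cinfty A (fun x => x 0 b + q x * (delta_mx 0 a : E) 0 b)) => //.
    by move=> x _; rewrite !mxE.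
  apply: Cinfty_add => //; first exact: Cinfty_coord.
  by apply: Cinfty_mul => //; exact: Cinfty_cst.
have cpsi b : Cinfty O (fun x => psi x 0 b).
  apply: eq_Cinfty (_ : Cinfty O (fun x => x 0 b - q x * (delta_mx 0 a : E) 0 b)) => //.
    by move=> x _; rewrite !mxE.
  apply: Cinfty_sub_fun => //; first exact: Cinfty_coord.
  by apply: Cinfty_mul => //; exact: Cinfty_cst.
have psiK x : theta (psi x) = x.
  by rewrite /theta qpsi /psi subrK.
have thetaK x : psi (theta x) = x.
  by rewrite /psi qtheta /theta addrK.
have [|||||||c' [sc' d' m' _]] := comp_chart (O := O) (O' := A `&` theta @^-1` O)
    (psi := psi) (theta := theta) sc oO _ _ cpsi.
- exact: open_preimage.
- by move=> x [p [dp _] <-]; exists p.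
- by move=> b; apply: Cinfty_sub (ctheta b) => ? [].
- move=> x Ox; split; last by rewrite /preimage/= psiK.
  exists (q x) => //; rewrite /preimage/= /sh -[q x]qpsi -/(theta (psi x)).
  by rewrite psiK.
- by move=> y [].
- by [].
- by [].
exists c'; split=> //; last by move=> m b; rewrite m' psiE.
rewrite d'; apply/seteqP; split=> [p []//|p dp]; split=> //.
exact: cimg_cmap.
Qed.

End Shear.

Section Correction.
Context {R : realType} {n : nat} {M : smooth_manifold R n}.
Local Notation E := ('rV[R]_n).
Local Notation vf := (M -> @tvec R n M).
Variables (N : set M) (w : 'I_n -> nat) (c : chart R n M) (Z : 'I_n -> vf).
Let P : pred 'I_n := fun a => (0 < w a)%N.
Let U := cdom c.
Hypotheses (sc : smooth_chart c)
  (NP : forall p, U p -> N p <-> forall a, P a -> cmap c p 0 a = 0)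
  (vZ : forall b, P b -> vfield U (Z b))
  (dZ : forall a b m, P a -> P b -> U m -> N m ->
     lieD (Z a) (fun p => cmap c p 0 b) m = (a == b)%:R)
  (star : starlike P (cimg c U))
  (wmono : forall a b : 'I_n, (a <= b)%N -> (w a <= w b)%N).

Let oU : open U := cdom_open c.
(* the powers of the vanishing ideal of [N] *)
Let J k f := lie_order (fun _ => @vfield R n M) N k U f.
Let hv : forall (j : nat) V X, open V -> vfield (M := M) V X -> vfield V X.
Proof. by []. Qed.

Let coord (b : 'I_n) (p : M) : R := cmap c p 0 b.
Let mon (t : seq 'I_n) (p : M) : R := \prod_(b <- t) coord b p.

Let s_coord b : smooth U (coord b). Proof. exact: smooth_coord. Qed.

Let s_mon t : smooth U (mon t).
Proof.
elim: t => [|b t IH].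
  by apply: smooth_ext (smooth_cst U 1) => // p _; rewrite /mon big_nil.
by apply: smooth_ext (smooth_mul oU (s_coord b) IH) => // p _; rewrite /mon big_cons.
Qed.

Let J_coord b : P b -> J 1 (coord b).
Proof.
move=> Pb; apply: lie_order1 => //.
by move=> m Um Nm; exact: (NP Um).1.
Qed.

Let J_mon t : all P t -> J (size t) (mon t).
Proof.
elim: t => [_|b t IH] /=; first by apply/lie_order0.
move=> /andP[Pb Pt]; rewrite -add1n.
apply: (lie_order_ext hv oU (f := fun p => coord b p * mon t p)).
  by move=> p _; rewrite /mon big_cons.
by apply: (lie_order_mul hv oU); [exact: J_coord|exact: IH].
Qed.

Let all_vZ s : all P s -> all_vfield U (map Z s).
Proof. by elim: s => [//|b s IH] /= /andP[Pb /IH]; split=> //; exact: vZ. Qed.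

Let J_kill k s f m : all P s -> (size s < k)%N -> J k f -> U m -> N m ->
  lieDs (map Z s) f m = 0.
Proof.
move=> Ps sk [_ Jf] Um Nm.
have := Jf [seq (1%N, Z b) | b <- s] _ _ m Um Nm.
rewrite -map_comp /=; apply.
  by elim: s Ps {sk} => [//|b s IH] /= /andP[Pb /IH]; split=> //; exact: vZ.
suff -> : weight [seq (1%N, Z b) | b <- s] = size s by [].
by elim: s {Ps sk} => [//|b s IH]; rewrite /= weight_cons IH add1n.
Qed.

(** As [Z_b x_a] is [delta_ab] on [N], the field [Z_b] acts on monomials like the partial derivative
    [d_b], up to an error in one higher power of the ideal. *)
Let J_lieD_mon b t : P b -> all P t ->
  J (size t) (fun p => lieD (Z b) (mon t) p - (count_mem b t)%:R * mon (rem b t) p).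
Proof.
move=> Pb; elim: t => [_|x t IH] /=.
  apply/lie_order0; apply: smooth_ext (smooth_cst U 0) => // p Up.
  rewrite mul0r subr0 (lieD_ext oU (vZ Pb) Up (g := fun=> 1)) ?(lieD_cst (vZ Pb))//.
  by move=> q _; rewrite /mon big_nil.
move=> /andP[Px Pt].
have sZ : smooth U (lieD (Z b) (coord x)) by apply: vfield_lieD => //; exact: vZ.
have C1 : J (1 + size t) (fun p => (lieD (Z b) (coord x) p - (b == x)%:R) * mon t p).
  apply: (lie_order_mul hv oU); last exact: J_mon.
  apply: lie_order1; first by move=> m Um Nm; rewrite dZ// subrr.
  by apply: smooth_subf => //; exact: smooth_cst.
have C2 := lie_order_mul hv oU (J_coord Px) (IH Pt).
apply: (lie_order_ext hv oU) (lie_order_add hv oU C1 C2) => p Up.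
have -> : lieD (Z b) (mon (x :: t)) p =
    coord x p * lieD (Z b) (mon t) p + mon t p * lieD (Z b) (coord x) p.
  rewrite -(lieD_mul oU (vZ Pb) Up)//; apply: (lieD_ext oU (vZ Pb) Up) => // q _.
  by rewrite /mon big_cons.
rewrite eq_sym; case: eqP => [->|_]; last first.
  by rewrite add0n /mon big_cons mulr0n; ring.
have [xt|xt] := boolP (b \in t).
  have -> : mon t p = coord b p * mon (rem b t) p.
    by rewrite /mon (perm_big _ (perm_to_rem xt))/= big_cons.
  by rewrite add1n -natr1 mulr1n; ring.
by rewrite (count_memPn xt) addn0 mulr1n; ring.
Qed.

(** For words of equal length, the constant obtained by differentiating the monomial of [t] along
    the letters of [s]: the product of the factorials of the multiplicities if [t] is a permutation
    of [s], and [0] otherwise. *)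
Fixpoint matchings (s t : seq 'I_n) : nat :=
  if s is b :: s' then (count_mem b t * matchings s' (rem b t))%N
  else (t == [::]).

Let matchings_neq0 s t : (matchings s t != 0)%N = perm_eq s t.
Proof.
elim: s t => [|b s IH] t /=.
  by rewrite perm_sym; case: t => [|x t]//=; apply/esym/negbTE/negP => /perm_size.
rewrite muln_eq0 negb_or IH -lt0n -has_count has_pred1.
have [bt|bt] := boolP (b \in t) => /=.
  by rewrite (perm_sym _ t) (permPl (perm_to_rem bt)) perm_cons perm_sym.
apply/esym/negbTE/negP => /perm_mem /(_ b); rewrite inE eqxx/= => E1.
by rewrite -E1 in bt.
Qed.

(** At a point of [N] only the terms in which all fields differentiate the monomial survive;
    [J_kill] removes the others. The reversal lets the head of [s] act first. *)
Let lieDs_mon s t g m : all P s -> all P t -> size s = size t -> smooth U g ->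
  U m -> N m ->
  lieDs (map Z (rev s)) (fun p => g p * mon t p) m = g m * (matchings s t)%:R.
Proof.
move=> Ps Pt st sg Um Nm; elim: s t g Ps Pt st sg => [|b s IH] t g /=.
  by move=> _ _; case: t => //= _ _; rewrite /mon big_nil.
move=> /andP[Pb Ps] Pt st sg; rewrite rev_cons map_rcons lieDs_rcons.
have Prs : all P (rev s) by rewrite all_rev.
have vs := all_vZ Prs.
have vb := vZ Pb.
have s1 : smooth U (fun p => mon t p * lieD (Z b) g p).
  by apply: smooth_mul => //; apply: vfield_lieD.
pose rho p := lieD (Z b) (mon t) p - (count_mem b t)%:R * mon (rem b t) p.
have J1 : J (size t) (fun p => g p * rho p + lieD (Z b) g p * mon t p).
  apply: (lie_order_add hv oU); apply: (lie_order_mull hv oU) => //.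
  - exact: J_lieD_mon.
  - exact: vfield_lieD.
  - exact: J_mon.
have s2 : smooth U (fun p => g p * rho p + lieD (Z b) g p * mon t p) by case: J1.
have s3 : smooth U (fun p => (g p * (count_mem b t)%:R) * mon (rem b t) p).
  by apply: smooth_mul => //; apply: smooth_mul => //; exact: smooth_cst.
have s4 : smooth U (lieD (Z b) (fun p => g p * mon t p)).
  by apply: vfield_lieD => //; exact: smooth_mul.
rewrite (lieDs_ext oU vs Um s4 (g := fun p =>
  (g p * rho p + lieD (Z b) g p * mon t p) +
  (g p * (count_mem b t)%:R) * mon (rem b t) p)); last first.
  by move=> p Up; rewrite (lieD_mul oU vb Up)// /rho; ring.
rewrite (lieDs_add oU vs Um s2 s3) (J_kill Prs _ J1 Um Nm); last first.
  by rewrite size_rev -st.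
rewrite add0r natrM mulrA; have [bt|bt] := boolP (b \in t).
  apply: IH => //.
  - by apply/allP => x /mem_rem; exact/allP.
  - by rewrite size_rem// -st.
  - by apply: smooth_mul => //; exact: smooth_cst.
rewrite {2}(count_memPn bt) mulr0 mul0r.
rewrite (lieDs_ext oU vs Um s3 (g := fun=> 0)); last first.
  by move=> p _; rewrite (count_memPn bt) mulr0 mul0r.
by apply: (J_kill Prs (ltnSn _)) => //; exact: lie_order_zero.
Qed.

Let sorted (s : seq 'I_n) := pairwise (fun x y : 'I_n => x <= y)%N s.

(* Terms of degree [K + 1] do not affect the tests of length at most [K], and
   [lieDs_mon] shows that their coefficients can be chosen to settle those of
   length [K + 1]. *)
Let correction_upto (a : 'I_n) (K : nat) : P a -> exists q : E -> R,
  [/\ Cinfty (cimg c U) q, J 2 (q \o cmap c),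
      forall x x' : E, (forall b, (w b < w a)%N -> x 0 b = x' 0 b) -> q x = q x' &
      forall s, sorted s -> all P s -> (2 <= size s <= K)%N ->
        (weight (frame_seq w Z s) < w a)%N -> forall m, U m -> N m ->
        lieDs (map Z s) (fun p => coord a p - q (cmap c p)) m = 0].
Proof.
move=> Pa; elim: K => [|K [q [q1 q2 q3 q4]]].
  exists (fun=> 0); split=> //.
  - exact: Cinfty_cst.
  - exact: (lie_order_zero (H := fun _ => @vfield R n M) N hv 2 oU).
  - by move=> s _ _ /andP[]; case: s => [|? []].
(* For [K = 0] there is no word to treat; afterwards the new terms have degree at least [2], which
   keeps [q] in [J 2]. *)
have [K2|K2] := ltnP K 1.
  exists q; split=> // s ss Ps /andP[s1 s2]; apply: q4 => //; rewrite s1/=; lia.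
have oI : open (cimg c U) by exact: open_cimg.
pose T (t : K.+1.-tuple 'I_n) := [&& sorted t, all P t & (weight (frame_seq w Z t) < w a)%N].
have sq : smooth U (fun p => coord a p - q (cmap c p)).
  by apply: smooth_subf => //; case: q2.
pose F (t : seq 'I_n) := lieDs (map Z t) (fun p => coord a p - q (cmap c p)).
have sF t : all P t -> smooth U (F t).
  by move=> Pt; apply: lieDs_smooth => //; exact: all_vZ.
pose mu (t : seq 'I_n) : R := (matchings (rev t) t)%:R.
have mu0 t : mu t != 0.
  by rewrite /mu pnatr_eq0 matchings_neq0 perm_rev perm_refl.
(* The test value, made independent of the transverse coordinates by projecting to [N], the only
   place where it has to be correct. *)
pose g (t : seq 'I_n) (x : E) : R := F t (cinv c (dilation P 0 x)).
have cdil (W : set E) b : Cinfty W (fun x => dilation P 0 x 0 b).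
  apply: (@Cinfty_sub _ _ setT) => //.
  apply: eq_Cinfty (_ : Cinfty setT (fun x : E => (if P b then 0 else 1) * x 0 b)).
  - exact: openT.
  - by move=> x _; rewrite mxE; case: (P b); rewrite ?mul1r.
  - by apply: Cinfty_mul; [exact: openT|exact: Cinfty_cst|exact: Cinfty_coord].
have dilI x : cimg c U x -> cimg c U (dilation P 0 x).
  by move=> Ix; apply: star => //; rewrite lexx ler01.
have cg t : all P t -> Cinfty (cimg c U) (g t).
  move=> Pt.
  exact: (Cinfty_comp oI oI dilI (cdil _) (smooth_Cinfty sc oU (sF t Pt))).
pose monx (t : seq 'I_n) (x : E) : R := \prod_(b <- t) x 0 b.
pose term (t : seq 'I_n) (x : E) := (mu t)^-1 * g t x * monx t x.
have cterm t : all P t -> Cinfty (cimg c U) (term t).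
  move=> Pt; apply: Cinfty_mul => //.
    by apply: Cinfty_mul => //; [exact: Cinfty_cst|exact: cg].
  by apply: Cinfty_prod => // b _; exact: Cinfty_coord.
have sg t : all P t -> smooth U (fun p => (mu t)^-1 * g t (cmap c p)).
  move=> Pt; apply: smooth_mul => //; first exact: smooth_cst.
  have := @smooth_comp_chart _ _ M c U (g t) sc oU (cg t Pt).
  by rewrite setIid.
have Jterm t : all P t -> J (size t) (term t \o cmap c).
  by move=> Pt; apply: (lie_order_mull hv oU); [exact: sg|exact: J_mon].
have TP t : T t -> all P t by move=> /and3P[].
exists (fun x => q x + \sum_(t | T t) term t x); split.
- apply: Cinfty_add => //; apply: Cinfty_sum => // t Tt; exact/cterm/TP.
- apply: (lie_order_add hv oU q2).
  apply: (@lie_order_sum _ _ M (fun _ => @vfield R n M) N hv 2 U _ _ T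
    (fun t : K.+1.-tuple 'I_n => term t \o cmap c)) => //.
  move=> t Tt; apply: lie_order_le (Jterm t (TP t Tt)).
  by rewrite size_tuple.
- move=> x x' xx'; rewrite (q3 x x' xx'); congr (_ + _); apply: eq_bigr => t Tt.
  rewrite /term; congr (_ * _ * _).
    rewrite /g; congr (F t (cinv c _)); apply/rowP => b; rewrite !mxE.
    case: ifPn => [|nPb]; first by rewrite !mul0r.
    by apply: xx'; apply: leq_ltn_trans Pa; rewrite leqNgt.
  rewrite /monx; have /and3P[_ _ wt] := Tt.
  (* A word of weight below [w a] has only letters of weight below [w a]. *)
  elim: (val t) wt => [|b s IHs]; first by rewrite !big_nil.
  rewrite /frame_seq/= weight_cons/= => wt; rewrite !big_cons xx'.
    by rewrite IHs//; apply: leq_ltn_trans wt; exact: leq_addl.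
  by apply: leq_ltn_trans wt; exact: leq_addr.
- move=> s ss Ps /andP[s2 sK] ws m Um Nm.
  have vs := all_vZ Ps.
  have ssum : smooth U (fun p => \sum_(t | T t) term t (cmap c p)).
    apply: (@smooth_sum _ _ M U _ (index_enum _) T
      (fun t : K.+1.-tuple 'I_n => term t \o cmap c)) => //.
    by move=> t Tt; have [] := Jterm t (TP t Tt).
  have sq' : smooth U (fun p => coord a p - (q (cmap c p) + \sum_(t | T t) term t (cmap c p))).
    by apply: smooth_subf => //; apply: smooth_add => //; case: q2.
  rewrite (lieDs_ext oU vs Um sq' (g := fun p => (coord a p - q (cmap c p)) -
    \sum_(t | T t) term t (cmap c p))); last by move=> p _; ring.
  rewrite (lieDs_sub oU vs Um sq ssum).
  rewrite (@lieDs_sum _ _ M U (map Z s) _ (index_enum _) T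
    (fun t : K.+1.-tuple 'I_n => term t \o cmap c) m oU vs Um); last first.
    by move=> t Tt; have [] := Jterm t (TP t Tt).
  move: sK; rewrite leq_eqVlt => /orP[/eqP sK|sK]; last first.
    rewrite q4 ?s2//= big1 ?subr0// => t Tt.
    by apply: (J_kill Ps _ (Jterm t (TP t Tt)) Um Nm); rewrite size_tuple.
  have sT : size s == K.+1 by rewrite sK.
  have E1 (t : K.+1.-tuple 'I_n) : T t -> lieDs (map Z s) (term t \o cmap c) m =
      (mu t)^-1 * g t (cmap c m) * (matchings (rev s) t)%:R.
    move=> Tt; rewrite -{1}[s]revK.
    rewrite -(lieDs_mon (s := rev s) (t := t) _ _ _ (sg t (TP t Tt)) Um Nm)//.
    - by rewrite all_rev.
    - exact: TP.
    - by rewrite size_rev sK size_tuple.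
  have Ts : T (Tuple sT) by rewrite /T /= ss Ps ws.
  rewrite (bigD1 (Tuple sT)) // (E1 _ Ts) /=.
  rewrite big1 => [|t /andP[Tt ts]].
    rewrite addr0 -/(mu s) mulrAC mulVf// mul1r /g.
    have -> : dilation P 0 (cmap c m) = cmap c m.
      apply/rowP => b; rewrite mxE; case: ifP => // Pb.
      by rewrite mul0r ((NP Um).1 Nm).
    by rewrite cmapK// subrr.
  (* Distinct sorted words are not permutations of each other, so only the term of [s] itself
     contributes. *)
  rewrite E1//; have /and3P[st _ _] := Tt.
  suff -> : matchings (rev s) t = 0%N by rewrite mulr0.
  apply/eqP; apply/negPn; rewrite matchings_neq0 perm_rev//.
  apply: contra ts => pst; apply/eqP/val_inj => /=; apply/esym.
  apply: (sorted_eq (leT := fun x y : 'I_n => (x <= y)%N)) pst.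
  - by move=> ? ? ?; exact: leq_trans.
  - by move=> x y xy; apply/val_inj/eqP; rewrite eqn_leq.
  - exact: pairwise_sorted.
  - exact: pairwise_sorted.
Qed.

(** A word of letters of positive weight is no longer than its weight, so [K = w a] reaches all
    words of weight below [w a]. *)
Lemma coordinate_correction (a : 'I_n) : P a -> exists q : E -> R,
  [/\ Cinfty (cimg c U) q, J 2 (q \o cmap c),
      forall x x' : E, (forall b, (w b < w a)%N -> x 0 b = x' 0 b) -> q x = q x' &
      forall s, pairwise (fun x y : 'I_n => x <= y)%N s -> all P s -> (2 <= size s)%N ->
        (weight (frame_seq w Z s) < w a)%N -> forall m, U m -> N m ->
        lieDs (map Z s) (fun p => cmap c p 0 a - q (cmap c p)) m = 0].
Proof.
move=> Pa; have [q [q1 q2 q3 q4]] := @correction_upto a (w a) Pa.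
exists q; split=> // s ss Ps s2 ws; apply: q4 => //; rewrite s2/=.
apply: leq_trans (ltnW ws); elim: s Ps {ss s2 ws} => [//|b s IH] /= /andP[Pb /IH].
by rewrite /frame_seq/= weight_cons -add1n; exact: leq_add.
Qed.

(** The shears are performed from the last index down. By [wmono], [q a] involves only coordinates
    of smaller index, still uncorrected at that stage, so it takes the same values in the current
    chart as in [c]. *)
Lemma corrected_chart : exists (q : 'I_n -> E -> R) (c' : chart R n M),
  [/\ smooth_chart c', cdom c' = U,
    forall p a, U p -> P a -> cmap c' p 0 a = cmap c p 0 a - q a (cmap c p),
    forall p, U p -> N p <-> forall a, P a -> cmap c' p 0 a = 0 &
    forall a, P a -> [/\ Cinfty (cimg c U) (q a), J 2 (q a \o cmap c) &
      forall s, pairwise (fun x y : 'I_n => x <= y)%N s -> all P s -> (2 <= size s)%N ->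
        (weight (frame_seq w Z s) < w a)%N -> forall m, U m -> N m ->
        lieDs (map Z s) (fun p => cmap c p 0 a - q a (cmap c p)) m = 0]].
Proof.
have ex (a : 'I_n) : exists q : E -> R, P a -> [/\ Cinfty (cimg c U) q, J 2 (q \o cmap c),
      forall x x' : E, (forall b, (w b < w a)%N -> x 0 b = x' 0 b) -> q x = q x' &
      forall s, pairwise (fun x y : 'I_n => x <= y)%N s -> all P s -> (2 <= size s)%N ->
        (weight (frame_seq w Z s) < w a)%N -> forall m, U m -> N m ->
        lieDs (map Z s) (fun p => cmap c p 0 a - q (cmap c p)) m = 0].
  have [Pa|nPa] := boolP (P a); last by exists (fun=> 0).
  by have [q Hq] := coordinate_correction Pa; exists q.
have [q qP] := choice ex.
have wlt (a b : 'I_n) : (w b < w a)%N -> (b < a)%N.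
  by move=> ba; rewrite ltnNge; apply/negP => /wmono; rewrite leqNgt ba.
have step k : (k <= n)%N -> exists c' : chart R n M, [/\ smooth_chart c', cdom c' = U &
    forall p b, U p -> cmap c' p 0 b =
      cmap c p 0 b - (if (n - k <= b)%N && P b then q b (cmap c p) else 0)].
  elim: k => [_|k IH kn].
    by exists c; split=> // p b _; rewrite subn0 leqNgt ltn_ord subr0.
  have [c1 [sc1 d1 m1]] := IH (ltnW kn).
  have an : (n - k.+1 < n)%N by rewrite ltn_subrL; case: (n) kn.
  pose a := Ordinal an.
  have aE (b : 'I_n) : (n - k.+1 <= b)%N = (n - k <= b)%N || (b == a).
    rewrite -val_eqE /=; apply/idP/orP => [|[|/eqP ->]]; lia.
  have na : (n - k <= a)%N = false by rewrite /=; lia.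
  have [Pa|nPa] := boolP (P a); last first.
    exists c1; split=> // p b Up; rewrite m1// aE; case: eqP => [->|_]; last by rewrite orbF.
    by rewrite orbT na /= (negbTE nPa).
  have [qa1 [sqa _] qa3 _] := qP a Pa.
  have qa (x x' : E) : (forall b, b != a -> x 0 b = x' 0 b) -> q a x = q a x'.
    by move=> H; apply: qa3 => b /wlt ba; apply: H; rewrite -val_eqE ltn_eqF.
  have qc1 p : U p -> q a (cmap c1 p) = q a (cmap c p).
    move=> Up; apply: qa3 => b /wlt ba; rewrite m1// ifF ?subr0//.
    by apply/negbTE; rewrite negb_and -ltnNge; move: ba => /=; lia.
  have [|c2 [sc2 d2 m2]] := shear_chart (q := q a) sc1 qa.
    rewrite d1; apply: eq_Cinfty (smooth_Cinfty sc1 oU sqa).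
      exact: open_cimg.
    by move=> _ [p [dp Up] <-] /=; rewrite cmapK// qc1.
  exists c2; split=> //; first by rewrite d2.
  move=> p b Up; rewrite m2 m1// aE; case: eqP => [->|_]; last by rewrite orbF subr0.
  by rewrite na /= Pa subr0 qc1.
have [c' [sc' d' m']] := step n (leqnn n).
have m'' p a : U p -> P a -> cmap c' p 0 a = cmap c p 0 a - q a (cmap c p).
  by move=> Up Pa; rewrite m'// subnn Pa.
exists q, c'; split=> //; last by move=> a /qP[].
move=> p Up; split=> [Np a Pa|H0].
  rewrite m''// (NP Up).1// sub0r.
  have [_ q2 _ _] := qP a Pa.
  by have /= -> := lie_order_vanish q2 isT Up Np; rewrite oppr0.
(* Induction on the weight: [x_a] equals [q_a], which sees only coordinates of smaller weight, and
   the transverse ones among them already vanish. So [q_a] takes its value at the projection to [N],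
   which is [0]. *)
apply/(NP Up) => a; move: {2}(w a) (leqnn (w a)) => k.
elim/ltn_ind: k a => k IH a wa Pa.
have := H0 a Pa; rewrite m''// => /eqP; rewrite subr_eq0 => /eqP ->.
have [_ q2 q3 _] := qP a Pa.
have Ip : cimg c U (dilation P 0 (cmap c p)).
  by apply: star; [exact: cimg_cmap|rewrite lexx ler01].
have /cimgP[d0 U0 E0] := Ip.
have N0 : N (cinv c (dilation P 0 (cmap c p))).
  by apply/(NP U0) => b Pb; rewrite E0 mxE Pb mul0r.
rewrite (q3 _ (dilation P 0 (cmap c p))).
  by have := lie_order_vanish q2 isT U0 N0; rewrite /= E0.
move=> b ba; rewrite mxE; case: ifP => // Pb; rewrite mul0r.
by apply: (IH (w b)) => //; apply: leq_trans wa.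
Qed.

End Correction.

(** * Privileged charts *)

Section StarlikeNeighbourhoods.
Context {R : realType} {n : nat} {M : smooth_manifold R n}.
Local Notation E := ('rV[R]_n).

Lemma starlike_nbhs (c : chart R n M) (P : pred 'I_n) (V : set M) m : open V -> V m ->
  V `<=` cdom c -> (forall a, P a -> cmap c m 0 a = 0) ->
  exists W, [/\ open W, W m, W `<=` V & starlike P (cimg c W)].
Proof.
move=> oV Vm Vc m0; set x0 : E := cmap c m.
have nI : nbhs x0 (cimg c V).
  apply: open_nbhs_nbhs; split; first exact: open_cimg.
  by apply: cimg_cmap => //; exact: Vc.
have /nbhs_cube[e e0 eI] := nI.
pose W := cdom c `&` cmap c @^-1` (ball x0 e).
have WP p : W p <-> cdom c p /\ forall a, `|cmap c p 0 a - x0 0 a| < e.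
  split=> [[dp [_ H1]]|[dp H1]]; split=> //.
    by move=> a; have := H1 0 a; rewrite /ball/= distrC.
  by split=> // i a; rewrite ord1 /ball/= distrC; exact: H1.
exists W; split.
- by apply: open_cpreim; exact: ball_open.
- by apply/WP; split=> [|a]; [exact: Vc|rewrite subrr normr0].
- by move=> p /WP[dp /eI/cimgP]; rewrite (cmapK dp) => -[].
move=> x t [p [dp /WP[_ H1] <-]] /andP[t0 t1].
have H2 a : `|dilation P t (cmap c p) 0 a - x0 0 a| < e.
  rewrite mxE; case: ifPn => [Pa|_]; last exact: H1.
  have := H1 a; rewrite [x0 0 a]m0// !subr0 normrM; apply: le_lt_trans.
  by rewrite ger0_norm// ler_piMl.
have /eI/cimgP[dq _ Eq] := H2.
by apply/cimgP; split=> //; apply/WP; rewrite Eq.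
Qed.

End StarlikeNeighbourhoods.

Section WeightedCharts.
Context {R : realType} {n r : nat} {M : smooth_manifold R n}.
Local Notation E := ('rV[R]_n).
Local Notation vf := (M -> @tvec R n M).
Variables (H : nat -> set M -> set vf) (N : set M).
Hypothesis hH : singular_lie_filtration r H.

Let hv : forall j U X, open U -> H j U X -> vfield U X.
Proof. by move=> j U X; exact: (slf_vfield hH). Qed.

Let hD : forall j, singular_distribution (H j) := slf_distribution hH.

Definition privileged_chart (w : 'I_n -> nat) (c : chart R n M) (Z : 'I_n -> vf) :=
  [/\ smooth_chart c,
      forall p, cdom c p -> N p <-> forall a, (0 < w a)%N -> cmap c p 0 a = 0,
      forall b, (0 < w b)%N -> H (w b) (cdom c) (Z b),
      forall a b m, (0 < w a)%N -> (0 < w b)%N -> cdom c m -> N m ->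
        lieD (Z a) (fun p => cmap c p 0 b) m = (a == b)%:R &
      forall a, lie_order H N (w a) (cdom c) (fun p => cmap c p 0 a)].

Lemma adapted_chart_starlike w c Z m0 : adapted_chart H N w c Z -> cdom c m0 -> N m0 ->
  exists c', [/\ adapted_chart H N w c' Z, cdom c' m0 &
    starlike (fun a => 0 < w a)%N (cimg c' (cdom c'))].
Proof.
move=> [sc NP HZ dZ spanZ] d0 N0.
have [U [oU Um Uc starU]] :=
  starlike_nbhs (cdom_open c) d0 (@subset_refl _ _) ((NP _ d0).1 N0).
have [c' [sc' d' m' _]] := restrict_chart sc oU Uc.
have m'' a : (fun p => cmap c' p 0 a) = (fun p => cmap c p 0 a).
  by apply/funext => p; rewrite m'.
exists c'; split.
- split=> //; rewrite ?d'.
  + by move=> p /Uc dp; rewrite (NP p dp) m'.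
  + by move=> b wb; exact: (sd_res (hD _) (cdom_open c) oU Uc (HZ b wb)).
  + by move=> a b m wa wb /Uc dm Nm; rewrite m''; exact: dZ.
  + by move=> j m v j0 /Uc; exact: spanZ.
- by rewrite d'.
- suff -> : cimg c' (cdom c') = cimg c U by [].
  rewrite d'; apply/seteqP; split=> [_ [p [_ Up] <-]|_ [p [_ Up] <-]].
    by rewrite m'; apply: cimg_cmap => //; exact: Uc.
  by rewrite -m'; apply: cimg_cmap => //; rewrite d'.
Qed.

(** By [frame_test] only sorted words of weight below [w a] matter. The empty word is settled by
    vanishing on [N], a single letter by duality as it differs from [a], and longer words by the
    correction. *)
Lemma exists_privileged_chart w c Z m0 : adapted_chart H N w c Z ->
  (forall a b : 'I_n, (a <= b)%N -> (w a <= w b)%N) -> cdom c m0 -> N m0 ->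
  exists c', cdom c' m0 /\ privileged_chart w c' Z.
Proof.
move=> ac wmono d0 N0.
have [c1 [ac1 d1 star]] := adapted_chart_starlike ac d0 N0.
have [sc NP HZ dZ spanZ] := ac1.
have oU := cdom_open c1.
have vZ b : (0 < w b)%N -> vfield (cdom c1) (Z b) by move=> wb; exact: hv (HZ b wb).
have [q [c' [sc' d' m' NP' Hq]]] := corrected_chart sc NP vZ dZ star wmono.
have sx a : smooth (cdom c1) (fun p => cmap c1 p 0 a) by exact: smooth_coord.
have sy a : smooth (cdom c1) (fun p => cmap c' p 0 a).
  by rewrite -d'; exact: smooth_coord.
(* The corrections lie in the square of the vanishing ideal, so first derivatives on [N], hence the
   duality, are unchanged. *)
have dZ' a b m : (0 < w a)%N -> (0 < w b)%N -> cdom c1 m -> N m ->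
    lieD (Z a) (fun p => cmap c' p 0 b) m = (a == b)%:R.
  move=> wa wb dm Nm; have [_ [sq Jq] _] := Hq b wb.
  rewrite (lieD_ext oU (vZ a wa) dm (sy b) (g := fun p => cmap c1 p 0 b - q b (cmap c1 p))).
    rewrite (lieD_sub oU (vZ a wa) dm (sx b) sq) dZ//.
    have := Jq [:: (1%N, Z a)] _ _ m dm Nm; rewrite /= => -> //; first by rewrite subr0.
    by split=> //; exact: vZ.
  by move=> p dp; exact: m'.
exists c'; rewrite d'; split=> //; split=> //; rewrite ?d'//.
move=> a; have [w0|wa] := posnP (w a); first by rewrite w0; apply/lie_order0.
have br := slf_bracket hH.
apply: (frame_test hv br oU HZ spanZ) => // s ss Ps ws m dm Nm.
have E1 : map snd (frame_seq w Z s) = map Z s by rewrite -map_comp.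
rewrite E1; case: s ss Ps ws {E1} => [|b [|b' s]] ss Ps ws /=.
- exact: (NP' m dm).1 Nm a wa.
- have /andP[wb _] := Ps; rewrite dZ'//.
  suff /negbTE -> : b != a by [].
  by apply: contraTneq ws => ->; rewrite /frame_seq/= weight_cons/= addn0 ltnn.
have vs : all_vfield (cdom c1) (map Z [:: b, b' & s]).
  have : all (fun b => 0 < w b)%N [:: b, b' & s] by exact: Ps.
  elim: [:: b, b' & s] => [//|x t IH] /= /andP[wx /IH]; split=> //; exact: vZ.
have [_ _ q4] := Hq a wa.
have := q4 [:: b, b' & s] ss Ps isT ws m dm Nm.
by rewrite -(lieDs_ext oU vs dm (sy a))// => p dp; exact: m'.
Qed.

Section Comparison.
Variables (w : 'I_n -> nat) (c : chart R n M) (Z : 'I_n -> vf).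
Hypothesis pc : privileged_chart w c Z.
Let P : pred 'I_n := fun a => (0 < w a)%N.
Let sc : smooth_chart c. Proof. by case: pc. Qed.
Let oc : open (cdom c) := cdom_open c.

Lemma wideal_lie_order i (V : set M) f : open V -> V `<=` cdom c ->
  weighted_ideal w (cimg c V) i (f \o cinv c) -> lie_order H N i V f.
Proof.
move=> oV Vc [k [s [h [h1 h2 h3]]]]; have [_ _ _ _ Hx] := pc.
have cV : cdom c `&` V = V by apply/seteqP; split=> [p []//|p Vp]; split=> //; exact: Vc.
apply: (lie_order_ext hv oV (f := fun p => \sum_(l < k) (h l (cmap c p) *
  \prod_(a < n) cmap c p 0 a ^+ s l a))).
  move=> p Vp; have dp := Vc p Vp; rewrite -h3; last exact: cimg_cmap.
  by rewrite /= cmapK.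
apply: (lie_order_sum hv) => // l _; apply: (lie_order_mull hv) => //.
  by have := smooth_comp_chart sc oV (h2 l); rewrite cV.
apply: lie_order_le (h1 l) _.
apply: (lie_order_prod hv) => // a; apply: (lie_order_exp hv) => //.
exact: (lie_order_restrict hv hD oc oV Vc).
Qed.

Lemma lie_order_wideal i (V : set M) f : open V -> V `<=` cdom c ->
  lie_order H N i V f -> weighted_ideal w (cimg c V) i (f \o cinv c).
Proof.
have [_ NP HZ dZ Hx] := pc.
elim/ltn_ind: i V f => -[|i] IH V f oV Vc Cf.
  by apply: wideal0; apply: smooth_Cinfty => //; case: Cf.
apply: wideal_local; first exact: open_cimg.
move=> _ [m [dm Vm] <-]; have sf : smooth V f by case: Cf.
have [Nm|nNm] := pselect (N m); last first.
  have [a [wa xa]] : exists a, P a /\ cmap c m 0 a <> 0.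
    apply: contrapT => H0; apply: nNm; apply/(NP m dm) => a wa.
    by apply: contrapT => xa; apply: H0; exists a.
  have sx : smooth V (fun p => cmap c p 0 a) by apply: smooth_sub (smooth_coord a sc).
  have [|W [oW Wm WV W0]] := smooth_neq0_near oV Vm sx; first exact/eqP.
  exists (cimg c W); split; [exact: open_cimg|exact: cimg_cmap|].
  apply: (wideal_off _ (a := a)) => //; first exact: open_cimg.
    by move=> _ [p [_ Wp] <-]; exact: W0.
  by apply: smooth_Cinfty => //; exact: smooth_sub sf.
have [V' [oV' V'm V'V starO]] := starlike_nbhs oV Vm Vc ((NP m dm).1 Nm).
have V'c : V' `<=` cdom c by exact: subset_trans Vc.
set O := cimg c V' in starO.
have oO : open O by exact: open_cimg.
have Cf' : lie_order H N i.+1 V' f by exact: (lie_order_restrict hv hD oV oV' V'V).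
have sf' : smooth V' f by case: Cf'.
exists O; split=> //; first exact: cimg_cmap.
set F := f \o cinv c.
have IHO j g : (j < i.+1)%N -> lie_order H N j V' g -> weighted_ideal w O j (g \o cinv c).
  by move=> ji; exact: IH.
have cF : Cinfty O F by exact: smooth_Cinfty.
have WF : weighted_ideal w O i F.
  by apply: IHO => //; exact: lie_order_le Cf'.
have vZ b : P b -> vfield V' (Z b).
  by move=> Pb; apply: vfield_sub (hv oc (HZ b Pb)).
have HZ' b : P b -> H (w b) V' (Z b).
  by move=> Pb; exact: (sd_res (hD _) oc oV' V'c (HZ b Pb)).
have Hx' a : lie_order H N (w a) V' (fun p => cmap c p 0 a).
  exact: (lie_order_restrict hv hD oc oV' V'c).
have sx' a : smooth V' (fun p => cmap c p 0 a) by case: (Hx' a).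
pose B := \max_a w a.
(* Solve [Z_b f = \sum_a (Z_b x_a) d_a f] for [d_b f], using that [Z_b x_a] is
   [delta_ab] on [N] and of order [w_a - w_b]. *)
have DF b : P b -> weighted_ideal w O (i.+1 - w b) ('D_(delta_mx 0 b) F).
  (* [B - w b] decreases as [w b] grows, so derivatives along heavier coordinates are settled
     first. *)
  move: {2}(B - w b)%N (erefl (B - w b)%N) => k.
  elim/ltn_ind: k b => k IHk b Bk Pb.
  have [ib|bi] := ltnP i (w b).
    rewrite (_ : i.+1 - w b = 0)%N; last by apply/eqP; rewrite subn_eq0.
    by apply: wideal0; exact: Cinfty_derive.
  have i0 : (0 < i)%N by exact: leq_trans Pb bi.
  pose zeta a p := lieD (Z b) (fun q => cmap c q 0 a) p - (P a && (a == b))%:R.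
  have szeta a : smooth V' (zeta a).
    by apply: smooth_subf => //; [apply: vfield_lieD => //; exact: vZ|exact: smooth_cst].
  apply: wideal_ext (_ : weighted_ideal w O _ (fun y => (lieD (Z b) f \o cinv c) y +
     \sum_a (-1) * ('D_(delta_mx 0 a) F y * (zeta a \o cinv c) y))).
    move=> y Oy; have [dy Vy Ey] := (cimgP c V' y).1 Oy.
    rewrite /= (lieD_coord oV' Vy (vZ b Pb) sf' sc dy) Ey -big_split/=.
    rewrite (bigD1 b)//= big1 => [|a /negbTE ab].
      by rewrite /zeta Pb eqxx/=; ring.
    by rewrite /zeta ab andbF/=; ring.
  apply: wideal_add.
    apply: IHO; first by rewrite ltn_subrL; apply/andP; split.
    exact: (lie_order_lieD hv oV' Pb Cf' (HZ' b Pb)).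
  apply: wideal_sum => a _; apply: wideal_mull => //; first exact: Cinfty_cst.
  (* Known from order [i] alone. This is one short of the goal when [w a = w b], where the vanishing
     of [zeta a] on [N] makes up for it. *)
  have Wa := wideal_derive a oO WF.
  have cz : Cinfty O (zeta a \o cinv c) by exact: smooth_Cinfty.
  have [wab|wba|wab] := ltngtP (w a) (w b).
  - have : weighted_ideal w O (i - w a + 0) (fun y => 'D_(delta_mx 0 a) F y * (zeta a \o cinv c) y).
      by apply: wideal_mul => //; exact: wideal0.
    by apply: wideal_le; lia.
  - have Pa : P a by exact: leq_ltn_trans wba.
    have aB : (w a <= B)%N by exact: leq_bigmax.
    have Da : weighted_ideal w O (i.+1 - w a) ('D_(delta_mx 0 a) F).
      by apply: (IHk (B - w a)%N) => //; lia.
    (* The minimum with [i] keeps the order within reach of the induction; when it equals [i], the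
       product still suffices because [w b > 0]. *)
    have Wz : weighted_ideal w O (minn (w a - w b) i) (zeta a \o cinv c).
      apply: IHO; first by rewrite ltnS geq_minr.
      apply: lie_order_le (geq_minl _ _) _.
      apply: (lie_order_ext hv oV') (lie_order_lieD hv oV' Pb (Hx' a) (HZ' b Pb)).
      move=> p _; rewrite /zeta (_ : a == b = false) ?andbF ?subr0//.
      by apply: contraTF wba => /eqP ->; rewrite ltnn.
    apply: wideal_le (wideal_mul oO Da Wz).
    have wb : (0 < w b)%N by []; lia.
  - have Pa : P a by rewrite /P wab.
    have Wz : weighted_ideal w O 1 (zeta a \o cinv c).
      apply: IHO => //; apply: lie_order1 => // p /V'c dp Np.
      by rewrite /zeta Pa/= dZ// eq_sym subrr.
    apply: wideal_le (wideal_mul oO Wa Wz); lia.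
apply: (wideal_hadamard oO starO cF) => // x Ox.
have O0 : O (dilation P 0 x) by apply: starO => //; rewrite lexx ler01.
have [d0 V0 E0] := (cimgP c V' _).1 O0.
rewrite /F/=; apply: (lie_order_vanish Cf') => //.
by apply/(NP _ d0) => a Pa; rewrite E0 mxE ifT// mul0r.
Qed.

Lemma lie_order_widealP i (V : set M) f : open V -> V `<=` cdom c ->
  lie_order H N i V f <-> weighted_ideal w (cimg c V) i (f \o cinv c).
Proof.
by move=> oV Vc; split; [exact: lie_order_wideal|exact: wideal_lie_order].
Qed.

End Comparison.
End WeightedCharts.

(** * The weighted atlas *)

Section Atlas.
Context {R : realType} {n r : nat} {M : smooth_manifold R n}.
Local Notation E := ('rV[R]_n).
Local Notation vf := (M -> @tvec R n M).

Lemma cimg_dom (c : chart R n M) (U : set M) : cimg c (cdom c `&` U) = cimg c U.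
Proof. by rewrite /cimg setIA setIid. Qed.

Lemma overlap_preimage (c c' : chart R n M) (V : set E) : V `<=` overlap c' c ->
  cimg c (cdom c' `&` (cdom c `&` cmap c' @^-1` V)) =
    overlap c c' `&` transition c c' @^-1` V.
Proof.
move=> _; apply/seteqP; split=> [_ [p [dp [d'p [_ Vp]]] <-]|_ [[p [dp d'p] <-] Vp]].
  by split; [exists p|rewrite /preimage/= /transition/= cmapK].
apply: cimg_cmap => //; split=> //; split=> //.
by move: Vp; rewrite /preimage/= /transition/= cmapK.
Qed.

Lemma weighted_atlas_transfer w (A : set (chart R n M)) c c' (W : set M) i f :
  weighted_atlas w A -> A c -> A c' -> open W -> W `<=` cdom c -> W `<=` cdom c' ->
  weighted_ideal w (cimg c' W) i (f \o cinv c') ->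
  weighted_ideal w (cimg c W) i (f \o cinv c).
Proof.
move=> [_ _ trA] Ac Ac' oW Wc Wc' Wf.
have W1 : cimg c' W `<=` overlap c' c.
  by move=> _ [p [dp Wp] <-]; exists p => //; split=> //; exact: Wc.
have := trA c c' Ac Ac' i _ _ (open_cimg (c := c') oW) W1 Wf.
move=> /(@wideal_sub _ _ _ _ (cimg c W)) Wt.
apply: wideal_ext (Wt _) => [_ [p [dp Wp] <-] /=|_ [p [dp Wp] <-]].
  by rewrite /transition/= (cmapK dp) cmapK//; exact: Wc'.
split; first by exists p => //; split=> //; exact: Wc'.
by rewrite /preimage/= /transition/= cmapK//; apply: cimg_cmap => //; exact: Wc'.
Qed.

Variables (H : nat -> set M -> set vf) (N : set M) (w : 'I_n -> nat).
Hypotheses (hH : singular_lie_filtration r H) (cN : closed N)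
  (onN : forall m, N m -> exists c Z, cdom c m /\ privileged_chart H N w c Z)
  (offN : forall m, ~ N m -> exists a, (0 < w a)%N).

Let hv : forall j U X, open U -> H j U X -> vfield U X.
Proof. by move=> j U X; exact: (slf_vfield hH). Qed.

Let hD : forall j, singular_distribution (H j) := slf_distribution hH.

(* The maximal weighted atlas, described by the ideals it has to induce. *)
Definition weighted_chart : set (chart R n M) := [set c | smooth_chart c /\
  forall i V f, open V -> V `<=` cdom c ->
    (lie_order H N i V f <-> weighted_ideal w (cimg c V) i (f \o cinv c))].

(* Away from [N] both filtrations are trivial as soon as a coordinate of positive
   weight does not vanish. *)
Lemma weighted_chart_cover m : exists2 c, weighted_chart c & cdom c m.
Proof.
have [Nm|nNm] := pselect (N m).
  have [c [Z [dm pc]]] := onN Nm; exists c => //; split; first by case: pc.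
  by move=> i V f oV Vc; exact: (lie_order_widealP hH pc).
have [a wa] := offN nNm; have [c0 Ac0 dm] := atlas_cover m.
(* A shear by a constant moves the [a]-th coordinate of [m] to [1]. *)
have [||c [sc d1 m1]] := shear_chart (a := a) (q := fun=> cmap c0 m 0 a - 1)
    (smooth_chart_atlas Ac0) _ _; [by []|exact: Cinfty_cst|].
have xm : cmap c m 0 a != 0 by rewrite m1 eqxx opprB addrC subrK oner_neq0.
have oV : open (cdom c `&` ~` N) by apply: openI; [exact: cdom_open|rewrite openC].
have sx : smooth (cdom c `&` ~` N) (fun p => cmap c p 0 a).
  by apply: smooth_sub (smooth_coord a sc) => p [].
have [|W [oW Wm WV W0]] := smooth_neq0_near oV _ sx xm; first by rewrite d1.
have [|c' [sc' d' m' _]] := restrict_chart sc oW; first by move=> p /WV[].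
exists c'; last by rewrite d'.
split=> // i V f oV' Vc; have offV p : V p -> ~ N p.
  by move=> /Vc; rewrite d' => /WV[].
split=> [[sf _]|Wf].
  apply: (wideal_off _ (a := a)) => //.
  - exact: open_cimg.
  - by move=> _ [p [dp Vp] <-]; rewrite m' W0// -d'.
  - exact: smooth_Cinfty.
apply: (lie_order_off H i oV' offV).
have := Cinfty_smooth sc' oV' (wideal_Cinfty (open_cimg (c := c') oV') Wf).
by apply: smooth_sub => p Vp; split=> //; exact: Vc.
Qed.

(** In both charts the weighted ideals express the same intrinsic ideals, so the transition function
    preserves them. *)
Lemma weighted_chart_atlas : weighted_atlas w weighted_chart.
Proof.
split; [by move=> c []|exact: weighted_chart_cover|].
move=> c c' [sc Wc] [sc' Wc'] i V g oV Vo Wg.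
pose U := cdom c' `&` (cdom c `&` cmap c' @^-1` V).
have oU : open U.
  by rewrite /U setICA; apply: openI; [exact: cdom_open|exact: open_cpreim].
have Uc : U `<=` cdom c by move=> p [_ []].
have Uc' : U `<=` cdom c' by move=> p [].
rewrite -(overlap_preimage Vo).
have : weighted_ideal w (cimg c' U) i ((g \o cmap c') \o cinv c').
  apply: wideal_ext (wideal_sub _ Wg) => [_ [p [dp _] <-] /=|_ [p [_ [_ [_ Vp]]] <-]//].
  by rewrite cmapK.
by move=> /(Wc' _ _ _ oU Uc') /(Wc _ _ _ oU Uc).
Qed.

(** Near each of its points a chart of the larger atlas is compared with a weighted chart, so it
    induces the right ideals locally, and both sides are local. *)
Lemma weighted_chart_maximal B : weighted_atlas w B -> weighted_chart `<=` B ->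
  B = weighted_chart.
Proof.
move=> wB AB; have [Bs _ _] := wB; apply/seteqP; split=> // b Bb.
split; first exact: Bs.
move=> i V f oV Vb; split=> Hf.
  apply: wideal_local; first exact: open_cimg.
  move=> _ [m [dm Vm] <-]; have [c Ac cm] := weighted_chart_cover m.
  have oW : open (V `&` cdom c) by apply: openI => //; exact: cdom_open.
  exists (cimg b (V `&` cdom c)); split; [exact: open_cimg|exact: cimg_cmap|].
  apply: (weighted_atlas_transfer wB Bb (AB _ Ac)) => //; try by move=> p [/Vb].
  apply/(Ac.2 _ _ _ oW (@subIsetr _ _ _)).
  by apply: (lie_order_restrict hv hD oV oW) Hf => p [].
apply: (lie_order_local hD oV) => m Vm; have [c Ac cm] := weighted_chart_cover m.
have oW : open (V `&` cdom c) by apply: openI => //; exact: cdom_open.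
exists (V `&` cdom c); split=> //.
apply/(Ac.2 _ _ _ oW (@subIsetr _ _ _)).
apply: (weighted_atlas_transfer wB (AB _ Ac) Bb) => //; try by move=> p [].
  by move=> p [/Vb].
by apply: wideal_sub Hf; apply: sub_cimg => p [].
Qed.

Lemma weighted_chart_ideal i U f : open U ->
  lie_order H N i U f <-> weighting_ideal w weighted_chart i U f.
Proof.
move=> oU; split=> [Cf|[sf Wf]].
  split; first by case: Cf.
  move=> c [sc Wc]; rewrite -[_ @` _]/(cimg c U) -cimg_dom.
  have oV : open (cdom c `&` U) by apply: openI => //; exact: cdom_open.
  apply/(Wc _ _ _ oV (@subIsetl _ _ _)).
  by apply: (lie_order_restrict hv hD oU oV) Cf => p [].
apply: (lie_order_local hD oU) => m Um; have [c Ac cm] := weighted_chart_cover m.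
have oV : open (cdom c `&` U) by apply: openI => //; exact: cdom_open.
exists (cdom c `&` U); split=> //.
apply/(Ac.2 _ _ _ oV (@subIsetl _ _ _)).
by rewrite cimg_dom; exact: Wf.
Qed.

(** The order [1] recovers [N]: off [N] the constant [1] has order [1], whereas the weighted ideal
    of order [1] vanishes wherever all coordinates of positive weight do. *)
Lemma weighted_chart_sub c m : weighted_chart c -> cdom c m ->
  N m <-> forall a, (0 < w a)%N -> cmap c m 0 a = 0.
Proof.
move=> [sc Wc] dm; split=> [Nm a wa|x0].
  suff Cx : lie_order H N (w a) (cdom c) (fun p => cmap c p 0 a).
    exact: lie_order_vanish Cx wa dm Nm.
  apply/(Wc _ _ _ (cdom_open c)) => //.
  apply: wideal_ext (wideal_coord w _ a) => x /cimgP[_ _ /= ->]//.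
apply: contrapT => nNm.
have oV : open (cdom c `&` ~` N) by apply: openI; [exact: cdom_open|rewrite openC].
have /(Wc 1%N _ _ oV) : lie_order H N 1 (cdom c `&` ~` N) (fun=> 1).
  by apply: lie_order_off => // [p []//|]; exact: smooth_cst.
case=> [p []//|k [s [h [h1 _ h3]]]].
have Im : cimg c (cdom c `&` ~` N) (cmap c m) by exact: cimg_cmap.
have := h3 _ Im; rewrite /= big1 => [/eqP|l _]; first by rewrite oner_eq0.
have [a /andP[sa wa]] : exists a, (0 < s l a)%N && (0 < w a)%N.
  apply: contrapT => H0; have := h1 l; rewrite big1// => a _.
  have [->|sa] := posnP (s l a); first by rewrite mul0n.
  have [->|wa] := posnP (w a); first by rewrite muln0.
  by case: H0; exists a; rewrite sa.
by rewrite (bigD1 a)//= x0// expr0n eqn0Ngt sa mul0r mulr0.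
Qed.

Lemma weighting_along : (forall a, (w a <= r)%N) -> is_weighting_along r N (lie_ideal H N).
Proof.
move=> wr; exists w, weighted_chart; split=> //.
- by split; [exact: weighted_chart_atlas|exact: weighted_chart_maximal].
- move=> i U f oU; rewrite (lie_ideal_order N hv)//; exact: weighted_chart_ideal.
- by move=> c Wc m; exact: weighted_chart_sub.
Qed.

End Atlas.

(** * The normal filtration *)

Section NormalFiltration.
Context {R : realType} {n r d : nat} {M : smooth_manifold R n}.
Local Notation E := ('rV[R]_n).
Local Notation vf := (M -> @tvec R n M).
Variables (H : nat -> set M -> set vf) (N : set M).
Hypotheses (hH : singular_lie_filtration r H) (hH0 : zero_distribution (H 0%N))
  (cN : closed N) (hNsub : embedded_submanifold d N) (hNclean : clean H N).

Let hv : forall j U X, open U -> H j U X -> vfield U X.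
Proof. by move=> j U X; exact: (slf_vfield hH). Qed.

Let hD : forall j, singular_distribution (H j) := slf_distribution hH.

Lemma distribution_sum D U (I : Type) (s : seq I) (a : I -> R) (X : I -> vf) :
  singular_distribution D -> open U -> (forall j, D U (X j)) ->
  D U (fun m => \sum_(j <- s) a j *: X j m).
Proof.
move=> sD oU DX; elim: s => [|j s IH].
  by apply: (sd_ext sD oU (sd_zero sD oU)) => m _; rewrite big_nil.
apply: (sd_ext sD oU (sd_add sD oU (sd_scale sD oU (smooth_cst U (a j)) (DX j)) IH)) => m _.
by rewrite big_cons.
Qed.

Lemma normal_class_eq m u v : tangent_sub N m (u - v) -> normal_class N m u = normal_class N m v.
Proof.
move=> uv; apply/seteqP; split=> x xu.
  by have := tangent_subD xu uv; rewrite addrA subrK.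
have := tangent_subD xu (tangent_subZ (-1) uv).
by rewrite scaleN1r opprB addrA subrK.
Qed.

Lemma tangent_sub_vanish U f m v : open U -> U m -> N m -> vanishing_ideal N U f ->
  tangent_sub N m v -> v f = 0.
Proof.
move=> oU Um Nm [sf f0] [tv Hv]; rewrite -(tangent_cst tv 0); apply: Hv.
- exact: smooth_nearI sf.
- exact: smooth_near_cst.
- rewrite -nbhs_nearE nbhsE; exists U => // p Up Np; exact: f0.
Qed.

Lemma tangent_vanish_sq U f m v : open U -> U m -> N m -> vanishing_ideal_sq N U f ->
  tangent m v -> v f = 0.
Proof.
move=> oU Um Nm [k [g [h [Ig Ih fE]]]] tv.
have sg l : smooth_near m (g l) by apply: smooth_nearI oU Um _; case: (Ig l).
have sh l : smooth_near m (h l) by apply: smooth_nearI oU Um _; case: (Ih l).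
have sgh l : smooth_near m (fun p => g l p * h l p) by exact: smooth_near_mul.
rewrite -(tangent_near tv (f := fun p => \sum_(l < k) g l p * h l p)).
- rewrite (tangent_sum tv) => [|l _]; last exact: sgh.
  rewrite big1// => l _; rewrite (tangent_mul tv)//.
  by rewrite (Ig l).2// (Ih l).2// !mul0r addr0.
- exact: smooth_near_sum.
- by rewrite -nbhs_nearE nbhsE; exists U => // p Up /=; rewrite fE.
Qed.

Lemma sum_space_frame w c Z m i v : adapted_chart H N w c Z -> cdom c m -> N m ->
  sum_space (tangent_sub N m) (values_at (H i) m) v ->
  exists k : 'I_n -> R, tangent_sub N m (v - \sum_(b | (0 < w b <= i)%N) k b *: Z b m).
Proof.
move=> [_ _ _ _ spanZ] dm Nm; have [->|i0] := posnP i.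
  rewrite (sum_space0 N hH hH0) => tv; exists (fun=> 0); rewrite big1 ?subr0// => b.
  by move=> _; rewrite scale0r.
move=> [a [b [ta vb ->]]]; have [k Hk] := spanZ i m b i0 dm Nm vb.
by exists k; rewrite -addrA; exact: tangent_subD.
Qed.

Lemma frame_sum_space w c Z m i : adapted_chart H N w c Z -> cdom c m ->
  forall k : 'I_n -> R, sum_space (tangent_sub N m) (values_at (H i) m)
    (\sum_(b | (0 < w b <= i)%N) k b *: Z b m).
Proof.
move=> [_ _ HZ _ _] dm k; exists 0, (\sum_(b | (0 < w b <= i)%N) k b *: Z b m).
split; [exact: tangent_sub0| |by rewrite add0r].
pose X b p := if (0 < w b <= i)%N then Z b p else 0.
exists (cdom c), (fun p => \sum_b k b *: X b p); split=> //.
- exact: cdom_open.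
- apply: distribution_sum => // [|b]; first exact: cdom_open.
  rewrite /X; case: (boolP (0 < w b <= i)%N) => [/andP[wb bi]|_]; last first.
    exact: (sd_zero (hD i) (cdom_open c)).
  move: (HZ b wb); move: bi => /subnK <-; elim: (i - w b)%N => [//|j IH] /IH.
  exact: (slf_decr hH (cdom_open c)).
- by rewrite [LHS]big_mkcond; apply: eq_bigr => b _; rewrite /X; case: ifP; rewrite ?scaler0.
Qed.

Lemma normal_frame w c Z i : adapted_chart H N w c Z ->
  exists (k : nat) (X : 'I_k -> vf), (forall j, vfield (cdom c) (X j)) /\
    forall m, cdom c m -> N m ->
      (forall a : 'I_k -> R, tangent_sub N m (\sum_(j < k) a j *: X j m) ->
         forall j, a j = 0) /\
      lie_normal_filtration H N i m = normal_class N m @` lin_span (fun j => X j m).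
Proof.
move=> ac; have [sc NP HZ dZ _] := ac.
pose Q := [pred b : 'I_n | (0 < w b <= i)%N].
have QP (j : 'I_#|Q|) : (0 < w (enum_val j) <= i)%N by exact: (enum_valP j).
have sumE (F : 'I_n -> R) m : \sum_(b | (0 < w b <= i)%N) F b *: Z b m =
    \sum_(j < #|Q|) F (enum_val j) *: Z (enum_val j) m.
  by rewrite (big_enum_val (A := Q) (fun b => F b *: Z b m)).
exists #|Q|, (fun j => Z (enum_val j)); split.
  by move=> j; apply: hv (HZ _ _); [exact: cdom_open|have /andP[] := QP j].
move=> m dm Nm; split.
  move=> a /(tangent_subP sc NP _ dm Nm)[_ H0] j; have /andP[wj _] := QP j.
  have := H0 _ wj; rewrite tvec_sum (bigD1 j)//= tvecZ.
  rewrite -[Z _ _ _]/(lieD (Z (enum_val j)) (fun p => cmap c p 0 (enum_val j)) m).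
  rewrite dZ// eqxx mulr1 big1 ?addr0// => l lj; rewrite tvecZ.
  rewrite -[Z _ _ _]/(lieD (Z (enum_val l)) (fun p => cmap c p 0 (enum_val j)) m).
  have /andP[wl _] := QP l.
  by rewrite dZ// (inj_eq enum_val_inj) (negbTE lj) mulr0.
rewrite /lie_normal_filtration; apply/seteqP; split=> [_ [v Sv <-]|_ [_ [a ->] <-]].
  have [k Hk] := sum_space_frame ac dm Nm Sv.
  exists (\sum_(b | (0 < w b <= i)%N) k b *: Z b m).
    by exists (fun j => k (enum_val j)); rewrite sumE.
  by apply/esym; exact: normal_class_eq.
pose k (b : 'I_n) := \sum_(j < #|Q| | enum_val j == b) a j.
exists (\sum_(b | (0 < w b <= i)%N) k b *: Z b m); first exact: (frame_sum_space i ac dm k).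
congr (normal_class N m _); rewrite sumE; apply: eq_bigr => j _; congr (_ *: _).
by rewrite /k (big_pred1 j)// => l; rewrite (inj_eq enum_val_inj).
Qed.

(** Locally [f] equals some [g] of order [i.+1] modulo the square of the vanishing ideal. Sections
    of [H_(-i)] kill [g] on [N], and tangent vectors at [N] kill the square. *)
Lemma conormal_annihilates i U f : (0 < i)%N -> open U -> vanishing_ideal N U f ->
  in_conormal_image N (lie_ideal H N i.+1) U f ->
  annihilates N U (lie_normal_filtration H N i) f.
Proof.
move=> i0 oU If Cf m Um Nm _ [u [a [b [ta vb uE]] <-]] v vu.
have If0 := tangent_sub_vanish oU Um Nm If.
suff b0 : b f = 0.
  have -> : v = (v - u) + (a + b) by rewrite -uE subrK.
  by rewrite tvecD (If0 _ vu) tvecD (If0 _ ta) b0 !addr0.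
have [V [oV Vm VU [g Cg fg]]] := Cf m Um.
have [W [X [oW Wm HX bE]]] := vb.
have oVW : open (V `&` W) by exact: openI.
have tb := values_at_tangent hH vb.
have [sg _] := (lie_ideal_order N hv _ _ oV).1 Cg.
have sf : smooth_near m f by apply: smooth_nearI oU Um _; case: If.
have sgm : smooth_near m g by apply: smooth_nearI oV Vm sg.
have Cg' : lie_order H N i.+1 (V `&` W) g.
  have := (lie_ideal_order N hv _ _ oV).1 Cg.
  by apply: (lie_order_restrict hv hD oV oVW) => p [].
have bg : b g = 0.
  have [_ /(_ [:: (i, X)])] := Cg'; rewrite bE /=; apply=> //.
  - split=> //; exact: (sd_res (hD i) oW oVW (@subIsetr _ _ _) HX).
  - by rewrite weight_cons /= addn0.
have := tangent_vanish_sq oV Vm Nm fg tb.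
by rewrite (tangent_sub_fun tb)// bg subr0.
Qed.

(** By Hadamard's lemma [f] is a sum of terms [x_a G_a], and [Z_b f = G_b] on [N]. So [G_a] vanishes
    on [N] for [w a <= i], which puts these terms in the square of the vanishing ideal; the others
    have order [i.+1]. *)
Lemma annihilates_conormal i U f (w : 'I_n -> nat) : (0 < i)%N -> open U ->
  (forall m, N m -> exists c Z, cdom c m /\ privileged_chart H N w c Z) ->
  vanishing_ideal N U f -> annihilates N U (lie_normal_filtration H N i) f ->
  in_conormal_image N (lie_ideal H N i.+1) U f.
Proof.
move=> i0 oU onN [sf f0] af m Um.
have [Nm|nNm] := pselect (N m); last first.
  have oV : open (U `&` ~` N) by apply: openI => //; rewrite openC.
  have sV : smooth (U `&` ~` N) f by apply: smooth_sub sf => p [].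
  (* Off [N] every smooth function has every order, so [f] represents itself. *)
  exists (U `&` ~` N); split=> //.
  exists f.
    by apply/(lie_ideal_order N hv _ _ oV); apply: lie_order_off => // p [].
  by exists 0%N, (fun _ _ => 0), (fun _ _ => 0); split=> [[]|[]|p _] //; rewrite subrr big_ord0.
have [c [Z [dm pc]]] := onN m Nm; have [sc NP HZ dZ Cx] := pc.
pose P : pred 'I_n := fun a => (0 < w a)%N.
have oUc : open (U `&` cdom c) by apply: openI => //; exact: cdom_open.
have [V [oV Vm VUc starV]] :=
  starlike_nbhs oUc (conj Um dm) (@subIsetr _ _ _) ((NP m dm).1 Nm).
have VU p : V p -> U p by move=> /VUc[].
have Vc p : V p -> cdom c p by move=> /VUc[].
have oI : open (cimg c V) by exact: open_cimg.
have sfV : smooth V f by exact: smooth_sub sf.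
have cF : Cinfty (cimg c V) (f \o cinv c) by exact: smooth_Cinfty.
have sx a : smooth V (fun p => cmap c p 0 a).
  by apply: smooth_sub (smooth_coord a sc).
have [G [sG fE]] : exists G : 'I_n -> E -> R, (forall a, smooth V (G a \o cmap c)) /\
    forall p, V p -> f p = \sum_(a | P a) cmap c p 0 a * G a (cmap c p).
  exists (fun a => radial_integral P 0 ('D_(delta_mx 0 a) (f \o cinv c))); split=> [a|p Vp].
    have cG := Cinfty_radial oI starV 0 (Cinfty_derive a cF).
    by apply: smooth_sub (smooth_comp_chart sc oV cG) => p Vp; split=> //; exact: Vc.
  have Ip : cimg c V (cmap c p) by apply: cimg_cmap => //; exact: Vc.
  have := hadamard oI starV cF Ip; rewrite /= (cmapK (Vc p Vp)) => ->.
  have /cimgP[d0 V0 E0] : cimg c V (dilation P 0 (cmap c p)).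
    by apply: starV => //; rewrite lexx ler01.
  rewrite (f0 _ (VU _ V0)) ?add0r//.
  by apply/(NP _ d0) => a Pa; rewrite E0 mxE ifT// mul0r.
have G0 b p : P b -> (w b <= i)%N -> V p -> N p -> G b (cmap c p) = 0.
  move=> Pb bi Vp Np; have vZ : vfield V (Z b).
    by apply: vfield_sub (hv (cdom_open c) (HZ b Pb)).
  have Zf : lieD (Z b) f p = 0.
    apply: (af p (VU p Vp) Np (normal_class N p (Z b p))).
      exists (Z b p) => //; exists 0, (Z b p); split; last by rewrite add0r.
        exact: tangent_sub0.
      apply: (values_at_le hH bi); exists (cdom c), (Z b); split=> //.
      - exact: cdom_open.
      - exact: Vc.
      - exact: HZ.
    by rewrite /normal_class/= subrr; exact: tangent_sub0.
  suff <- : lieD (Z b) f p = G b (cmap c p) by [].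
  rewrite (lieD_ext oV vZ Vp sfV fE).
  rewrite (lieD_sum oV vZ _ Vp) => [|a _]; last first.
    by apply: smooth_mul => //; exact: sG.
  have E1 a : P a -> lieD (Z b) (fun q => cmap c q 0 a * G a (cmap c q)) p =
      G a (cmap c p) * (b == a)%:R.
    move=> Pa; rewrite (lieD_mul oV vZ Vp (sx a) (sG a)).
    by rewrite ((NP p (Vc p Vp)).1 Np a Pa) mul0r add0r dZ//; exact: Vc.
  rewrite (eq_bigr _ E1) (bigD1 b Pb)/= eqxx mulr1 big1 ?addr0// => a /andP[_ /negbTE ab].
  by rewrite eq_sym ab mulr0.
pose T a := P a && (w a <= i)%N.
exists V; split=> //.
exists (fun p => \sum_(a | P a && ~~ (w a <= i)%N) cmap c p 0 a * G a (cmap c p)).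
  apply/(lie_ideal_order N hv _ _ oV).
  apply: (lie_order_sum hv) => // a /andP[Pa]; rewrite -ltnNge => ia.
  apply: lie_order_ext (_ : lie_order H N i.+1 V (fun p => G a (cmap c p) * cmap c p 0 a)) => //.
    by move=> p _; rewrite mulrC.
  apply: (lie_order_mull hv) => //; first exact: sG.
  apply: lie_order_le ia _.
  by apply: (lie_order_restrict hv hD (cdom_open c) oV) => // p; exact: Vc.
exists n, (fun a p => if T a then cmap c p 0 a else 0),
  (fun a p => if T a then G a (cmap c p) else 0); split.
- move=> a; case Ta: (T a); last by split=> //; exact: smooth_cst.
  have /andP[Pa _] := Ta; split=> // p Vp Np; exact: (NP p (Vc p Vp)).1.
- move=> a; case Ta: (T a); last by split=> //; exact: smooth_cst.
  have /andP[Pa ai] := Ta; split=> [|p Vp Np]; [exact: sG|exact: G0].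
- move=> p Vp; rewrite fE// (bigID (fun a => w a <= i)%N)/= addrK big_mkcond.
  by apply: eq_bigr => a _; rewrite -/(T a); case: (T a); rewrite ?mul0r.
Qed.

Lemma clean_privileged m1 m : N m1 -> N m -> exists c Z,
  cdom c m /\ privileged_chart H N (fun a : 'I_n => clean_weight hNclean a) c Z.
Proof.
move=> N1 Nm; have [c [Z [dm ac]]] := exists_adapted_chart hH hH0 hNsub hNclean N1 Nm.
have [c' [d'm pc]] := exists_privileged_chart hH ac (clean_weight_mono hH hNsub hNclean N1) dm Nm.
by exists c', Z.
Qed.

Lemma normal_filtration : normal_filtration_of r N (lie_ideal H N) (lie_normal_filtration H N).
Proof.
split.
- move=> i m ri Nm; rewrite /lie_normal_filtration /normal_space; congr image.
  apply/seteqP; split=> v; first exact: (sum_space_tangent hH).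
  move=> tv; exists 0, v; split; [exact: tangent_sub0| |by rewrite add0r].
  exact: (values_at_top hH ri tv).
- move=> m Nm; rewrite /lie_normal_filtration (sum_space0 N hH hH0).
  apply/seteqP; split=> [_ [v tv <-]|_ ->].
    by apply: normal_class_eq; rewrite subr0.
  by exists 0 => //; exact: tangent_sub0.
- move=> i m Nm _ [v Sv <-]; exists v => //; exact: (sum_space_le hH (leqnSn i)) Sv.
- move=> i m0 N0; have [c [Z [dm ac]]] := exists_adapted_chart hH hH0 hNsub hNclean N0 N0.
  exists (cdom c); split=> //; first exact: cdom_open.
  exact: normal_frame ac.
- move=> i U f i0 oU If; split; first exact: conormal_annihilates.
  have [[m1 N1]|N0] := pselect (exists m, N m).
    apply: (annihilates_conormal i0 oU _ If) => m Nm; exact: clean_privileged N1 Nm.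
  move=> af; apply: (annihilates_conormal (w := fun=> 0%N) i0 oU _ If af) => m Nm.
  by case: N0; exists m.
Qed.

End NormalFiltration.

Theorem theorem4p1 (R : realType) (n r d : nat) (M : smooth_manifold R n)
    (H : nat -> set M -> set (M -> @tvec R n M)) (N : set M)
    (hH : singular_lie_filtration r H)
    (hH0 : zero_distribution (H 0%N))
    (hNclosed : closed N)
    (hNsub : embedded_submanifold d N)
    (hNclean : clean H N)
    (hNcodim : d = n -> N = setT) :
  is_weighting_along r N (lie_ideal H N) /\
  normal_filtration_of r N (lie_ideal H N) (lie_normal_filtration H N).
Proof.
split; last exact: normal_filtration hH hH0 hNclosed hNsub hNclean.
(* With all weights [0] the weighted charts would lie in [N], so a point off [N] requires a positive
   weight; [hNcodim] excludes codimension [0] there. *)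
have dn m : ~ N m -> (d < n)%N.
  move=> nNm; have [+ _] := hNsub; rewrite leq_eqVlt => /orP[/eqP dn|//].
  by case: nNm; rewrite hNcodim.
have [[m1 N1]|N0] := pselect (exists m, N m).
  apply: (@weighting_along _ _ _ _ _ _ (fun a : 'I_n => clean_weight hNclean a)) => //.
  - by move=> m Nm; exact: (clean_privileged hH hH0 hNsub hNclean N1 Nm).
  (* The last coordinate is transverse as soon as [d < n]. *)
  - move=> m /dn dn'; have n1 : (n.-1 < n)%N by lia.
    exists (Ordinal n1); rewrite (clean_weight_gt0 hH hH0 hNsub hNclean N1) /=; lia.
  - by move=> a; exact: (clean_weight_le_r hH hNsub hNclean N1).
(* For empty [N] it suffices that the weights be positive; the minimum keeps the bound [w a <= r]
   even for [r = 0]. *)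
apply: (@weighting_along _ _ _ _ _ _ (fun a : 'I_n => minn 1 r)) => //.
- by move=> m Nm; case: N0; exists m.
- move=> m /dn dn'; have n0 : (0 < n)%N by lia.
  (* If [r = 0], then [H_0] consists of all vector fields and is zero, which a coordinate field at
     [m] contradicts. *)
  exists (Ordinal n0); rewrite leq_min /= lt0n; apply/eqP => r0.
  have [c Ac dm] := atlas_cover m; have sc := smooth_chart_atlas Ac.
  have oc := cdom_open c.
  have r0' : (r <= 0)%N by rewrite r0.
  have /(slf_top hH _ r0' oc) : vfield (cdom c) (coord_vec c (Ordinal n0)) by exact: coord_vfield.
  move=> /(hH0 _ _ oc) /(_ m dm) Z0.
  have := @coord_vec_coord _ _ _ c (Ordinal n0) (Ordinal n0) m sc dm.
  by rewrite Z0 eqxx /= => /esym/eqP; rewrite oner_eq0.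
- by move=> a; exact: geq_minr.
Qed.
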